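(* Let $\Omega\subset\mathbb{R}^n$ be a nonempty open set, let $M=(M_p)_{p\in\mathbb{Z}_+}$ be a weight sequence as in the context, and let $\mathcal{B}$ be the set of all bounded sequences in $\mathbb{R}_+^{\mathbb{Z}_+}$. Then, as subsets of $\mathcal{G}(\Omega)$, $$\mathcal{G}^{M,\mathcal{B}}(\Omega)\cap\mathcal{D}'(\Omega)=\mathcal{E}^M(\Omega).$$
   Context: $\mathbb{Z}_+=\{0,1,2,\dots\}$, $\mathbb{R}_+=[0,\infty)$. Colombeau algebra: $\mathcal{X}(\Omega)$ is the set of families $(u_\varepsilon)_\varepsilon\in C^\infty(\Omega)^{]0,1]}$ such that for every compact $K\subset\Omega$ and every $\alpha\in\mathbb{Z}_+^n$ there are $m\in\mathbb{Z}_+$, $C>0$, $\eta\in\,]0,1]$ with $\sup_{K}|\partial^\alpha u_\varepsilon|\le C\varepsilon^{-m}$ for all $\varepsilon\in\,]0,\eta]$. $\mathcal{N}(\Omega)$ is the set of $(u_\varepsilon)_\varepsilon\in\mathcal{X}(\Omega)$ such that for every compact $K\subset\Omega$, every $\alpha$ and every $m\in\mathbb{Z}_+$ there are $C>0$, $\eta\in\,]0,1]$ with $\sup_{K}|\partial^\alpha u_\varepsilon|\le C\varepsilon^{m}$ for all $\varepsilon\in\,]0,\eta]$. $\mathcal{G}(\Omega)=\mathcal{X}(\Omega)/\mathcal{N}(\Omega)$. Weight sequence: positive numbers $(M_p)_{p\in\mathbb{Z}_+}$ with $M_0=1$, (H1) $M_p^2\le M_{p-1}M_{p+1}$ for $p\ge1$,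 (H2) there are $A,H>0$ with $M_p\le AH^pM_qM_{p-q}$ for all $p\ge q$, (H3)$'$ $\sum_{p\ge1}M_{p-1}/M_p<\infty$. $\mathcal{E}^M(\Omega)$ is the space of $f\in C^\infty(\Omega)$ such that for every compact $K\subset\Omega$ there is $c>0$ with $\sup_K|\partial^\alpha f|\le c^{|\alpha|+1}M_{|\alpha|}$ for all $\alpha\in\mathbb{Z}_+^n$. $\mathcal{X}^{M,\mathcal{B}}(\Omega)$ is the set of $(f_\varepsilon)_\varepsilon\in C^\infty(\Omega)^{]0,1]}$ such that for every compact $K\subset\Omega$ there are $N\in\mathcal{B}$, $C>0$, $\varepsilon_0\in\,]0,1]$ with $\sup_{K}|\partial^\alpha f_\varepsilon|\le C^{|\alpha|+1}M_{|\alpha|}\varepsilon^{-N_{|\alpha|}}$ for all $\alpha\in\mathbb{Z}_+^n$ and $\varepsilon\le\varepsilon_0$. $\mathcal{G}^{M,\mathcal{B}}(\Omega)=\mathcal{X}^{M,\mathcal{B}}(\Omega)/(\mathcal{N}(\Omega)\cap\mathcal{X}^{M,\mathcal{B}}(\Omega))\subset\mathcal{G}(\Omega)$. $\mathcal{D}'(\Omega)$ is regarded as a subspace of $\mathcal{G}(\Omega)$ by the standard Colombeau embedding: the linear sheaf embedding which on compactly supported distributions $w$ is $w\mapsto[((w*\rho_\varepsilon)|_\Omega)_\varepsilon]$, where $\rho_\varepsilon(x)=\varepsilon^{-n}\rho(x/\varepsilon)$ and $\rho\in\mathcal{S}(\mathbb{R}^n)$ is fixed with $\int\rho=1$ and $\int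 x^\alpha\rho\,dx=0$ for all $\alpha\neq0$. Its restriction to $C^\infty(\Omega)$ is the constant embedding $u\mapsto[(u)_\varepsilon]$. $\mathcal{E}^M(\Omega)$ is regarded as a subset of $\mathcal{G}(\Omega)$ by this constant embedding. *)

(* Defs.v *)
From HB Require Import structures.
From mathcomp Require Import all_boot all_order all_algebra.
From mathcomp Require Import all_classical all_reals all_analysis.
From mathcomp Require Import complex.

Set Implicit Arguments.
Unset Strict Implicit.
Unset Printing Implicit Defensive.

Import Order.TTheory GRing.Theory Num.Theory.
Import numFieldNormedType.Exports.

Local Open Scope classical_set_scope.
Local Open Scope ring_scope.
Local Open Scope complex_scope.

Local Notation Re := complex.Re.
Local Notation Im := complex.Im.
Local Notation normc := complex.ComplexField.Normc.normc.

Section SmoothFunctions.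
Context {R : realType} {n : nat}.
Implicit Types (A K Omega : set 'rV[R]_n) (f : 'rV[R]_n -> R[i]).
Implicit Types (a : 'I_n -> nat).

Definition iter_partial (s : seq 'I_n) (g : 'rV[R]_n -> R) : 'rV[R]_n -> R :=
  foldr (fun i h => 'D_(delta_mx 0 i) h) g s.

Definition smoothR Omega (g : 'rV[R]_n -> R) : Prop :=
  forall (s : seq 'I_n) (x : 'rV[R]_n), Omega x ->
    {for x, continuous (iter_partial s g)} /\
    forall i : 'I_n, derivable (iter_partial s g) x (delta_mx 0 i).

(* Functions on an open set Omega are represented by total functions whose
   values outside Omega are irrelevant.  Derivatives and integrals of complex
   valued functions are taken componentwise, R[i] not being a normed module
   over R. *)
Definition smooth Omega : set ('rV[R]_n -> R[i]) :=
  [set f | smoothR Omega (fun x => Re (f x)) /\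
           smoothR Omega (fun x => Im (f x))].

Definition mlen a : nat := (\sum_(i < n) a i)%N.

Definition mindices a : seq 'I_n :=
  flatten [seq nseq (a i) i | i <- enum 'I_n].

Definition partial a f : 'rV[R]_n -> R[i] := fun x =>
  iter_partial (mindices a) (fun y => Re (f y)) x +i*
  iter_partial (mindices a) (fun y => Im (f y)) x.

Definition mpow (x : 'rV[R]_n) a : R := \prod_(i < n) x 0 i ^+ a i.

Definition supp f : set 'rV[R]_n := closure [set x | f x != 0].

Definition test_function Omega : set ('rV[R]_n -> R[i]) :=
  [set phi | smooth setT phi /\ compact (supp phi) /\ supp phi `<=` Omega].

Definition schwartz : set ('rV[R]_n -> R[i]) :=
  [set f | smooth setT f /\
    forall a b : 'I_n -> nat, exists C : R,
      forall x, `|mpow x b| * normc (partial a f x) <= C].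

End SmoothFunctions.

Section Colombeau.
Context {R : realType} {n : nat}.
Implicit Types (Omega : set 'rV[R]_n).

(* A net is a family (u_eps) of functions; only eps in ]0,1] matters. *)
Definition net : Type := R -> 'rV[R]_n -> R[i].

Definition moderate Omega : set net :=
  [set u | (forall eps : R, 0 < eps <= 1 -> smooth Omega (u eps)) /\
    forall (K : set 'rV[R]_n) (a : 'I_n -> nat), compact K -> K `<=` Omega ->
      exists (m : nat) (C eta : R), 0 < C /\ 0 < eta <= 1 /\
        forall eps : R, 0 < eps <= eta -> forall x, K x ->
          normc (partial a (u eps) x) <= C * eps ^- m].

Definition negligible_net Omega : set net :=
  [set u | moderate Omega u /\
    forall (K : set 'rV[R]_n) (a : 'I_n -> nat) (m : nat),
      compact K -> K `<=` Omega ->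
      exists C eta : R, 0 < C /\ 0 < eta <= 1 /\
        forall eps : R, 0 < eps <= eta -> forall x, K x ->
          normc (partial a (u eps) x) <= C * eps ^+ m].

Definition net_sub (u v : net) : net := fun eps x => u eps x - v eps x.

(* Cosets also absorb the irrelevant values, i.e. those outside Omega and for
   eps outside ]0,1]. *)
Definition gclass Omega (u : net) : set net :=
  [set v | moderate Omega v /\ negligible_net Omega (net_sub v u)].

(* The quotient X(Omega)/N(Omega), as the set of cosets. *)
Definition colombeau Omega : set (set net) :=
  [set gclass Omega u | u in moderate Omega].

End Colombeau.

Section Ultradifferentiable.
Context {R : realType} {n : nat}.
Implicit Types (Omega : set 'rV[R]_n) (M : nat -> R).

(* Log-convexity and non-quasianalyticity are indexed from 0 instead of 1. *)
Definition weight_sequence M : Prop :=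
  [/\ (forall p, 0 < M p) /\ M 0%N = 1,
      (forall p, M p.+1 ^+ 2 <= M p * M p.+2),
      (exists A H : R, 0 < A /\ 0 < H /\
         forall p q : nat, (q <= p)%N ->
           M p <= A * H ^+ p * M q * M (p - q)%N) &
      cvgn (series (fun p => M p / M p.+1))].

Definition ultradiff Omega M : set ('rV[R]_n -> R[i]) :=
  [set f | smooth Omega f /\
    forall K : set 'rV[R]_n, compact K -> K `<=` Omega ->
      exists c : R, 0 < c /\
        forall (a : 'I_n -> nat) x, K x ->
          normc (partial a f x) <= c ^+ (mlen a).+1 * M (mlen a)].

Definition bounded_sequences : set (nat -> R) :=
  [set N | (forall p, 0 <= N p) /\ exists b : R, forall p, N p <= b].

Definition reg_net Omega M (B : set (nat -> R)) : set (@net R n) :=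
  [set f | (forall eps : R, 0 < eps <= 1 -> smooth Omega (f eps)) /\
    forall K : set 'rV[R]_n, compact K -> K `<=` Omega ->
      exists N : nat -> R, B N /\
      exists C eps0 : R, 0 < C /\ 0 < eps0 <= 1 /\
        forall (a : 'I_n -> nat) (eps : R), 0 < eps <= eps0 ->
          forall x, K x ->
          normc (partial a (f eps) x) <=
            C ^+ (mlen a).+1 * M (mlen a) * eps `^ (- N (mlen a))].

(* Image of X^{M,B}/(N `&` X^{M,B}) under its canonical injection into the
   Colombeau algebra. *)
Definition reg_colombeau Omega M (B : set (nat -> R)) : set (set (@net R n)) :=
  [set gclass Omega u | u in reg_net Omega M B].

Definition ultradiff_colombeau Omega M : set (set (@net R n)) :=
  [set gclass Omega (fun=> f) | f in ultradiff Omega M].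

End Ultradifferentiable.

Section Distributions.
Context {R : realType} {n : nat}.
Implicit Types (Omega V : set 'rV[R]_n).

Definition functional : Type := ('rV[R]_n -> R[i]) -> R[i].

(* Only the values on test functions supported in Omega matter. *)
Definition distribution Omega : set functional :=
  [set T |
    (forall (c : R[i]) phi psi,
       test_function Omega phi -> test_function Omega psi ->
       T (fun x => c * phi x + psi x) = c * T phi + T psi) /\
    forall K : set 'rV[R]_n, compact K -> K `<=` Omega ->
      exists (C : R) (m : nat), forall phi (b : R),
        test_function Omega phi -> supp phi `<=` K ->
        (forall a x, (mlen a <= m)%N -> normc (partial a phi x) <= b) ->
        normc (T phi) <= C * b].

Definition eq_dist_on V (T1 T2 : functional) : Prop :=
  forall phi, test_function V phi -> T1 phi = T2 phi.

Definition supported_in Omega (K : set 'rV[R]_n) (w : functional) : Prop :=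
  [/\ compact K, K `<=` Omega & eq_dist_on (Omega `\` K) w (fun=> 0)].

Definition compact_distribution Omega : set functional :=
  [set w | distribution Omega w /\ exists K, supported_in Omega K w].

Definition cutoffs Omega (w : functional) : set ('rV[R]_n -> R[i]) :=
  [set chi | test_function Omega chi /\
    exists K U : set 'rV[R]_n, supported_in Omega K w /\ open U /\ K `<=` U /\
      forall x, U x -> chi x = 1].

(* The pairing of a compactly supported distribution with a smooth function;
   it does not depend on the chosen cut-off. *)
Definition pairing Omega (w : functional) (psi : 'rV[R]_n -> R[i]) : R[i] :=
  let chi := xget (fun=> 0) (cutoffs Omega w) in
  w (fun y => chi y * psi y).

Definition convolution Omega (w : functional) (psi : 'rV[R]_n -> R[i]) :
    'rV[R]_n -> R[i] :=
  fun x => pairing Omega w (fun y => psi (x - y)).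

End Distributions.

Section Embedding.
Context {R : realType}.

(* Integral over R^n as an iterated integral: it is only applied to Schwartz
   functions, where it is the Lebesgue integral by Fubini's theorem. *)
Fixpoint integral_rV (n : nat) : ('rV[R]_n -> R) -> R :=
  match n with
  | 0%N => fun f => f 0
  | n'.+1 => fun f =>
      \int[@lebesgue_measure R]_x
        integral_rV (fun y : 'rV[R]_n' => f (row_mx (x%:M : 'rV[R]_1) y))
  end.

Definition integral_rVC (n : nat) (f : 'rV[R]_n -> R[i]) : R[i] :=
  integral_rV (fun x => Re (f x)) +i* integral_rV (fun x => Im (f x)).

Definition mollifier (n : nat) : set ('rV[R]_n -> R[i]) :=
  [set rho | schwartz rho /\ integral_rVC rho = 1 /\
    forall a : 'I_n -> nat, (exists i, a i != 0%N) ->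
      integral_rVC (fun x => (mpow x a)%:C * rho x) = 0].

Definition rescale (n : nat) (rho : 'rV[R]_n -> R[i]) (eps : R) :
    'rV[R]_n -> R[i] :=
  fun x => (eps ^- n)%:C * rho (eps^-1 *: x).

(* The image of the distribution T under the sheaf embedding determined by
   w |-> [w * rho_eps] on compactly supported distributions, as a coset: by
   compatibility with restrictions, u represents it iff u restricts to a
   representative of [(w * rho_eps)|_V] on every open V on which T agrees with a
   compactly supported w; such V cover Omega, so the coset is unique. *)
Definition dist_embedding (n : nat) (rho : 'rV[R]_n -> R[i])
    (Omega : set 'rV[R]_n) (T : functional) : set (@net R n) :=
  [set u | moderate Omega u /\
    forall (V : set 'rV[R]_n) (w : functional),
      open V -> V `<=` Omega -> compact_distribution Omega w ->
      eq_dist_on V T w ->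
      negligible_net V
        (net_sub u (fun eps => convolution Omega w (rescale rho eps)))].

Definition dist_colombeau (n : nat) (rho : 'rV[R]_n -> R[i])
    (Omega : set 'rV[R]_n) : set (set (@net R n)) :=
  colombeau Omega `&` [set dist_embedding rho Omega T | T in distribution Omega].

End Embedding.

(* Main.v *)
Require Import Defs.
From mathcomp Require Import all_boot all_order all_algebra.
From mathcomp Require Import all_classical all_reals all_analysis measurable_realfun.
From mathcomp Require Import complex ring lra.

(** Derivatives are indexed by sequences of coordinates throughout, multi-indices
    being recovered by symmetry ([iter_partial_perm]), and complex objects are
    split into real and imaginary parts.

    An ultradifferentiable function is regular and distributional.  The constant
    net of [f] is the image of the distribution phi |-> int f phi
    ([dist_embedding_regular]).  Near a point, this distribution agrees with
    theta f for a cut-off theta, up to a part supported at positive distance, whose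
    mollification is O(eps^m) for every m because the mollifier decreases rapidly
    ([convol_rescR_far]); and int (theta f)(x - eps z) rho(z) dz = (theta f)(x) +
    O(eps^m) by Taylor's formula in each coordinate and the vanishing of the
    moments ([moment_approx]).  Negligibility at order zero suffices, since the
    derivatives follow by Landau's inequality ([rneg_all]).

    Conversely let [u] be a regular net that represents a distribution, so that
    locally u_eps = w * rho_eps + O(eps^m) for all m.

    First, [u] converges.  Averaging w * rho_eps at a scale d exchanges the roles
    of eps and d ([scale_swap], which is Fubini's theorem for [w]).  If
    d^(2q) <= eps <= d^q with q = n + 1, the average differs from u_eps by O(d^m),
    because the derivatives of u_eps are O(eps^-b) with the same [b] for all
    orders, so that each power of [d] gained in the moment expansion costs nothing;
    this is where boundedness of the exponents enters.  It differs from
    w * rho_d by O(d^m) as well: a moment expansion of order [m] involves n m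
    derivatives of w * rho_d, which lose d^(nm), but it gains eps^m <= d^(qm)
    ([two_scale]).  Hence
    u_eps - u_eps' = O(eps^m) for eps^2 <= eps' <= eps, and then for all
    eps' <= eps ([chain_le]).  So [u] differs from a smooth limit [f] by a
    negligible net ([net_limit_real]).

    Second, [f] is ultradifferentiable.  The dyadic differences
    g_j = u_(2^-j-1) - u_(2^-j) have derivatives bounded by
    C^(|a|+1) M_|a| 2^(jb), and they are themselves O(2^(-jm)) for every [m].
    Gorny's interpolation inequality ([gorny_line]), applied one coordinate at a
    time with a step length adapted to the weights ([gorny_step]), turns this into
    bounds E^(|a|+1) M_|a| 2^-j for the derivatives of g_j ([gorny_cube]), which can
    be summed over [j] ([limit_ultradiff]). *)

Set Implicit Arguments.
Unset Strict Implicit.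
Unset Printing Implicit Defensive.

Import Order.TTheory GRing.Theory Num.Theory.
Import numFieldNormedType.Exports.

Local Open Scope classical_set_scope.
Local Open Scope ring_scope.

Local Notation Re := complex.Re.
Local Notation Im := complex.Im.
Local Notation normc := complex.ComplexField.Normc.normc.

(** * Taylor's formula in one variable *)

Section OneVariable.
Context {R : realType}.

Lemma is_derive_continuous (f df : R -> R) (a b : R) :
  (forall t, a <= t <= b -> is_derive t (1 : R) f (df t)) ->
  {within `[a, b], continuous f}.
Proof.
move=> h; apply: derivable_within_continuous => t; rewrite in_itv/= => tab.
by have := h t tab; case.
Qed.

(** Monotonicity form of the mean value theorem; it replaces integration of the derivatives. *)
Lemma increment_le (f df g dg : R -> R) (b : R) : 0 <= b ->
  (forall t, 0 <= t <= b -> is_derive t (1 : R) f (df t)) ->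
  (forall t, 0 <= t <= b -> is_derive t (1 : R) g (dg t)) ->
  (forall t, 0 <= t <= b -> df t <= dg t) ->
  f b - f 0 <= g b - g 0.
Proof.
move=> b0 hf hg hle.
have hd t : 0 <= t <= b -> is_derive t (1 : R) (g - f) (dg t - df t).
  by move=> tb; have := hf t tb; have := hg t tb => ? ?; exact: is_deriveB.
have [c cb E] := @MVT_segment _ (g - f) (fun t => dg t - df t) 0 b b0
  (fun t ht => hd t (ltac:(by move: ht; rewrite in_itv/= => /andP[/ltW-> /ltW->])))
  (is_derive_continuous hd).
have : 0 <= (g - f) b - (g - f) 0.
  by rewrite E subr0 mulr_ge0// subr_ge0 hle//; move: cb; rewrite in_itv.
rewrite /= -![(g - f) _]/(g _ - f _); lra.
Qed.

Lemma is_derive_pow (c : R) k (t : R) :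
  is_derive t (1 : R) (fun t : R => c * t ^+ k.+1 / k.+1`!%:R) (c * t ^+ k / k`!%:R).
Proof.
have hX : is_derive t (1 : R) (fun t : R => t ^+ k.+1) (k.+1%:R *: t ^+ k *: (1 : R)).
  by apply: DeriveDef; [exact: exprn_derivable|exact: exp_derive].
have -> : (fun t : R => c * t ^+ k.+1 / k.+1`!%:R) = (c / k.+1`!%:R) *: (fun t : R => t ^+ k.+1).
  by apply/funext => u; rewrite /= fctE -mulrAC.
apply: (@is_derive_eq _ _ _ _ _ _ _ _ (@is_deriveZ _ _ _ _ _ _ _ _ hX)).
rewrite factS natrM /GRing.scale /= mulr1.
have : (k.+1%:R : R) != 0 by rewrite pnatr_eq0.
have : (k`!%:R : R) != 0 by rewrite pnatr_eq0 -lt0n fact_gt0.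
move=> h1 h2; field; rewrite h1 /=.
by rewrite nat1r.
Qed.

(** Induction on the order: the bound for the derivative integrates, by [increment_le], to the bound for
    the function.  The family [G] stands for the successive derivatives, so that no smoothness of a single
    function has to be assumed outside the segment. *)
Lemma taylor_abs q (G : nat -> R -> R) (b B : R) : 0 <= b ->
  (forall k t, (k < q)%N -> 0 <= t <= b -> is_derive t (1 : R) (G k) (G k.+1 t)) ->
  (forall t, 0 <= t <= b -> `|G q t| <= B) ->
  forall t, 0 <= t <= b ->
  `|G 0%N t - \sum_(k < q) G k 0 * t ^+ k / k`!%:R| <= B * t ^+ q / q`!%:R.
Proof.
move=> b0; elim: q G => [|q IH] G hG hB t tb.
  by rewrite big_ord0 subr0 expr0 fact0 divr1 mulr1; exact: hB.
have {}IH := IH (fun k => G k.+1) (fun k t kq => hG k.+1 t kq) hB.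
have {}hG0 := hG 0%N _ (ltn0Sn q).
rewrite big_ord_recl /= expr0 mulr1 fact0 divr1.
pose P u := \sum_(i < q) G (lift ord0 i) 0 * u ^+ i.+1 / i.+1`!%:R.
pose dP u := \sum_(i < q) G (lift ord0 i) 0 * u ^+ i / i`!%:R.
have dPP u : is_derive u (1 : R) P (dP u).
  have -> : P = \sum_(i < q) (fun u => G (lift ord0 i) 0 * u ^+ i.+1 / i.+1`!%:R).
    by apply/funext => v; rewrite fct_sumE.
  by apply: is_derive_sum => i; exact: is_derive_pow.
pose E u := B * u ^+ q.+1 / q.+1`!%:R.
have dE u : is_derive u (1 : R) E (B * u ^+ q / q`!%:R) by exact: is_derive_pow.
have tb' u : 0 <= u <= t -> 0 <= u <= b.
  by move=> /andP[-> /le_trans ->]//; case/andP: tb.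
have t0 : 0 <= t by case/andP: tb.
have dF u : 0 <= u <= t -> is_derive u (1 : R) (G 0%N - P) (G 1%N u - dP u).
  by move=> /tb' /hG0 ?; have ? := dPP u; exact: is_deriveB.
have dNF u : 0 <= u <= t -> is_derive u (1 : R) (P - G 0%N) (dP u - G 1%N u).
  by move=> /tb' /hG0 ?; have ? := dPP u; exact: is_deriveB.
have P0 : P 0 = 0.
  by rewrite /P big1// => i _; rewrite expr0n /= mulr0 mul0r.
have E0 : E 0 = 0 by rewrite /E expr0n /= mulr0 mul0r.
have IH' u : 0 <= u <= t -> `|G 1%N u - dP u| <= B * u ^+ q / q`!%:R.
  by move=> ut; exact: IH (tb' u ut).
have H1 := @increment_le _ _ E _ t t0 dF (fun u _ => dE u) (fun u ut =>
  le_trans (ler_norm _) (IH' u ut)).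
have H2 : (P - G 0%N) t - (P - G 0%N) 0 <= E t - E 0.
  apply: (@increment_le _ _ E _ t t0 dNF (fun u _ => dE u)) => u ut.
  by rewrite (le_trans (ler_norm _))// distrC IH'.
rewrite -/(P t) -/(E t).
move: H1 H2; rewrite -![(_ - _ : _ -> _) _]/(_ _ - _ _) P0 E0 ler_norml; lra.
Qed.

End OneVariable.

(** * Smooth functions of several variables *)

Section RowVectors.
Context {R : realType} {n : nat}.
Implicit Types (x y : 'rV[R]_n).

Lemma coord_le_norm x i : `|x 0 i| <= `|x|.
Proof.
have /mapP[j Hj ->] : `|x 0 i| \in [seq `|x u.1 u.2| | u : 'I_1 * 'I_n].
  by apply/mapP; exists (0, i) => //=; rewrite mem_enum.
by rewrite [leRHS]/Num.norm /= mx_normrE; apply/bigmax_geP; right => /=; exists j.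
Qed.

Lemma norm_le_coord x r : 0 <= r -> (forall i, `|x 0 i| <= r) -> `|x| <= r.
Proof.
move=> r0 h; rewrite [leLHS]/Num.norm /= mx_normrE.
by apply/bigmax_leP; split => // -[a b] _ /=; rewrite (ord1 a); exact: h.
Qed.

Lemma norm_delta_le i : `|delta_mx 0 i : 'rV[R]_n| <= 1.
Proof.
apply: norm_le_coord => // j; rewrite mxE eqxx /=.
by case: (j == i); rewrite ?normr1 ?normr0.
Qed.

Lemma norm_scale_delta (h : R) i : `|h *: (delta_mx 0 i : 'rV[R]_n)| <= `|h|.
Proof. by rewrite normrZ ler_piMr// norm_delta_le. Qed.

Lemma open_cube (Omega : set 'rV[R]_n) x : open Omega -> Omega x ->
  exists2 r : R, 0 < r & forall y, `|y - x| <= r -> Omega y.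
Proof.
rewrite openE => /(_ x) /[apply] /nbhs_ballP[r /= r0 h].
exists (r / 2) => [|y yr]; first by rewrite divr_gt0.
apply: h; rewrite -ball_normE /=; rewrite distrC (le_lt_trans yr)//.
by rewrite ltr_pdivrMr// mulr_natr mulr2n ltrDl.
Qed.
End RowVectors.

Section Smooth.
Context {R : realType} {n : nat}.
Implicit Types (x y : 'rV[R]_n) (g : 'rV[R]_n -> R) (Omega : set 'rV[R]_n).
Local Notation e i := (delta_mx 0 i : 'rV[R]_n).

Lemma is_derive_line g x i (t : R) : derivable g (x + t *: e i) (e i) ->
  is_derive t (1 : R) (fun u : R => g (x + u *: e i)) ('D_(e i) g (x + t *: e i)).
Proof.
have E : (fun h : R => h^-1 *: (((fun u : R => g (x + u *: e i)) \o shift t) (h *: (1 : R)) -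
    g (x + t *: e i))) = (fun h : R => h^-1 *: ((g \o shift (x + t *: e i)) (h *: e i) - g (x + t *: e i))).
  apply/funext => h /=; congr (_ *: (g _ - _)).
  by rewrite [h%:A]mulr1 scalerDl addrCA.
by move=> d; apply: DeriveDef; rewrite /derivable /derive E.
Qed.

Lemma mvt_line g x i (h : R) : 0 <= h ->
  (forall t, 0 <= t <= h -> derivable g (x + t *: e i) (e i)) ->
  exists2 c, 0 <= c <= h & g (x + h *: e i) - g x = h * 'D_(e i) g (x + c *: e i).
Proof.
move=> h0 d; have D t (th : 0 <= t <= h) := is_derive_line (d t th).
have [c ch E] := @MVT_segment _ (fun u : R => g (x + u *: e i))
  (fun t => 'D_(e i) g (x + t *: e i)) 0 h h0
  (fun t ht => D t (ltac:(by move: ht; rewrite in_itv/= => /andP[/ltW-> /ltW->])))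
  (is_derive_continuous D).
exists c; first by move: ch; rewrite in_itv.
by move: E; rewrite scale0r addr0 subr0 mulrC.
Qed.

(** A quadratic bound on the remainder determines the derivative.  All derivatives of limits, integrals and
    functionals below are found in this way. *)
Lemma is_derive_quad (V : normedModType R) (g : V -> R) (x v : V) (l C d : R) : 0 < d ->
  (forall h, `|h| <= d -> `|g (x + h *: v) - g x - h * l| <= C * h ^+ 2) ->
  is_derive x (v) g l.
Proof.
move=> d0 H.
have C0 : 0 <= C.
  have := H d; rewrite (gtr0_norm d0) lexx => /(_ isT).
  by move=> /(le_trans (normr_ge0 _)); rewrite pmulr_lge0// exprn_gt0.
suff L : h^-1 *: ((g \o shift x) (h *: v) - g x) @[h --> 0^'] --> l.
  apply: DeriveDef; first by apply/cvg_ex; exists l.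
  exact: (cvg_lim _ L).
apply/cvgrPdist_le => eps eps0; near=> h.
have h0 : h != 0 by near: h; exact: nbhs_dnbhs_neq.
have hd : `|h| <= d.
  by near: h; exact: dnbhs0_le.
have hC : `|h| <= eps / (C + 1).
  by near: h; apply: dnbhs0_le; rewrite divr_gt0// ltr_wpDl.
have -> : l - h^-1 *: ((g \o shift x) (h *: v) - g x) =
    - (h^-1 * (g (x + h *: v) - g x - h * l)).
  by rewrite /= [h *: v + x]addrC mulrBr mulKf// opprB.
rewrite normrN normrM normfV ler_pdivrMl ?normr_gt0//.
apply: le_trans (H h hd) _; rewrite -real_normK ?num_real// expr2 mulrCA.
apply: ler_wpM2l => //; apply: le_trans (_ : (C + 1) * `|h| <= _).
  by rewrite ler_wpM2r// lerDl.
by rewrite mulrC -ler_pdivlMr// ltr_wpDl.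
Unshelve. all: by end_near. Qed.

Lemma iter_partial_cat s s' g :
  iter_partial (s ++ s') g = iter_partial s (iter_partial s' g).
Proof. by rewrite /iter_partial foldr_cat. Qed.

Lemma smoothR_iter Omega s g : smoothR Omega g -> smoothR Omega (iter_partial s g).
Proof. by move=> h s' x Ox; rewrite -!iter_partial_cat; exact: h. Qed.

Lemma smoothR_derivable Omega g x i : smoothR Omega g -> Omega x -> derivable g x (e i).
Proof. by move=> h Ox; have [_ +] := h [::] x Ox; exact. Qed.

Lemma smoothR_continuous Omega g x : smoothR Omega g -> Omega x -> {for x, continuous g}.
Proof. by move=> h Ox; have [+ _] := h [::] x Ox; exact. Qed.

Lemma smoothR_sub Omega V g : V `<=` Omega -> smoothR Omega g -> smoothR V g.
Proof. by move=> VO h s x /VO; exact: h. Qed.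

Lemma smoothRT_continuous g : smoothR setT g -> continuous g.
Proof. by move=> h x; exact: smoothR_continuous h I. Qed.

Lemma eq_on_open_near Omega g g' x : open Omega -> Omega x ->
  (forall y, Omega y -> g y = g' y) -> {near x, g =1 g'}.
Proof.
move=> oO Ox E; have : \forall y \near x, Omega y.
  by move: oO; rewrite openE => /(_ x Ox).
by apply: filterS.
Qed.

(** Locality: functions are meaningful only on [Omega], so equality there must carry over to derivatives. *)
Lemma eq_iter_partial Omega g g' : open Omega ->
  (forall y, Omega y -> g y = g' y) ->
  forall s y, Omega y -> iter_partial s g y = iter_partial s g' y.
Proof.
move=> oO E; elim => [|i s IH] y Oy //=; first exact: E.
exact: near_eq_derive (eq_on_open_near oO Oy IH).
Qed.

Lemma eq_smoothR Omega g g' : open Omega -> (forall y, Omega y -> g y = g' y) ->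
  smoothR Omega g -> smoothR Omega g'.
Proof.
move=> oO E sg s x Ox; have [cg dg] := sg s x Ox.
have N := eq_on_open_near oO Ox (eq_iter_partial oO E s).
split=> [|i]; last exact: near_eq_derivable N (dg i).
rewrite /prop_for /continuous_at -(eq_iter_partial oO E s Ox).
exact: cvg_trans (near_eq_cvg N) cg.
Qed.

(** To prove smoothness it suffices to exhibit all candidate derivatives at once and to differentiate each
    of them once. *)
Lemma smoothR_family Omega (G : seq 'I_n -> 'rV[R]_n -> R) : open Omega ->
  (forall s x, Omega x -> {for x, continuous (G s)}) ->
  (forall s i x, Omega x -> is_derive x (e i) (G s) (G (i :: s) x)) ->
  smoothR Omega (G [::]) /\
  forall s x, Omega x -> iter_partial s (G [::]) x = G s x.
Proof.
move=> oO cG dG.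
have E s x : Omega x -> iter_partial s (G [::]) x = G s x.
  elim: s x => [//|i s IH] x Ox /=.
  rewrite (near_eq_derive _ (eq_on_open_near oO Ox IH)).
  by have [] := dG s i x Ox.
split=> // s x Ox.
have N := eq_on_open_near oO Ox (fun y Oy => esym (E s y Oy)).
split=> [|i].
  rewrite /prop_for /continuous_at (E _ _ Ox).
  exact: cvg_trans (near_eq_cvg N) (cG s x Ox).
apply: near_eq_derivable N _.
by have [] := dG s i x Ox.
Qed.
End Smooth.

Section SmoothCalculus.
Context {R : realType} {n : nat}.
Implicit Types (x y : 'rV[R]_n) (f g : 'rV[R]_n -> R) (Omega : set 'rV[R]_n).
Local Notation e i := (delta_mx 0 i : 'rV[R]_n).

Lemma is_derive_translate g v y u l : is_derive (y + v) u g l ->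
  is_derive y u (fun z => g (z + v)) l.
Proof.
have E : (fun h : R => h^-1 *: (((fun z => g (z + v)) \o shift y) (h *: u) - g (y + v))) =
    (fun h : R => h^-1 *: ((g \o shift (y + v)) (h *: u) - g (y + v))).
  by apply/funext => h /=; rewrite addrA.
by move=> [d <-]; apply: DeriveDef; rewrite /derivable /derive E.
Qed.

(** Directional derivatives only see the line through the point, which reduces them to one variable. *)
Lemma is_derive_of_line g x i l :
  is_derive (0 : R) (1 : R) (fun u : R => g (x + u *: e i)) l -> is_derive x (e i) g l.
Proof.
have E : (fun h : R => h^-1 *: (((fun u : R => g (x + u *: e i)) \o shift 0) (h *: (1 : R)) -
    g (x + 0 *: e i))) = (fun h : R => h^-1 *: ((g \o shift x) (h *: e i) - g x)).
  apply/funext => h /=.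
  by rewrite [h%:A]mulr1 addr0 scale0r addr0 [x + _]addrC.
by move=> [+ <-]; rewrite /derivable /derive E => d; apply: DeriveDef.
Qed.

Lemma is_derive_line_scaled g x i (h t : R) : derivable g (x + (t * h) *: e i) (e i) ->
  is_derive t (1 : R) (fun u : R => g (x + (u * h) *: e i))
    (h * 'D_(e i) g (x + (t * h) *: e i)).
Proof.
move=> /is_derive_line d.
have dm : is_derive t (1 : R) (fun u : R => u * h) h.
  have -> : (fun u : R => u * h) = h \*: (id : R -> R).
    by apply/funext => u; rewrite /= mulrC.
  have ? := is_derive_id t (1 : R).
  by apply: is_derive_eq; rewrite /GRing.scale /= mulr1.
have := @is_derive1_comp _ (fun u : R => g (x + u *: e i)) (fun u => u * h) t _ _ d dm.
by rewrite mulrC.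
Qed.

(** The segment is parametrised by [0, 1] so that steps [h] of either sign are covered. *)
Lemma taylor_line Omega g x i (h B : R) q : smoothR Omega g ->
  (forall t, 0 <= t <= 1 -> Omega (x + (t * h) *: e i)) ->
  (forall t, 0 <= t <= 1 -> `|iter_partial (nseq q i) g (x + (t * h) *: e i)| <= B) ->
  `|g (x + h *: e i) - \sum_(k < q) iter_partial (nseq k i) g x * h ^+ k / k`!%:R|
    <= B * `|h| ^+ q / q`!%:R.
Proof.
move=> sg Oh hB.
pose G k t := h ^+ k * iter_partial (nseq k i) g (x + (t * h) *: e i).
have dG k (t : R) : (k < q)%N -> 0 <= t <= 1 -> is_derive t (1 : R) (G k) (G k.+1 t).
  move=> kq t01.
  have -> : G k = h ^+ k \*: (fun u : R => iter_partial (nseq k i) g (x + (u * h) *: e i)).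
    by apply/funext.
  have d := is_derive_line_scaled (smoothR_derivable (i := i) (smoothR_iter (nseq k i) sg) (Oh t t01)).
  by apply: is_derive_eq; rewrite /G exprSr -mulrA.
have bG (t : R) : 0 <= t <= 1 -> `|G q t| <= `|h| ^+ q * B.
  by move=> t01; rewrite normrM normrX ler_wpM2l ?exprn_ge0// hB.
have /= := taylor_abs ler01 dG bG (t := 1); rewrite ler01 lexx => /(_ isT).
rewrite /G expr0 !mul1r expr1n mulr1 [B * _]mulrC.
under eq_bigr do rewrite mul0r scale0r addr0 expr1n mulr1 [h ^+ _ * _]mulrC.
by [].
Qed.

Lemma quad_line Omega g x i (h B : R) : smoothR Omega g ->
  (forall t, 0 <= t <= 1 -> Omega (x + (t * h) *: e i)) ->
  (forall t, 0 <= t <= 1 -> `|iter_partial [:: i; i] g (x + (t * h) *: e i)| <= B) ->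
  `|g (x + h *: e i) - g x - h * 'D_(e i) g x| <= B * h ^+ 2.
Proof.
move=> sg Oh hB; have := @taylor_line Omega g x i h B 2 sg Oh hB.
rewrite !big_ord_recl big_ord0 /= addr0 /bump /= expr0 expr1 fact0 !divr1 mulr1.
rewrite real_normK ?num_real// opprD addrA [h * _]mulrC => /le_trans; apply.
rewrite ler_piMr//; last by rewrite invf_le1// ler1n.
by rewrite mulr_ge0 ?sqr_ge0// (le_trans _ (hB 0 _))// lexx ler01.
Qed.

(** Move from [z] to [y] by changing one coordinate at a time; the cube is convex in each coordinate. *)
Lemma lip_cube g c r (B : R) : 0 <= B ->
  (forall i y, `|y - c| <= r -> derivable g y (e i)) ->
  (forall i y, `|y - c| <= r -> `|'D_(e i) g y| <= B) ->
  forall y z, `|y - c| <= r -> `|z - c| <= r -> `|g y - g z| <= n%:R * B * `|y - z|.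
Proof.
move=> B0 dg hB y z yr zr.
have r0 : 0 <= r by rewrite (le_trans _ yr).
(* the first [k] coordinates of [y], the others of [z] *)
pose w (k : nat) : 'rV[R]_n := \row_j (if (j < k)%N then y 0 j else z 0 j).
have w0 : w 0%N = z by apply/rowP => j; rewrite mxE ltn0.
have wn : w n = y by apply/rowP => j; rewrite mxE ltn_ord.
have wS (k : 'I_n) : w k.+1 = w k + (y 0 k - z 0 k) *: e k.
  apply/rowP => j; rewrite !mxE eqxx /= ltnS leq_eqVlt -val_eqE /=.
  by case: (ltngtP j k) => /= jk; rewrite ?mulr0 ?addr0// (val_inj jk) mulr1 addrC subrK.
have coord (v : 'rV[R]_n) j : `|v - c| <= r -> `|v 0 j - c 0 j| <= r.
  by move=> /(le_trans (coord_le_norm _ j)); rewrite !mxE.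
have line (v : 'rV[R]_n) (i : 'I_n) (h : R) : 0 <= h -> (forall t, 0 <= t <= h -> `|v + t *: e i - c| <= r) ->
    `|g (v + h *: e i) - g v| <= B * h.
  move=> h0 H; have [t th ->] := mvt_line h0 (fun t th => dg i _ (H t th)).
  by rewrite normrM (ger0_norm h0) mulrC ler_wpM2r// hB// H.
have seg (v : 'rV[R]_n) (i : 'I_n) (h : R) : `|v - c| <= r -> `|v + h *: e i - c| <= r ->
    0 <= h -> forall t, 0 <= t <= h -> `|v + t *: e i - c| <= r.
  move=> vr hr h0 t /andP[t0 th]; apply: norm_le_coord => // j; rewrite !mxE eqxx /=.
  have := coord _ j vr; have := coord _ j hr; rewrite !mxE eqxx /=.
  case: (j == i); rewrite ?mulr0 ?mulr1 ?addr0// !ler_norml; lra.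
have wr k : `|w k - c| <= r.
  by apply: norm_le_coord => // j; rewrite !mxE; case: ifP => _; exact: coord.
have step (k : 'I_n) : `|g (w k.+1) - g (w k)| <= B * `|y - z|.
  have yz : `|y 0 k - z 0 k| <= `|y - z| by have := coord_le_norm (y - z) k; rewrite !mxE.
  have := wr k.+1; have := wr k; rewrite wS; set h := (_ - _) in yz *.
  move=> r1 r2; apply: le_trans (_ : B * `|h| <= _); last exact: ler_wpM2l.
  have [h0|h0] := leP 0 h.
    by rewrite (ger0_norm h0); apply: line => //; exact: seg.
  rewrite distrC (ltr0_norm h0).
  have E : w k = (w k + h *: e k) + (- h) *: e k by rewrite scaleNr addrK.
  have h0' : 0 <= - h by rewrite oppr_ge0 ltW.
  rewrite {1}E; apply: line => //; apply: seg => //.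
  by rewrite -E.
have -> : g y - g z = \sum_(k < n) (g (w k.+1) - g (w k)).
  by rewrite -wn -[in LHS]w0 -(big_mkord xpredT (fun k => g (w k.+1) - g (w k))) telescope_sumr.
apply: le_trans (ler_norm_sum _ _ _) _.
apply: le_trans (ler_sum _ (fun k _ => step k)) _.
by rewrite sumr_const card_ord -[leLHS]mulr_natl mulrA.
Qed.

Lemma continuous_of_lip g x (C d : R) : 0 < d ->
  (forall y, `|y - x| <= d -> `|g y - g x| <= C * `|y - x|) -> {for x, continuous g}.
Proof.
move=> d0 H; apply/(@cvgrPdist_le _ _ _ (nbhs x)) => eps eps0; apply/nbhs_ballP.
exists (Num.min d (eps / (`|C| + 1))) => /= [|y].
  by rewrite lt_min d0 divr_gt0// ltr_wpDl.
rewrite -ball_normE /= lt_min => /andP[/ltW yd]; rewrite distrC in yd.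
rewrite distrC ltr_pdivlMr ?ltr_wpDl// => yC.
rewrite distrC (le_trans (H y yd))// (le_trans _ (ltW yC))//.
by rewrite mulrC ler_wpM2l// (le_trans (ler_norm _))// lerDl.
Qed.

(** Quadratic remainders give the derivatives, and local bounds on the next derivatives give continuity:
    continuity of the candidates need not be checked separately. *)
Lemma smoothR_quad_family Omega (G : seq 'I_n -> 'rV[R]_n -> R) : open Omega ->
  (forall s x, Omega x -> exists C d : R, 0 < d /\
     forall y, `|y - x| <= d -> `|G s y| <= C /\
     forall i h, `|h| <= d -> `|G s (y + h *: e i) - G s y - h * G (i :: s) y| <= C * h ^+ 2) ->
  smoothR Omega (G [::]) /\
  forall s x, Omega x -> iter_partial s (G [::]) x = G s x.
Proof.
move=> oO H.
have dG s i x : Omega x -> is_derive x (e i) (G s) (G (i :: s) x).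
  move=> Ox; have [C [d [d0 {}H]]] := H s x Ox.
  apply: (is_derive_quad d0 (C := C)); have [|_] := H x; first by rewrite subrr normr0 ltW.
  by apply.
apply: smoothR_family => // s x Ox.
have [r r0 xr] := open_cube oO Ox.
have /choice[C hC] : forall i, exists C, exists2 d, 0 < d & forall y, `|y - x| <= d -> `|G (i :: s) y| <= C.
  by move=> i; have [C [d [d0 {}H]]] := H (i :: s) x Ox; exists C, d => // y /H[].
have /choice[d hd] : forall i, exists d, 0 < d /\ forall y, `|y - x| <= d -> `|G (i :: s) y| <= C i.
  by move=> i; have [d d0 hd] := hC i; exists d.
pose D := \big[Num.min/r]_i d i.
have D0 : 0 < D by apply: lt_bigmin => // i _; case: (hd i).
have Dr : D <= r by exact: bigmin_le_id.
have Dd i : D <= d i by exact: bigmin_le_cond.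
pose B := \sum_i `|C i|.
have BC i : `|C i| <= B by rewrite /B (bigD1 i)//= lerDl sumr_ge0.
have B0 : 0 <= B by exact: sumr_ge0.
apply: (@continuous_of_lip _ _ (n%:R * B) D) => // y yD.
have inO z : `|z - x| <= D -> Omega z by move=> zD; apply: xr; exact: le_trans zD Dr.
apply: (@lip_cube _ x D) => //; last by rewrite subrr normr0 ltW.
  by move=> i z /inO Oz; case: (dG s i z Oz).
move=> i z zD; have [_ ->] := dG s i z (inO z zD).
have [_ h] := hd i; rewrite (le_trans (h z _))// ?(le_trans zD)//.
by rewrite (le_trans (ler_norm _)).
Qed.
End SmoothCalculus.

(** * Closure properties of smooth functions *)

Section Leibniz.
Context {I : Type}.
(** The ways to distribute the derivatives listed in [s] over the two factors of a product. *)
Fixpoint leibniz_splits (s : seq I) : seq (seq I * seq I) :=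
  if s is i :: s' then
    [seq (i :: p.1, p.2) | p <- leibniz_splits s'] ++
    [seq (p.1, i :: p.2) | p <- leibniz_splits s']
  else [:: ([::], [::])].

Lemma size_leibniz_splits s : size (leibniz_splits s) = (2 ^ size s)%N.
Proof. by elim: s => //= i s IH; rewrite size_cat !size_map IH addnn expnS mul2n. Qed.

End Leibniz.

Lemma leibniz_splits_size (I : eqType) (s : seq I) p : p \in leibniz_splits s ->
  (size p.1 + size p.2 = size s)%N.
Proof.
elim: s p => [|i s IH] p /=; first by rewrite inE => /eqP ->.
rewrite mem_cat => /orP[] /mapP[q /IH <- ->] /=; first by rewrite addSn.
by rewrite addnS.
Qed.

Section Closure.
Context {R : realType} {n : nat}.
Implicit Types (x y : 'rV[R]_n) (f g : 'rV[R]_n -> R) (Omega : set 'rV[R]_n).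
Local Notation e i := (delta_mx 0 i : 'rV[R]_n).

Lemma smoothR_is_derive Omega g s i x : smoothR Omega g -> Omega x ->
  is_derive x (e i) (iter_partial s g) (iter_partial (i :: s) g x).
Proof. by move=> sg Ox; apply: derivableP; have [_] := sg s x Ox. Qed.

Lemma smoothR_cst Omega (c : R) : open Omega -> smoothR Omega (fun=> c) /\
  forall s x, Omega x -> iter_partial s (fun=> c) x = if s is [::] then c else 0.
Proof.
move=> oO.
pose G (s : seq 'I_n) : 'rV[R]_n -> R := fun=> if s is [::] then c else 0.
apply: (@smoothR_family R n Omega G oO) => s x _.
exact: cst_continuous.
Qed.

Lemma smoothR_add Omega f g : open Omega -> smoothR Omega f -> smoothR Omega g ->
  smoothR Omega (fun x => f x + g x) /\
  forall s x, Omega x ->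
    iter_partial s (fun x => f x + g x) x = iter_partial s f x + iter_partial s g x.
Proof.
move=> oO sf sg.
pose G (s : seq 'I_n) x := iter_partial s f x + iter_partial s g x.
apply: (@smoothR_family R n Omega G oO) => [s x Ox|s i x Ox].
  by apply: continuousD; [have [] := sf s x Ox|have [] := sg s x Ox].
have ? := smoothR_is_derive s i sf Ox; have ? := smoothR_is_derive s i sg Ox.
exact: is_deriveD.
Qed.

Lemma smoothR_scale Omega c f : open Omega -> smoothR Omega f ->
  smoothR Omega (fun x => c * f x) /\
  forall s x, Omega x ->
    iter_partial s (fun x => c * f x) x = c * iter_partial s f x.
Proof.
move=> oO sf.
pose G (s : seq 'I_n) x := c * iter_partial s f x.
apply: (@smoothR_family R n Omega G oO) => [s x Ox|s i x Ox].
  by apply: continuousM; [exact: cst_continuous|have [] := sf s x Ox].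
have ? := smoothR_is_derive s i sf Ox.
exact: is_deriveZ.
Qed.

Lemma smoothR_opp Omega f : open Omega -> smoothR Omega f ->
  smoothR Omega (fun x => - f x) /\
  forall s x, Omega x -> iter_partial s (fun x => - f x) x = - iter_partial s f x.
Proof.
move=> oO sf; have [h1 h2] := smoothR_scale (-1) oO sf.
have -> : (fun x => - f x) = (fun x => -1 * f x) by apply/funext => x; rewrite mulN1r.
by split=> // s x Ox; rewrite h2// mulN1r.
Qed.

Lemma smoothR_sub_fun Omega f g : open Omega -> smoothR Omega f -> smoothR Omega g ->
  smoothR Omega (fun x => f x - g x) /\
  forall s x, Omega x ->
    iter_partial s (fun x => f x - g x) x = iter_partial s f x - iter_partial s g x.
Proof.
move=> oO sf sg; have [h1 h2] := smoothR_opp oO sg.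
have [h3 h4] := smoothR_add oO sf h1.
by split=> // s x Ox; rewrite h4// h2.
Qed.

Lemma smoothR_sum Omega (I : Type) (r : seq I) (F : I -> 'rV[R]_n -> R) : open Omega ->
  (forall i, smoothR Omega (F i)) ->
  smoothR Omega (fun x => \sum_(i <- r) F i x) /\
  forall s x, Omega x ->
    iter_partial s (fun x => \sum_(i <- r) F i x) x = \sum_(i <- r) iter_partial s (F i) x.
Proof.
move=> oO sF; elim: r => [|i r [IH1 IH2]].
  have [h1 h2] := smoothR_cst 0 oO.
  have -> : (fun x => \sum_(i <- [::]) F i x) = (fun=> 0 : R).
    by apply/funext => x; rewrite big_nil.
  by split=> // s x Ox; rewrite h2// big_nil; case: s.
have [h1 h2] := smoothR_add oO (sF i) IH1.
have -> : (fun x => \sum_(j <- i :: r) F j x) = (fun x => F i x + \sum_(j <- r) F j x).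
  by apply/funext => x; rewrite big_cons.
by split=> // s x Ox; rewrite h2// big_cons IH2.
Qed.

Lemma smoothR_mul Omega f g : open Omega -> smoothR Omega f -> smoothR Omega g ->
  smoothR Omega (fun x => f x * g x) /\
  forall s x, Omega x ->
    iter_partial s (fun x => f x * g x) x =
    \sum_(p <- leibniz_splits s) iter_partial p.1 f x * iter_partial p.2 g x.
Proof.
move=> oO sf sg.
pose G (s : seq 'I_n) x := \sum_(p <- leibniz_splits s) iter_partial p.1 f x * iter_partial p.2 g x.
have <- : G [::] = (fun x => f x * g x).
  by apply/funext => x; rewrite /G /= big_cons big_nil addr0.
apply: (@smoothR_family R n Omega G oO) => [s x Ox|s i x Ox].
  rewrite /G; elim: (leibniz_splits s) => [|p l IH].
    have -> : (fun x => \sum_(p <- [::]) iter_partial p.1 f x * iter_partial p.2 g x) = (fun=> 0).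
      by apply/funext => z; rewrite big_nil.
    exact: cst_continuous.
  have -> : (fun x => \sum_(p <- p :: l) iter_partial p.1 f x * iter_partial p.2 g x) =
    (fun x => iter_partial p.1 f x * iter_partial p.2 g x +
       \sum_(p <- l) iter_partial p.1 f x * iter_partial p.2 g x).
    by apply/funext => z; rewrite big_cons.
  apply: continuousD; last exact: IH.
  by apply: continuousM; [have [] := sf p.1 x Ox|have [] := sg p.2 x Ox].
rewrite /G /=; elim: (leibniz_splits s) => [|p l IH].
  have -> : (fun x => \sum_(p <- [::]) iter_partial p.1 f x * iter_partial p.2 g x) = (fun=> 0).
    by apply/funext => z; rewrite big_nil.
  by rewrite /= big_nil; exact: is_derive_cst.
have -> : (fun x => \sum_(p <- p :: l) iter_partial p.1 f x * iter_partial p.2 g x) =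
    (fun x => iter_partial p.1 f x * iter_partial p.2 g x) +
     (fun x =>  \sum_(p <- l) iter_partial p.1 f x * iter_partial p.2 g x).
  by apply/funext => z; rewrite big_cons.
have d1 := smoothR_is_derive p.1 i sf Ox; have d2 := smoothR_is_derive p.2 i sg Ox.
have dM := @is_deriveM _ _ _ _ _ _ _ _ d1 d2.
apply: is_derive_eq.
rewrite !map_cons !big_cat !big_cons /GRing.scale /=.
set a := \sum_(p <- _) _; set b := \sum_(p <- _) _; ring.
Qed.

Lemma smoothR_prod Omega (I : Type) (r : seq I) (F : I -> 'rV[R]_n -> R) : open Omega ->
  (forall i, smoothR Omega (F i)) -> smoothR Omega (fun x => \prod_(i <- r) F i x).
Proof.
move=> oO sF; elim: r => [|i r IH].
  have -> : (fun x => \prod_(i <- [::]) F i x) = (fun=> 1 : R).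
    by apply/funext => x; rewrite big_nil.
  by case: (smoothR_cst 1 oO).
have -> : (fun x => \prod_(j <- i :: r) F j x) = (fun x => F i x * \prod_(j <- r) F j x).
  by apply/funext => x; rewrite big_cons.
by case: (smoothR_mul oO (sF i) IH).
Qed.

Lemma smoothR_affine Omega a (c : R) g : open Omega -> smoothR setT g ->
  smoothR Omega (fun y => g (a + c *: y)) /\
  forall s x, Omega x ->
    iter_partial s (fun y => g (a + c *: y)) x = c ^+ size s * iter_partial s g (a + c *: x).
Proof.
move=> oO sg.
pose G (s : seq 'I_n) y := c ^+ size s * iter_partial s g (a + c *: y).
have <- : G [::] = fun y => g (a + c *: y) by apply/funext => y; rewrite /G expr0 mul1r.
have cA x : {for x, continuous (fun y => a + c *: y)}.
  apply: continuousD; first exact: cst_continuous.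
  exact: scaler_continuous.
apply: (@smoothR_family R n Omega G oO) => [s x Ox|s i x Ox].
  apply: continuousM; first exact: cst_continuous.
  apply: (@continuous_comp _ _ _ (fun y => a + c *: y) (iter_partial s g)); first exact: cA.
  by have [] := sg s (a + c *: x) I.
have d : is_derive x (e i) (fun y => iter_partial s g (a + c *: y)) (c * iter_partial (i :: s) g (a + c *: x)).
  apply: is_derive_of_line.
  have -> : (fun u : R => iter_partial s g (a + c *: (x + u *: e i))) =
      (fun u : R => iter_partial s g ((a + c *: x) + (u * c) *: e i)).
    by apply/funext => u; rewrite scalerDr scalerA addrA mulrC.
  have := @is_derive_line_scaled _ _ (iter_partial s g) (a + c *: x) i c 0.
  rewrite mul0r scale0r addr0; apply.
  by have [_] := sg s (a + c *: x) I.
have -> : G s = c ^+ size s \*: (fun y => iter_partial s g (a + c *: y)) by apply/funext.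
by apply: is_derive_eq; rewrite /G /GRing.scale /= exprS; ring.
Qed.

(** Coinductive principle, for functions whose higher derivatives have no convenient closed form, such as
    quotients and flat functions. *)
Lemma smoothR_class Omega (C : set ('rV[R]_n -> R)) : open Omega ->
  (forall g x, C g -> Omega x -> {for x, continuous g}) ->
  (forall g i, C g -> exists2 g', C g' & forall x, Omega x -> is_derive x (e i) g (g' x)) ->
  forall g, C g -> smoothR Omega g.
Proof.
move=> oO cC dC g Cg.
have H s : exists2 g', C g' & forall y, Omega y -> iter_partial s g y = g' y.
  elim: s => [|i s [g' Cg' E]]; first by exists g.
  have [g'' Cg'' D] := dC g' i Cg'; exists g'' => // y Oy /=.
  rewrite (near_eq_derive _ (eq_on_open_near oO Oy E)).
  by have [] := D y Oy.
move=> s x Ox; have [g' Cg' E] := H s.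
have N := eq_on_open_near oO Ox (fun y Oy => esym (E y Oy)).
split=> [|i].
  rewrite /prop_for /continuous_at (E _ Ox).
  exact: cvg_trans (near_eq_cvg N) (cC g' x Cg' Ox).
have [g'' _ D] := dC g' i Cg'.
by apply: near_eq_derivable N _; case: (D x Ox).
Qed.

(** The functions p / f^k with [p] smooth form a class closed under differentiation. *)
Lemma smoothR_inv Omega f : open Omega -> smoothR Omega f ->
  (forall x, Omega x -> f x != 0) -> smoothR Omega (fun x => (f x)^-1).
Proof.
move=> oO sf f0.
pose C : set ('rV[R]_n -> R) := [set g | exists p k, smoothR Omega p /\ g = (fun x => p x * (f x)^-1 ^+ k)].
have cf x : Omega x -> {for x, continuous (fun x => (f x)^-1)}.
  by move=> Ox; apply: continuousV; [exact: f0|exact: (smoothR_continuous sf)].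
have cfk k x : Omega x -> {for x, continuous (fun x => (f x)^-1 ^+ k)}.
  move=> Ox; elim: k => [|k IH].
    have -> : (fun x => (f x)^-1 ^+ 0) = (fun=> 1) by apply/funext => y; rewrite expr0.
    exact: cst_continuous.
  have -> : (fun x => (f x)^-1 ^+ k.+1) = (fun x => (f x)^-1 * (f x)^-1 ^+ k).
    by apply/funext => y; rewrite exprS.
  by apply: continuousM => //; exact: cf.
apply: (@smoothR_class Omega C) => //.
- move=> g x [p [k [sp ->]]] Ox; apply: continuousM; last exact: cfk.
  exact: (smoothR_continuous sp).
- move=> g i [p [k [sp ->]]].
  exists (fun x => ('D_(e i) p x * f x - k%:R * p x * 'D_(e i) f x) * (f x)^-1 ^+ k.+1).
    exists (fun x => 'D_(e i) p x * f x - k%:R * p x * 'D_(e i) f x), k.+1; split=> //.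
    have [s1 _] := smoothR_mul oO (smoothR_iter [:: i] sp) sf.
    have [s2 _] := smoothR_mul oO (smoothR_scale k%:R oO sp).1 (smoothR_iter [:: i] sf).
    by have [] := smoothR_sub_fun oO s1 s2.
  move=> x Ox.
  have d1 := smoothR_is_derive [::] i sp Ox; have d2 := smoothR_is_derive [::] i sf Ox.
  have fx := f0 x Ox.
  have dk : is_derive x (e i) (fun x => (f x)^-1 ^+ k) (- k%:R * 'D_(e i) f x * (f x)^-1 ^+ k.+1).
    elim: k => [|k IH].
      have -> : (fun x => (f x)^-1 ^+ 0) = (fun=> 1) by apply/funext => y; rewrite expr0.
      by rewrite oppr0 !mul0r; exact: is_derive_cst.
    have -> : (fun x => (f x)^-1 ^+ k.+1) = (fun x => (f x)^-1) * (fun x => (f x)^-1 ^+ k).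
      by apply/funext => y; rewrite exprS.
    have dV : is_derive x (e i) (fun x => (f x)^-1) (- (f x) ^- 2 *: 'D_(e i) f x).
      by apply: DeriveDef; [apply: derivableV => //; case: d2|rewrite deriveV//; case: d2].
    apply: is_derive_eq; rewrite /GRing.scale /= !exprS -natr1.
    by field.
  have -> : (fun x => p x * (f x)^-1 ^+ k) = p * (fun x => (f x)^-1 ^+ k) by [].
  apply: is_derive_eq; rewrite /GRing.scale /= exprS; by field.
- exists (fun=> 1), 1%N; split; first by case: (smoothR_cst 1 oO).
  by apply/funext => x; rewrite mul1r expr1.
Qed.
End Closure.

(** * Symmetry of partial derivatives *)

Lemma dist_le_of_common (R : realType) (a b c d z : R) :
  `|a - c| <= z / 2 -> `|b - d| <= z / 2 -> d = c -> `|a - b| <= z.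
Proof. by move=> + + E'; rewrite E' !ler_norml; lra. Qed.

Section Symmetry.
Context {R : realType} {n : nat}.
Implicit Types (x y : 'rV[R]_n) (f g : 'rV[R]_n -> R) (Omega : set 'rV[R]_n).
Local Notation e i := (delta_mx 0 i : 'rV[R]_n).

(** Two applications of the mean value theorem, one per variable; the left-hand side is symmetric in [i]
    and [j], whence the symmetry of second derivatives. *)
Lemma second_difference g x i j (h : R) Omega : smoothR Omega g -> 0 <= h ->
  (forall y, `|y - x| <= h + h -> Omega y) ->
  exists2 p, `|p - x| <= h + h &
    g (x + h *: e i + h *: e j) - g (x + h *: e i) - (g (x + h *: e j) - g x)
      = h * (h * 'D_(e j) ('D_(e i) g) p).
Proof.
move=> sg h0 hO.
have near1 (t u : R) : 0 <= t <= h -> 0 <= u <= h -> `|x + t *: e i + u *: e j - x| <= h + h.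
  move=> /andP[t0 th] /andP[u0 uh]; rewrite addrAC [x + _]addrC addrK.
  apply: le_trans (ler_normD _ _) _.
  by apply: lerD; apply: le_trans (norm_scale_delta _ _) _; rewrite ger0_norm.
have near0 (t : R) : 0 <= t <= h -> `|x + t *: e i - x| <= h + h.
  by move=> th; have := near1 t 0 th; rewrite scale0r addr0 lexx; apply.
have dphi (t : R) : 0 <= t <= h -> is_derive (x + t *: e i) (e i)
    (fun y => g (y + h *: e j) - g y)
    ('D_(e i) g (x + t *: e i + h *: e j) - 'D_(e i) g (x + t *: e i)).
  move=> th.
  have d1 := is_derive_translate (smoothR_is_derive [::] i sg (hO _ (near1 t h th (ltac:(by rewrite h0 lexx))))).
  have d2 := smoothR_is_derive [::] i sg (hO _ (near0 t th)).
  exact: is_deriveB.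
have [c ch E1] := mvt_line h0 (fun t th => @ex_derive _ _ _ _ _ _ _ (dphi t th)).
have [d dh E2] := @mvt_line _ _ ('D_(e i) g) (x + c *: e i) j h h0
  (fun t th => @ex_derive _ _ _ _ _ _ _ (smoothR_is_derive [:: i] j sg (hO _ (near1 c t ch th)))).
exists (x + c *: e i + d *: e j); first exact: near1.
by rewrite E1 (@derive_val _ _ _ _ _ _ _ (dphi c ch)) E2.
Qed.

Lemma partial_comm Omega g x i j : open Omega -> smoothR Omega g -> Omega x ->
  'D_(e i) ('D_(e j) g) x = 'D_(e j) ('D_(e i) g) x.
Proof.
move=> oO sg Ox.
have [r r0 xr] := open_cube oO Ox.
have c1 : {for x, continuous ('D_(e i) ('D_(e j) g))} by case: (sg [:: i; j] x Ox).
have c2 : {for x, continuous ('D_(e j) ('D_(e i) g))} by case: (sg [:: j; i] x Ox).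
apply/eqP; rewrite -subr_eq0 -normr_le0; apply/ler_addgt0Pl => eps eps0; rewrite addr0.
have e2 : 0 < eps / 2 by rewrite divr_gt0.
move/(@cvgrPdist_le _ _ _ (nbhs x)) : c1 => /(_ _ e2) /nbhs_ballP[d1 /= d10 h1].
move/(@cvgrPdist_le _ _ _ (nbhs x)) : c2 => /(_ _ e2) /nbhs_ballP[d2 /= d20 h2].
pose h := Num.min (r / 2) (Num.min (d1 / 4) (d2 / 4)).
have h0 : 0 < h by rewrite !lt_min !divr_gt0.
have hr : h + h <= r.
  have : h <= r / 2 by rewrite ge_min lexx.
  lra.
have hd1 : h + h < d1.
  have : h <= d1 / 4 by rewrite !ge_min lexx orbT.
  lra.
have hd2 : h + h < d2.
  have : h <= d2 / 4 by rewrite !ge_min lexx !orbT.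
  lra.
have hO y : `|y - x| <= h + h -> Omega y by move=> yh; apply: xr; exact: le_trans yh hr.
have [p px Ep] := second_difference i j sg (ltW h0) hO.
have [q qx Eq] := second_difference j i sg (ltW h0) hO.
have E : 'D_(e j) ('D_(e i) g) p = 'D_(e i) ('D_(e j) g) q.
  apply: (mulfI (lt0r_neq0 h0)); apply: (mulfI (lt0r_neq0 h0)).
  apply: etrans (esym Ep) (etrans _ Eq).
  by rewrite (addrAC x (h *: e j)); ring.
have H1 : `|'D_(e i) ('D_(e j) g) x - 'D_(e i) ('D_(e j) g) q| <= eps / 2.
  by apply: h1; rewrite -ball_normE /= distrC (le_lt_trans qx).
have H2 : `|'D_(e j) ('D_(e i) g) x - 'D_(e j) ('D_(e i) g) p| <= eps / 2.
  by apply: h2; rewrite -ball_normE /= distrC (le_lt_trans px).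
exact: dist_le_of_common H1 H2 E.
Qed.

Lemma iter_partial_perm Omega g s s' x : open Omega -> smoothR Omega g -> Omega x ->
  perm_eq s s' -> iter_partial s g x = iter_partial s' g x.
Proof.
move=> oO sg Ox.
have front i s1 s2 y : Omega y -> iter_partial (s1 ++ i :: s2) g y = iter_partial (i :: s1 ++ s2) g y.
  elim: s1 y => [//|j s1 IH] y Oy /=.
  rewrite (near_eq_derive _ (eq_on_open_near oO Oy IH)) /=.
  exact: (partial_comm _ _ oO (smoothR_iter (s1 ++ s2) sg) Oy).
elim: s s' x Ox => [|i s IH] s' x Ox.
  by rewrite perm_sym => /perm_nilP ->.
move=> H; have : i \in s' by rewrite -(perm_mem H) mem_head.
move=> /path.splitPr S; case: S H => s1 s2 H.
have {}H : perm_eq s (s1 ++ s2).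
  by rewrite -(perm_cons i) (perm_trans H)// -cat1s perm_catCA.
rewrite front//=.
exact: near_eq_derive (eq_on_open_near oO Ox (fun y Oy => IH (s1 ++ s2) y Oy H)).
Qed.

Lemma size_mindices (a : 'I_n -> nat) : size (mindices a) = mlen a.
Proof.
rewrite /mindices size_flatten /shape -map_comp sumnE big_map big_enum /=.
by apply: eq_bigr => i _; rewrite size_nseq.
Qed.

Lemma perm_mindices (s : seq 'I_n) : perm_eq s (mindices (fun i => count_mem i s)).
Proof.
apply/allP => j _ /=; apply/eqP.
rewrite /mindices count_flatten -map_comp sumnE big_map big_enum /=.
rewrite (bigD1 j)//= big1 ?addn0 => [|i ij]; first by rewrite count_nseq /= eqxx mul1n.
by rewrite count_nseq /= (negbTE ij).
Qed.

Lemma iter_partial_mindices Omega g s x : open Omega -> smoothR Omega g -> Omega x ->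
  iter_partial s g x = iter_partial (mindices (fun i => count_mem i s)) g x.
Proof. by move=> oO sg Ox; exact: (iter_partial_perm oO sg Ox (perm_mindices s)). Qed.

Lemma mlen_count (s : seq 'I_n) : mlen (fun i => count_mem i s) = size s.
Proof. by rewrite -size_mindices (perm_size (perm_mindices s)). Qed.

(** The seminorms that measure the order of a distribution. *)
Definition dbound (m : nat) (K : set 'rV[R]_n) g (B : R) :=
  forall s y, (size s <= m)%N -> K y -> `|iter_partial s g y| <= B.

Lemma dbound_ge0 m K g B y : K y -> dbound m K g B -> 0 <= B.
Proof. by move=> Ky /(_ [::] y (leq0n _) Ky); exact: le_trans. Qed.

Lemma dbound_mul Omega m K f g A B : open Omega -> K `<=` Omega ->
  smoothR Omega f -> smoothR Omega g -> dbound m K f A -> dbound m K g B ->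
  dbound m K (fun x => f x * g x) (2 ^+ m * A * B).
Proof.
move=> oO KO sf sg hA hB s y sm Ky.
have A0 := dbound_ge0 Ky hA; have B0 := dbound_ge0 Ky hB.
have [_ ->] := smoothR_mul oO sf sg; last exact: KO.
apply: le_trans (ler_norm_sum _ _ _) _.
apply: le_trans (_ : \sum_(p <- leibniz_splits s) A * B <= _).
  rewrite big_seq [leRHS]big_seq; apply: ler_sum => p ps.
  have sp := leibniz_splits_size ps.
  rewrite normrM ler_pM//; [apply: hA|apply: hB] => //; apply: leq_trans _ sm;
    by rewrite -sp ?leq_addr ?leq_addl.
rewrite big_const_seq count_predT size_leibniz_splits iter_addr_0 -mulrA -[leLHS]mulr_natl.
rewrite natrX.
apply: ler_wpM2r; first exact: mulr_ge0.
by rewrite ler_weXn2l// ler1n.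
Qed.

(** There are finitely many multi-indices of order at most [m], so bounds can be made uniform in them. *)
Lemma short_seqs_bound (m : nat) (P : seq 'I_n -> R -> Prop) :
  (forall s, exists B, P s B) -> (forall s B B', B <= B' -> P s B -> P s B') ->
  exists2 B : R, 0 < B & forall s, (size s <= m)%N -> P s B.
Proof.
move=> eP mP.
have many (l : seq (seq 'I_n)) : exists2 B : R, 0 < B & forall s, s \in l -> P s B.
  elim: l => [|s l [B B0 hB]]; first by exists 1.
  have [B' hB'] := eP s; exists (B + `|B'|) => [|t]; first by rewrite ltr_wpDr.
  rewrite inE => /orP[/eqP ->|tl].
    apply: mP hB'; rewrite (le_trans (ler_norm _))// lerDr; exact: ltW.
  by apply: mP (hB t tl); rewrite lerDl.
have [B B0 hB] := many (flatten [seq map val (enum {: k.-tuple 'I_n}) | k <- iota 0 m.+1]).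
exists B => // s sm; apply: hB.
apply/flattenP; exists (map val (enum {: (size s).-tuple 'I_n})).
  by apply/mapP; exists (size s) => //; rewrite mem_iota add0n ltnS.
by apply/mapP; exists (in_tuple s) => //; rewrite mem_enum.
Qed.

Lemma compact_dbound Omega m K g : open Omega -> compact K -> K `<=` Omega -> smoothR Omega g ->
  exists2 B, 0 < B & dbound m K g B.
Proof.
move=> oO cK KO sg.
have one s : exists2 B, 0 < B & forall y, K y -> `|iter_partial s g y| <= B.
  have cg : {within K, continuous (iter_partial s g)}.
    apply: continuous_in_subspaceT => y; rewrite inE => /KO Oy.
    exact: (smoothR_continuous (smoothR_iter s sg)).
  have := continuous_compact cg cK => /compact_bounded [M [Mr hM]].
  exists (`|M| + 1) => [|y Ky]; first by rewrite ltr_wpDl.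
  apply: (hM (`|M| + 1)); last by exists y.
  by rewrite (le_lt_trans (ler_norm _))// ltrDl.
have [//||B B0 hB] := @short_seqs_bound m (fun s B => forall y, K y -> `|iter_partial s g y| <= B).
- by move=> s; have [B _ hB] := one s; exists B.
- by move=> s B B' BB H y Ky; rewrite (le_trans (H y Ky)).
by exists B => // s y sm; exact: hB.
Qed.
End Symmetry.

(** * Integrals on the line *)

Section Line.
Context {R : realType}.
Local Notation mu := (@lebesgue_measure R).
Implicit Types (h : R -> R) (L : R).

Lemma oneDsqrV_ge0 (t : R) : 0 <= (oneDsqr t)^-1.
Proof. by rewrite invr_ge0 addr_ge0// sqr_ge0. Qed.

(** The weight 1 / (1 + t^2) is the standard integrable majorant used throughout. *)
Lemma integrable_oneDsqrV : mu.-integrable setT (EFin \o (fun t : R => (oneDsqr t)^-1)).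
Proof.
apply/integrableP; split.
  by apply/measurable_EFinP; apply: continuous_measurable_fun; exact: continuous_oneDsqrV.
rewrite /=; have -> : (fun x : R => `|(oneDsqr x)^-1|%:E) = (fun t : R => ((oneDsqr t)^-1)%:E).
  by apply/funext => t /=; rewrite ger0_norm// oneDsqrV_ge0.
rewrite ge0_symfun_integralT//=.
- have -> : [set x : R | 0 <= x] = `[0, +oo[%classic by apply/seteqP; split => x /=; rewrite in_itv /= andbT.
  by rewrite integral0y_oneDsqr -EFinM ltry.
- exact: continuous_oneDsqrV.
- by move=> t; rewrite /oneDsqr /= sqrrN.
Qed.

Lemma Rintegral_oneDsqrV_ge0 : 0 <= \int[mu]_t (oneDsqr t)^-1.
Proof. by apply: Rintegral_ge0 => t _; exact: oneDsqrV_ge0. Qed.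

Lemma dominated_integrable1 h L : continuous h ->
  (forall t, `|h t| <= L * (oneDsqr t)^-1) -> mu.-integrable setT (EFin \o h).
Proof.
move=> ch hL.
apply: (le_integrable measurableT _ _ (integrableZl measurableT L integrable_oneDsqrV)).
- by apply/measurable_EFinP; exact: continuous_measurable_fun.
- by move=> t _; rewrite /= lee_fin (le_trans (hL t))// ler_norm.
Qed.

Lemma Rintegral_le_dominated h L : continuous h ->
  (forall t, `|h t| <= L * (oneDsqr t)^-1) ->
  `|\int[mu]_t h t| <= L * \int[mu]_t (oneDsqr t)^-1.
Proof.
move=> ch hL; have ih := dominated_integrable1 ch hL.
apply: le_trans (le_normr_Rintegral _ ih) _ => //.
rewrite -RintegralZl//; last exact: integrable_oneDsqrV.
apply: le_Rintegral => //; first exact: integrable_norm.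
exact: (integrableZl measurableT L integrable_oneDsqrV).
Qed.

Lemma Rintegral_dominated_cvg (u : nat -> R -> R) h L :
  continuous h -> (forall t, `|h t| <= L * (oneDsqr t)^-1) ->
  (forall k, continuous (u k)) -> (forall k t, `|u k t| <= L * (oneDsqr t)^-1) ->
  (forall t, u k t @[k --> \oo] --> h t) ->
  \int[mu]_t u k t @[k --> \oo] --> \int[mu]_t h t.
Proof.
move=> ch hL cu uL uh.
have iL : mu.-integrable setT (EFin \o (fun t : R => L * (oneDsqr t)^-1)).
  exact: (integrableZl measurableT L integrable_oneDsqrV).
have ih := dominated_integrable1 ch hL.
pose g : R -> R := fun t => L * (oneDsqr t)^-1.
have H : ((\int[mu]_t (u k t)%:E)%E @[k --> \oo] --> (\int[mu]_t (h t)%:E)%E).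
  apply: (@dominated_cvg _ _ _ mu setT measurableT (fun k => EFin \o u k) (EFin \o h) (EFin \o g)) => //.
  - by move=> k; apply/measurable_EFinP; exact: continuous_measurable_fun.
  - by move=> t _; apply: cvg_EFin; [exact: nearW|exact: uh].
  - by move=> k t _; rewrite /= lee_fin.
apply: fine_cvg; rewrite fineK//.
exact: (integrable_fin_num measurableT ih).
Qed.

Lemma Rintegral_affine_ge0 h (a c : R) : 0 < c -> continuous h -> (forall t, 0 <= h t) ->
  (\int[mu]_t (h t)%:E = \int[mu]_t (h (a + c * t) * c)%:E)%E.
Proof.
move=> c0 ch h0; pose F (t : R) := a + c * t.
have dF (t : R) : is_derive t (1 : R) F c.
  have -> : F = cst a + (c \*: (id : R -> R)) by apply/funext.
  apply: is_derive_eq.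
  by rewrite add0r /GRing.scale /= mulr1.
have F' : F^`()%classic = cst c by apply/funext => t; rewrite derive1E; have [_] := dF t.
rewrite (@increasing_ge0_integration_by_substitutionT _ F)//.
- by rewrite F'.
- by move=> x y xy; rewrite ltrD2l ltr_pM2l.
- by rewrite F' => ?; exact: cst_continuous.
- by rewrite F'; exact: is_cvg_cst.
- by rewrite F'; exact: is_cvg_cst.
- apply/cvgrNyPle => A; exists ((A - a) / c); split; first exact: num_real.
  by move=> t tA; rewrite /F -lerBrDl mulrC -ler_pdivlMr// ltW.
- apply/cvgryPge => A; exists ((A - a) / c); split; first exact: num_real.
  by move=> t tA; rewrite /F -lerBlDl mulrC -ler_pdivrMr// ltW.
Qed.

Lemma Rintegral_opp_ge0 h : continuous h -> (forall t, 0 <= h t) ->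
  (\int[mu]_t (h t)%:E = \int[mu]_t (h (- t))%:E)%E.
Proof.
move=> ch h0.
have split_ (g : R -> R) : continuous g -> (forall t, 0 <= g t) ->
  (\int[mu]_t (g t)%:E = \int[mu]_(t in `]-oo, 0%R]) (g t)%:E + \int[mu]_(t in `[0%R, +oo[) (g t)%:E)%E.
  move=> cg g0.
  have mg : measurable_fun setT (EFin \o g).
    by apply/measurable_EFinP; exact: continuous_measurable_fun.
  rewrite -integral_itv_obnd_cbnd; last exact: measurable_funTS.
  rewrite -ge0_integral_setU//=.
  - by rewrite -setCitvr setvU.
  - exact: measurable_funTS.
  - by move=> t _; rewrite lee_fin.
  - rewrite disj_set2E; apply/eqP; rewrite -subset0 => x []/= /[!in_itv]/=.
    by rewrite leNgt andbT => /negP.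
have cN : continuous (fun t => h (- t)).
  by move=> t; apply: (@continuous_comp _ _ _ -%R h); [exact: oppr_continuous|exact: ch].
rewrite split_// [RHS]split_// addeC.
have E := @ge0_integration_by_substitutionNy R _ 0 (continuous_subspaceT ch) (fun t _ => h0 t).
have E' := @ge0_integration_by_substitutionNy R _ 0 (continuous_subspaceT cN) (fun t _ => h0 _).
rewrite oppr0 in E E'; rewrite E E'; congr (_ + _)%E.
by apply: eq_integral => t _ /=; rewrite opprK.
Qed.

Lemma dominated_pos h L : continuous h -> (forall t, `|h t| <= L * (oneDsqr t)^-1) ->
  [/\ continuous (fun t => Num.max (h t) 0), continuous (fun t => Num.max (- h t) 0),
    (forall t, `|Num.max (h t) 0| <= L * (oneDsqr t)^-1),
    (forall t, `|Num.max (- h t) 0| <= L * (oneDsqr t)^-1) &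
    forall t, h t = Num.max (h t) 0 - Num.max (- h t) 0].
Proof.
move=> ch hL.
have aux (g : R -> R) : continuous g -> (forall t, `|g t| <= L * (oneDsqr t)^-1) ->
  continuous (fun t => Num.max (g t) 0) /\ forall t, `|Num.max (g t) 0| <= L * (oneDsqr t)^-1.
  move=> cg gL; split=> t.
    apply: (@continuous_max _ _ g (fun=> 0) t); [exact: cg|exact: cst_continuous].
  rewrite ger0_norm ?le_max ?lexx ?orbT//.
  rewrite ge_max (le_trans (ler_norm _) (gL t)) /=.
  by rewrite (le_trans _ (gL t)).
have [c1 l1] := aux h ch hL.
have [c2 l2] : continuous (fun t => Num.max (- h t) 0) /\ forall t, `|Num.max (- h t) 0| <= L * (oneDsqr t)^-1.
  apply: (aux (fun t => - h t)) => [t|t]; last by rewrite normrN.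
  by apply: continuousN; exact: ch.
split=> // t; rewrite !maxEle oppr_le0; case: (lerP 0 (h t)) => ht.
  by case: ltgtP ht => // [|<-]; rewrite ?subr0.
by rewrite (ltW ht) sub0r opprK.
Qed.

(** Positive and negative parts are substituted separately: for nonnegative integrands the substitution rule
    holds before integrability is known. *)
Lemma Rintegral_subst h L (a c : R) : 0 < c -> continuous h ->
  (forall t, `|h t| <= L * (oneDsqr t)^-1) ->
  \int[mu]_t h (a - c * t) = c^-1 * \int[mu]_t h t.
Proof.
move=> c0 ch hL.
have cA (g : R -> R) : continuous g -> continuous (fun t => g (a - c * t)).
  move=> cg t; apply: (@continuous_comp _ _ _ (fun t => a - c * t) g); last exact: cg.
  apply: continuousB; first exact: cst_continuous.
  by apply: continuousM; [exact: cst_continuous|].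
have pos (g : R -> R) : continuous g -> (forall t, 0 <= g t) -> (forall t, `|g t| <= L * (oneDsqr t)^-1) ->
    \int[mu]_t g (a - c * t) = c^-1 * \int[mu]_t g t /\
    mu.-integrable setT (EFin \o (fun t => g (a - c * t))).
  move=> cg g0 gL.
  have ig := dominated_integrable1 cg gL.
  have E : (\int[mu]_t (g t)%:E = c%:E * \int[mu]_t (g (a - c * t))%:E)%E.
    rewrite (@Rintegral_affine_ge0 _ a c)//.
    have cB : continuous (fun t => g (a + c * t)).
      move=> t; apply: (@continuous_comp _ _ _ (fun t => a + c * t) g); last exact: cg.
      apply: continuousD; first exact: cst_continuous.
      by apply: continuousM; [exact: cst_continuous|].
    under eq_integral do rewrite mulrC EFinM.
    rewrite ge0_integralZl//.
    - congr (_ * _)%E; rewrite Rintegral_opp_ge0//; last exact: cA.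
      by apply: eq_integral => t _; rewrite mulrN opprK.
    - by apply/measurable_EFinP; exact: continuous_measurable_fun.
    - by move=> t _; rewrite lee_fin.
    - by rewrite lee_fin ltW.
  have i2 : mu.-integrable setT (EFin \o (fun t => g (a - c * t))).
    apply/integrableP; split.
      by apply/measurable_EFinP; apply: continuous_measurable_fun; exact: cA.
    under eq_integral do rewrite /= ger0_norm//.
    have := integrable_fin_num measurableT ig; rewrite /= E => fE.
    rewrite ltey; apply/negP => /eqP oo; move: fE.
    by rewrite oo mulr_infty gtr0_sg// mul1e.
  split=> //.
  rewrite /Rintegral E fineM//; last exact: integrable_fin_num.
  by rewrite mulKf// gt_eqF.
have [c1 c2 l1 l2 E] := dominated_pos ch hL.
have m0 (g : R -> R) (t : R) : 0 <= Num.max (g t) 0 :> R by rewrite le_max lexx orbT.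
have [E1 i1] := pos _ c1 (m0 _) l1.
have [E2 i2] := pos _ c2 (m0 (fun t => - h t)) l2.
under eq_Rintegral do rewrite E.
rewrite RintegralB// E1 E2 -mulrBr -RintegralB//.
- by congr (_ * _); apply: eq_Rintegral => t _; rewrite -E.
- exact: dominated_integrable1 c1 l1.
- exact: dominated_integrable1 c2 l2.
Qed.
End Line.

(** * Quadrature on the line *)

Section Quadrature1.
Context {R : realType}.
Local Notation mu := (@lebesgue_measure R).

Lemma tail_oneDsqrV (tau : R) : 0 < tau -> exists k : nat,
  \int[mu]_(t in ~` `[- k%:R, k%:R]) (oneDsqr t)^-1 <= tau.
Proof.
move=> tau0.
pose g : R -> R := fun t => (oneDsqr t)^-1.
pose u (k : nat) : R -> R := g \_ `[- k%:R, k%:R].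
have ig := @integrable_oneDsqrV R.
have H : ((\int[mu]_t (u k t)%:E)%E @[k --> \oo] --> (\int[mu]_t (g t)%:E)%E).
  apply: (@dominated_cvg _ _ _ mu setT measurableT (fun k => EFin \o u k) (EFin \o g) (EFin \o g)) => //.
  - move=> k; apply/measurable_EFinP; apply/(measurable_restrictT g) => //.
    by apply: measurable_funTS; apply: continuous_measurable_fun; exact: continuous_oneDsqrV.
  - move=> t _; apply: cvg_EFin; first exact: nearW.
    apply: cvg_near_cst; near=> k.
    rewrite /u /= patchE mem_set//= in_itv /= -ler_norml.
    by near: k; exact: nbhs_infty_ger.
  - move=> k t _; rewrite /= lee_fin /u patchE; case: ifP => _.
      by rewrite ger0_norm// oneDsqrV_ge0.
    by rewrite normr0 oneDsqrV_ge0.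
have {}H : \int[mu]_t u k t @[k --> \oo] --> \int[mu]_t g t.
  by apply: fine_cvg; rewrite fineK//; exact: (integrable_fin_num measurableT ig).
move/(@cvgrPdist_le _ _ _ \oo) : H => /(_ _ tau0) [k _ /(_ k (leqnn k)) /= Hk].
exists k; have E : \int[mu]_t g t = \int[mu]_(t in `[- k%:R, k%:R]) g t + \int[mu]_(t in ~` `[- k%:R, k%:R]) g t.
  rewrite -Rintegral_setU ?setUv//; first exact: measurableC.
  by rewrite disj_set2E setICr.
move: Hk; rewrite E /u -Rintegral_mkcond [X in `|X - _|]addrC addrK.
exact: le_trans (ler_norm _).
Unshelve. all: by end_near. Qed.

Lemma riemann_sum (h : R -> R) (a eta tau : R) (N : nat) : 0 < eta -> continuous h ->
  mu.-integrable setT (EFin \o h) ->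
  (forall t t', `|t - t'| <= eta -> `|h t - h t'| <= tau) ->
  `|\int[mu]_(t in `[a, a + eta *+ N]) h t - \sum_(j < N) eta * h (a + eta *+ j)|
     <= tau * (eta *+ N).
Proof.
move=> eta0 ch ih hh.
have iS (D : set R) : measurable D -> mu.-integrable D (EFin \o h).
  by move=> mD; exact: (integrableS measurableT).
elim: N => [|N IH].
  by rewrite mulr0n addr0 set_itv1 Rintegral_set1 big_ord0 mulr0 subrr normr0.
have xy : a + eta *+ N < a + eta *+ N.+1 by rewrite ltrD2l mulrSr ltrDl.
have E : \int[mu]_(t in `[a, a + eta *+ N.+1]) h t =
    \int[mu]_(t in `[a, a + eta *+ N]) h t + \int[mu]_(t in `]a + eta *+ N, a + eta *+ N.+1]) h t.
  rewrite -(@Rintegral_itvB _ h (BLeft a) (BRight (a + eta *+ N.+1)) (a + eta *+ N)).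
  - by rewrite [RHS]addrC subrK.
  - exact: iS.
  - by rewrite bnd_simp lerDl mulrn_wge0// ltW.
  - by rewrite bnd_simp ltW.
have cell : `|\int[mu]_(t in `]a + eta *+ N, a + eta *+ N.+1]) h t - eta * h (a + eta *+ N)| <= tau * eta.
  have ml : fine (mu `]a + eta *+ N, a + eta *+ N.+1]) = eta.
    rewrite lebesgue_measure_itv /= lte_fin xy /= mulrSr; lra.
  have ic (c : R) : mu.-integrable `]a + eta *+ N, a + eta *+ N.+1] (EFin \o cst c).
    apply/integrableP; split; first exact/measurable_EFinP/measurable_cst.
    rewrite /= integral_cst//= lebesgue_measure_itv /= lte_fin xy -EFinB -EFinM.
    exact: ltry.
  have -> : eta * h (a + eta *+ N) = \int[mu]_(t in `]a + eta *+ N, a + eta *+ N.+1]) h (a + eta *+ N).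
    by rewrite Rintegral_cst// ml mulrC.
  rewrite -RintegralB//; [ |exact: iS|exact: ic].
  have iB : mu.-integrable `]a + eta *+ N, a + eta *+ N.+1] (EFin \o (fun t => h t - h (a + eta *+ N))).
    have cB : continuous (fun t => h t - h (a + eta *+ N)).
      by move=> t; apply: continuousB; [exact: ch|exact: cst_continuous].
    have := @continuous_compact_integrable _ _ `[a + eta *+ N, a + eta *+ N.+1]
      (@segment_compact _ _ _) (continuous_subspaceT cB).
    by apply: integrableS => // t /=; rewrite !in_itv /= => /andP[/ltW -> ->].
  apply: le_trans (le_normr_Rintegral _ iB) _ => //.
  rewrite -[X in _ <= _ * X]ml -Rintegral_cst//.
  apply: le_Rintegral => //; [exact: integrable_norm|exact: ic|].
  move=> t /=; rewrite in_itv /= => /andP[t1 t2]; apply: hh.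
  rewrite ger0_norm; last by rewrite subr_ge0 ltW.
  by rewrite lerBlDl -addrA -mulrSr.
rewrite E big_ord_recr /= [in leRHS]mulrSr mulrDr.
have -> (p q r s : R) : p + q - (r + s) = (p - r) + (q - s) by ring.
exact: le_trans (ler_normD _ _) (lerD IH cell).
Qed.

(** Riemann sums on a large interval, whose choice depends on [tau] and on the common majorant only; this
    is why one quadrature rule serves the whole family [H]. *)
Lemma quadrature1 (I : Type) (H : I -> R -> R) (L : R) : 0 <= L ->
  (forall i, continuous (H i)) ->
  (forall i t, `|H i t| <= L * (oneDsqr t)^-1) ->
  (forall tau : R, 0 < tau -> exists2 eta : R, 0 < eta &
     forall i t t', `|t - t'| <= eta -> `|H i t - H i t'| <= tau) ->
  forall tau : R, 0 < tau -> exists l : seq (R * R), forall i,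
    `|\int[mu]_t H i t - \sum_(p <- l) p.1 * H i p.2| <= tau.
Proof.
move=> L0 cH HL eH tau tau0.
have [k hk] := @tail_oneDsqrV (tau / 2 / (L + 1)) (ltac:(by rewrite !divr_gt0// ltr_wpDl)).
have t2 : 0 < tau / 2 / (2 * k%:R + 1) by rewrite !divr_gt0// ltr_wpDl// mulr_ge0.
have [eta eta0 he] := eH _ t2.
(* an integral number of steps of length at most eta fills [-k, k] *)
pose N := (Num.truncn (2 * k%:R / eta)).+1.
pose eta' : R := 2 * k%:R / N%:R.
have eN : eta' *+ N = 2 * k%:R by rewrite /eta' -[LHS]mulr_natr mulfVK// pnatr_eq0.
have ee : eta' <= eta.
  rewrite /eta' ler_pdivrMr ?ltr0n// -ler_pdivrMl// [leLHS]mulrC.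
  exact/ltW/truncnS_gt.
have ek : - k%:R + eta' *+ N = k%:R :> R by rewrite eN; lra.
(* for k = 0 the steps would have length 0 *)
exists (if k == 0%N then [::] else [seq (eta', - k%:R + eta' *+ j) | j <- iota 0 N]) => i.
have iH := dominated_integrable1 (cH i) (HL i).
have E : \int[mu]_t H i t = \int[mu]_(t in `[- k%:R, k%:R]) H i t + \int[mu]_(t in ~` `[- k%:R, k%:R]) H i t.
  rewrite -Rintegral_setU ?setUv//; first exact: measurableC.
  by rewrite disj_set2E setICr.
have mC : measurable (~` `[- k%:R, k%:R]%classic : set R) by exact: measurableC.
have T : `|\int[mu]_(t in ~` `[- k%:R, k%:R]) H i t| <= tau / 2.
  have iD : mu.-integrable (~` `[- k%:R, k%:R]) (EFin \o H i) by exact: (integrableS measurableT).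
  apply: le_trans (le_normr_Rintegral _ iD) _ => //.
  have ig : mu.-integrable (~` `[- k%:R, k%:R]) (EFin \o (fun t : R => (oneDsqr t)^-1)).
    exact: (integrableS measurableT _ _ integrable_oneDsqrV).
  apply: le_trans (_ : \int[mu]_(t in ~` `[- k%:R, k%:R]) (L * (oneDsqr t)^-1) <= _).
    apply: le_Rintegral => //; first exact: integrable_norm.
    have iL : mu.-integrable setT (EFin \o (fun t : R => L * (oneDsqr t)^-1)).
      exact: (integrableZl measurableT L integrable_oneDsqrV).
    exact: (integrableS measurableT _ _ iL).
  rewrite RintegralZl//.
  apply: le_trans (_ : (L + 1) * (tau / 2 / (L + 1)) <= _).
    apply: ler_pM => //; last by rewrite lerDl.
    by apply: Rintegral_ge0 => t _; exact: oneDsqrV_ge0.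
  by rewrite mulrC divfK// gt_eqF// ltr_wpDl.
have B : `|\int[mu]_(t in `[- k%:R, k%:R]) H i t -
    \sum_(p <- if k == 0%N then [::] else [seq (eta', - k%:R + eta' *+ j) | j <- iota 0 N]) p.1 * H i p.2| <= tau / 2.
  have [k0|k0] := eqVneq k 0%N.
    by rewrite k0 oppr0 set_itv1 Rintegral_set1 big_nil subrr normr0 divr_ge0// ltW.
  have e0 : 0 < eta' by rewrite divr_gt0 ?mulr_gt0 ?ltr0n// lt0n.
  have := @riemann_sum (H i) (- k%:R) eta' _ N e0 (cH i) iH (fun t t' tt => he i t t' (le_trans tt ee)).
  rewrite ek eN big_map -(big_mkord xpredT (fun j => eta' * H i (- k%:R + eta' *+ j))).
  rewrite /index_iota subn0 => /le_trans; apply.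
  rewrite -mulrA ler_piMr ?divr_ge0//; first exact: ltW.
  by rewrite mulrC ler_pdivrMr ?mul1r ?lerDl// ltr_wpDl// mulr_ge0.
rewrite E -addrAC [tau]splitr.
exact: le_trans (ler_normD _ _) (lerD B T).
Qed.
End Quadrature1.

(** * Iterated integrals *)

Section IteratedIntegral.
Context {R : realType}.
Local Notation mu := (@lebesgue_measure R).
Local Notation I1 := (\int[mu]_t (oneDsqr t)^-1).

(** The product weight makes slices of dominated functions dominated, so that induction on the dimension
    goes through for iterated integrals. *)
Definition wt {n} (z : 'rV[R]_n) : R := \prod_(i < n) (oneDsqr (z 0 i))^-1.

Definition row_cons {n} (t : R) (y : 'rV[R]_n) : 'rV[R]_n.+1 := row_mx (t%:M : 'rV[R]_1) y.

Lemma integral_rVS n (h : 'rV[R]_n.+1 -> R) :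
  integral_rV h = \int[mu]_t integral_rV (fun y => h (row_cons t y)).
Proof. by []. Qed.

Lemma row_cons_coord n (t : R) (y : 'rV[R]_n) (P : R -> Prop) :
  P t -> (forall i, P (y 0 i)) -> forall i, P (row_cons t y 0 i).
Proof.
move=> Pt Py i; rewrite /row_cons mxE.
by case: (@fintype.split 1 n i) => j //; rewrite mxE (ord1 j) eqxx.
Qed.

Lemma row_consB n (t t' : R) (y y' : 'rV[R]_n) :
  row_cons t y - row_cons t' y' = row_cons (t - t') (y - y').
Proof.
apply/rowP => i; rewrite !mxE; case: (@fintype.split 1 n i) => j; by rewrite !mxE ?(ord1 j) ?eqxx.
Qed.

Lemma row_consZ n (c t : R) (y : 'rV[R]_n) : c *: row_cons t y = row_cons (c * t) (c *: y).
Proof. apply/rowP => i; rewrite !mxE; case: (@fintype.split 1 n i) => j; by rewrite !mxE ?(ord1 j) ?eqxx. Qed.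

Lemma row_consE n (z : 'rV[R]_n.+1) : exists t y, z = row_cons t y.
Proof.
exists (z 0 0), (@rsubmx R 1 1 n z); rewrite /row_cons -[LHS](@hsubmxK R 1 1 n z).
congr (row_mx _ _ : 'rV[R]_(1 + n)).
by apply/rowP => j; rewrite !mxE (ord1 j) eqxx /=; congr (z _ _); exact: val_inj.
Qed.

Lemma norm_row_cons_le n (t : R) (y : 'rV[R]_n) (r : R) :
  `|t| <= r -> `|y| <= r -> `|row_cons t y| <= r.
Proof.
move=> tr yr; have r0 : 0 <= r by exact: le_trans tr.
apply: norm_le_coord => //; apply: (@row_cons_coord _ _ _ (fun u => `|u| <= r)) => // i.
exact: le_trans (coord_le_norm _ _) yr.
Qed.

Lemma wt_row_cons n (t : R) (y : 'rV[R]_n) : wt (row_cons t y) = (oneDsqr t)^-1 * wt y.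
Proof.
have El : row_cons t y 0 (@lshift 1 n 0) = t by rewrite /row_cons (row_mxEl t%:M) mxE eqxx.
have Er i : row_cons t y 0 (@rshift 1 n i) = y 0 i by rewrite /row_cons (row_mxEr t%:M).
rewrite /wt (@big_split_ord _ _ _ 1 n) big_ord1 El; congr (_ * _).
by apply: eq_bigr => i _; rewrite Er.
Qed.

Lemma wt_ge0 n (z : 'rV[R]_n) : 0 <= wt z.
Proof. by apply: prodr_ge0 => i _; exact: oneDsqrV_ge0. Qed.

Lemma wt0 (z : 'rV[R]_0) : wt z = 1.
Proof. by rewrite /wt big_ord0. Qed.

Lemma continuousRP (h : R -> R) x : {for x, continuous h} <->
  forall e, 0 < e -> exists2 d : R, 0 < d & forall y, `|y - x| < d -> `|h y - h x| <= e.
Proof.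
split=> [/(@cvgrPdist_le _ _ _ (nbhs x)) H e /H|H].
  move=> /nbhs_ballP[d /= d0 hd]; exists d => // y yd.
  by rewrite distrC; apply: hd; rewrite -ball_normE /= distrC.
apply/(@cvgrPdist_le _ _ _ (nbhs x)) => e /H[d d0 hd].
apply/nbhs_ballP; exists d => //= y; rewrite -ball_normE /= distrC => /hd.
by rewrite distrC.
Qed.

Lemma continuous_rVP n (h : 'rV[R]_n -> R) x : {for x, continuous h} <->
  forall e, 0 < e -> exists2 d : R, 0 < d & forall y, `|y - x| < d -> `|h y - h x| <= e.
Proof.
split=> [/(@cvgrPdist_le _ _ _ (nbhs x)) H e /H|H].
  move=> /nbhs_ballP[d /= d0 hd]; exists d => // y yd.
  by rewrite distrC; apply: hd; rewrite -ball_normE /= distrC.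
apply/(@cvgrPdist_le _ _ _ (nbhs x)) => e /H[d d0 hd].
apply/nbhs_ballP; exists d => //= y; rewrite -ball_normE /= distrC => /hd.
by rewrite distrC.
Qed.

(** Sequential continuity, in the form required by dominated convergence. *)
Lemma continuous_seqR (h : R -> R) x :
  (forall v : nat -> R, v k @[k --> \oo] --> x -> h (v k) @[k --> \oo] --> h x) ->
  {for x, continuous h}.
Proof.
move=> H; apply/continuousRP => e e0; apply: contrapT => N.
have /choice[v hv] : forall k : nat, exists y, `|y - x| < k.+1%:R^-1 /\ ~ `|h y - h x| <= e.
  move=> k; apply: contrapT => N'; apply: N; exists (k.+1%:R^-1); first by rewrite invr_gt0.
  move=> y yk; apply: contrapT => yN; apply: N'; by exists y.
have vx : v k @[k --> \oo] --> x.
  apply/(@cvgrPdist_le _ _ _ \oo) => d d0; near=> k.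
  rewrite distrC (le_trans (ltW (hv k).1))//.
  rewrite -[leRHS]invrK lef_pV2 ?posrE ?invr_gt0//.
  have : d^-1 <= k%:R by near: k; exact: nbhs_infty_ger.
  by move/le_trans; apply; rewrite ler_nat.
have := H v vx => /(@cvgrPdist_le _ _ _ \oo)/(_ _ e0)[k _ /(_ k (leqnn k)) /=].
by rewrite distrC => hk; case: (hv k).
Unshelve. all: by end_near. Qed.

Lemma continuous_cvg_seqR (h : R -> R) x (v : nat -> R) : {for x, continuous h} ->
  v k @[k --> \oo] --> x -> h (v k) @[k --> \oo] --> h x.
Proof. by move=> ch vx; exact: (continuous_cvg _ ch vx). Qed.

Lemma continuous_row_cons_r n (h : 'rV[R]_n.+1 -> R) t : continuous h ->
  continuous (fun y => h (row_cons t y)).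
Proof.
move=> ch y; apply/continuous_rVP => e e0.
have /continuous_rVP/(_ _ e0)[d d0 hd] := ch (row_cons t y).
exists d => // y' yy; apply: hd; rewrite row_consB subrr.
apply: le_lt_trans yy; apply: norm_row_cons_le => //; by rewrite normr0.
Qed.

Lemma continuous_row_cons_l n (h : 'rV[R]_n.+1 -> R) (y : 'rV[R]_n) : continuous h ->
  continuous (fun t => h (row_cons t y)).
Proof.
move=> ch t; apply/continuousRP => e e0.
have /continuous_rVP/(_ _ e0)[d d0 hd] := ch (row_cons t y).
exists d => // t' tt; apply: hd; rewrite row_consB subrr.
apply: le_lt_trans tt; apply: norm_row_cons_le => //; by rewrite normr0.
Qed.

Definition dominated n (h : 'rV[R]_n -> R) (L : R) :=
  continuous h /\ forall z, `|h z| <= L * wt z.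

Lemma dominated_row_cons n (h : 'rV[R]_n.+1 -> R) L t : dominated h L ->
  dominated (fun y => h (row_cons t y)) (L * (oneDsqr t)^-1).
Proof.
move=> [ch hL]; split; first exact: continuous_row_cons_r.
by move=> y; rewrite (le_trans (hL _))// wt_row_cons mulrA.
Qed.

Lemma dominated_ge0 n (h : 'rV[R]_n -> R) L : dominated h L -> 0 <= L.
Proof.
move=> dh; have := dh.2 0 => /(le_trans (normr_ge0 _)).
rewrite pmulr_lge0//; apply: prodr_gt0 => i _.
by rewrite invr_gt0 ltr_pwDl// sqr_ge0.
Qed.

Lemma dominated_weaken n (h : 'rV[R]_n -> R) L L' : L <= L' -> dominated h L -> dominated h L'.
Proof.
by move=> LL [ch hL]; split=> // z; rewrite (le_trans (hL z))// ler_wpM2r// wt_ge0.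
Qed.

Lemma dominated_slice n (h : 'rV[R]_n.+1 -> R) L t : dominated h L ->
  dominated (fun y => h (row_cons t y)) L.
Proof.
move=> dh; apply: dominated_weaken (dominated_row_cons t dh).
by rewrite ler_piMr ?oneDsqrV_le1//; exact: dominated_ge0 dh.
Qed.

Definition dominated_convergence n := forall (u : nat -> 'rV[R]_n -> R) h L,
  dominated h L -> (forall k, dominated (u k) L) -> (forall z, u k z @[k --> \oo] --> h z) ->
  integral_rV (u k) @[k --> \oo] --> integral_rV h.

Lemma slice_integral_continuous n (h : 'rV[R]_n.+1 -> R) L : dominated_convergence n ->
  dominated h L -> continuous (fun t => integral_rV (fun y => h (row_cons t y))).
Proof.
move=> cvg_n dh t; apply: continuous_seqR => v vt.
apply: (cvg_n _ _ L); first exact: dominated_slice.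
  by move=> k; exact: dominated_slice.
move=> z.
exact: (@continuous_cvg_seqR (fun t => h (row_cons t z)) t v (@continuous_row_cons_l _ _ z dh.1 t) vt).
Qed.

(** The two statements need each other in the induction: convergence in dimension [n] makes the inner
    integral continuous, hence integrable, in dimension n + 1. *)
Lemma integral_rV_theory n :
  (forall (h : 'rV[R]_n -> R) L, dominated h L -> `|integral_rV h| <= L * I1 ^+ n) /\
  dominated_convergence n.
Proof.
elim: n => [|n [IHb IHc]].
  split=> [h L [_ hL]|u h L _ _ uh]; last exact: uh.
  by rewrite /= expr0 (le_trans (hL _))// wt0.
have bnd (h : 'rV[R]_n.+1 -> R) L t : dominated h L ->
    `|integral_rV (fun y => h (row_cons t y))| <= L * I1 ^+ n * (oneDsqr t)^-1.
  by move=> dh; rewrite mulrAC; apply: IHb; exact: dominated_row_cons.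
split=> [h L dh|u h L dh du uh].
  rewrite integral_rVS exprSr mulrA; apply: Rintegral_le_dominated.
    exact: slice_integral_continuous dh.
  by move=> t; exact: bnd.
rewrite integral_rVS; apply: (@Rintegral_dominated_cvg _ _ _ (L * I1 ^+ n)).
- exact: slice_integral_continuous dh.
- by move=> t; exact: bnd.
- by move=> k; exact: slice_integral_continuous (du k).
- by move=> k t; exact: bnd.
- move=> t; apply: (IHc _ _ (L * (oneDsqr t)^-1)).
  + exact: dominated_row_cons.
  + by move=> k; exact: dominated_row_cons.
  + by move=> z; exact: uh.
Qed.

Lemma integral_rV_le n (h : 'rV[R]_n -> R) L : dominated h L ->
  `|integral_rV h| <= L * I1 ^+ n.
Proof. exact: (integral_rV_theory n).1. Qed.

Lemma inner_integral_bound n (h : 'rV[R]_n.+1 -> R) L t : dominated h L ->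
  `|integral_rV (fun y => h (row_cons t y))| <= L * I1 ^+ n * (oneDsqr t)^-1.
Proof.
by move=> dh; rewrite mulrAC; apply: integral_rV_le; exact: dominated_row_cons.
Qed.

Lemma inner_integral_continuous n (h : 'rV[R]_n.+1 -> R) L : dominated h L ->
  continuous (fun t => integral_rV (fun y => h (row_cons t y))).
Proof. by move=> dh; exact: slice_integral_continuous (integral_rV_theory n).2 dh. Qed.

Lemma dominatedD n (f g : 'rV[R]_n -> R) L L' : dominated f L -> dominated g L' ->
  dominated (fun z => f z + g z) (L + L').
Proof.
move=> [cf fL] [cg gL]; split=> [z|z].
  by apply: continuousD; [exact: cf|exact: cg].
by rewrite mulrDl (le_trans (ler_normD _ _))// lerD.
Qed.

Lemma dominatedZ n (c : R) (f : 'rV[R]_n -> R) L : dominated f L ->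
  dominated (fun z => c * f z) (`|c| * L).
Proof.
move=> [cf fL]; split=> [z|z].
  by apply: continuousM; [exact: cst_continuous|exact: cf].
by rewrite normrM -mulrA ler_wpM2l.
Qed.

Lemma integral_rVD n (f g : 'rV[R]_n -> R) L L' : dominated f L -> dominated g L' ->
  integral_rV (fun z => f z + g z) = integral_rV f + integral_rV g.
Proof.
elim: n f g L L' => [//|n IH] f g L L' df dg; rewrite !integral_rVS -RintegralD//.
- apply: eq_Rintegral => t _.
  exact: (IH _ _ _ _ (dominated_row_cons t df) (dominated_row_cons t dg)).
- exact: dominated_integrable1 (inner_integral_continuous df) (fun t => inner_integral_bound t df).
- exact: dominated_integrable1 (inner_integral_continuous dg) (fun t => inner_integral_bound t dg).
Qed.

Lemma integral_rVZ n (c : R) (f : 'rV[R]_n -> R) L : dominated f L ->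
  integral_rV (fun z => c * f z) = c * integral_rV f.
Proof.
elim: n f L => [//|n IH] f L df; rewrite !integral_rVS -RintegralZl//.
- apply: eq_Rintegral => t _.
  exact: (IH _ _ (dominated_row_cons t df)).
- exact: dominated_integrable1 (inner_integral_continuous df) (fun t => inner_integral_bound t df).
Qed.

Lemma dominated0 n : dominated (fun _ : 'rV[R]_n => 0) 0.
Proof. by split=> z; [exact: cst_continuous|rewrite normr0 mul0r]. Qed.

Lemma integral_rV0 n : integral_rV (fun _ : 'rV[R]_n => 0 : R) = 0.
Proof.
by have := integral_rVZ 0 (@dominated0 n); rewrite !mul0r.
Qed.

Lemma integral_rV_sum n (I : eqType) (r : seq I) (F : I -> 'rV[R]_n -> R) :
  (forall i, i \in r -> exists L, dominated (F i) L) ->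
  (exists L, dominated (fun z => \sum_(i <- r) F i z) L) /\
  integral_rV (fun z => \sum_(i <- r) F i z) = \sum_(i <- r) integral_rV (F i).
Proof.
elim: r => [|i r IH] dF.
  rewrite big_nil.
  have -> : (fun z => \sum_(i <- [::]) F i z) = (fun=> 0) by apply/funext => z; rewrite big_nil.
  by split; [exists 0; exact: dominated0|exact: integral_rV0].
have [[L dL] E] := IH (fun j jr => dF j (ltac:(by rewrite inE jr orbT))).
have [L' dL'] := dF i (mem_head _ _).
rewrite big_cons.
have -> : (fun z => \sum_(j <- i :: r) F j z) = (fun z => F i z + \sum_(j <- r) F j z).
  by apply/funext => z; rewrite big_cons.
split; first by exists (L' + L); exact: dominatedD.
by rewrite (integral_rVD dL' dL) E.
Qed.

Lemma continuous_affine n (h : 'rV[R]_n -> R) (a : 'rV[R]_n) (c : R) : continuous h ->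
  continuous (fun z : 'rV[R]_n => h (a - c *: z)).
Proof.
move=> ch z; apply: (@continuous_comp _ _ _ (fun z : 'rV[R]_n => a - c *: z) h); last exact: ch.
apply: continuousB; first exact: cst_continuous.
exact: scaler_continuous.
Qed.

(** Change of variables in each coordinate of the iterated integral. *)
Lemma integral_rV_affine n (h : 'rV[R]_n -> R) L (a : 'rV[R]_n) (c : R) : 0 < c ->
  dominated h L -> integral_rV (fun z => h (a - c *: z)) = c ^- n * integral_rV h.
Proof.
move=> c0; elim: n h L a => [|n IH] h L a dh.
  by rewrite /= expr0 invr1 mul1r; congr h; apply/rowP => -[].
have [a0 [a' ->]] := row_consE a.
rewrite !integral_rVS.
transitivity (\int[mu]_t (c ^- n * integral_rV (fun y => h (row_cons (a0 - c * t) y)))).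
  apply: eq_Rintegral => t _.
  rewrite -(IH _ _ a' (dominated_row_cons (a0 - c * t) dh)).
  by congr integral_rV; apply/funext => y; rewrite row_consZ row_consB.
pose H s := integral_rV (fun y => h (row_cons s y)).
have cH : continuous H := inner_integral_continuous dh.
have bH s : `|H s| <= L * I1 ^+ n * (oneDsqr s)^-1 := inner_integral_bound s dh.
have cV : continuous (fun s => c ^- n * H s).
  by move=> s; apply: (@continuousM _ _ (fun=> c ^- n) H s); [exact: cst_continuous|exact: cH].
have bV s : `|c ^- n * H s| <= (c ^- n * (L * I1 ^+ n)) * (oneDsqr s)^-1.
  have cn : 0 <= c ^- n by rewrite invr_ge0 exprn_ge0// ltW.
  by rewrite normrM -mulrA (ger0_norm cn) ler_wpM2l.
rewrite (Rintegral_subst a0 c0 cV bV) RintegralZl//; last exact: dominated_integrable1 cH bH.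
by rewrite mulrA -invfM -exprS.
Qed.
End IteratedIntegral.

(** * Quadrature in several variables *)

(** Interpolation between a small bound and a decaying one keeps half of the decay. *)
Lemma min_le_theta (R : realType) (a b w th : R) (g : R) : 0 < b -> 0 < th -> 0 <= w ->
  `|g| <= a -> `|g| <= b * w ^+ 2 -> a * b <= th ^+ 2 -> `|g| <= th * w.
Proof.
move=> b0 th0 w0 ga gb ab.
have [bw|bw] := leP (b * w) th.
  by rewrite (le_trans gb)// expr2 mulrA ler_wpM2r.
rewrite (le_trans ga)// -(ler_pM2r b0) (le_trans ab)// expr2 -mulrA ler_pM2l// mulrC.
exact: ltW.
Qed.

Section Quadrature.
Context {R : realType}.
Local Notation mu := (@lebesgue_measure R).
Local Notation I1 := (\int[mu]_t (oneDsqr t)^-1).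

Lemma wt_le1 n (z : 'rV[R]_n) : wt z <= 1.
Proof.
by apply: prodr_ile1 => i _; rewrite oneDsqrV_ge0 oneDsqrV_le1.
Qed.

Lemma wt_sq_le n (z : 'rV[R]_n) : wt z ^+ 2 <= wt z.
Proof. by rewrite expr2 ler_piMr ?wt_le1 ?wt_ge0. Qed.

Lemma lipschitz_continuous n (h : 'rV[R]_n -> R) (L : R) :
  (forall z z', `|h z - h z'| <= L * `|z - z'|) -> continuous h.
Proof. by move=> hL x; apply: (@continuous_of_lip _ _ _ _ L 1) => // y _. Qed.

(** A quadrature rule that is uniform over an equi-Lipschitz family.  This is the form in which Fubini's
    theorem will be used: a continuous functional commutes with finite sums, and the rule is uniform over
    all derivatives and translates to which the functional is applied.  Decay like the square of the weight
    is assumed because half of it is spent, by [min_le_theta], on making the inner integrals uniformly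
    continuous. *)
Lemma quadrature_rV n (J : Type) (h : J -> 'rV[R]_n -> R) (L : R) : 0 < L ->
  (forall j z, `|h j z| <= L * wt z ^+ 2) ->
  (forall j z z', `|h j z - h j z'| <= L * `|z - z'|) ->
  forall tau : R, 0 < tau -> exists l : seq (R * 'rV[R]_n), forall j,
    `|integral_rV (h j) - \sum_(p <- l) p.1 * h j p.2| <= tau.
Proof.
move=> L0; elim: n J h => [|n IH] J h hL hlip tau tau0.
  exists [:: (1, 0)] => j; rewrite big_cons big_nil /= mul1r addr0 subrr normr0.
  exact: ltW.
have dh j : dominated (h j) L.
  split; first exact: lipschitz_continuous (hlip j).
  by move=> z; rewrite (le_trans (hL j z))// ler_wpM2l ?wt_sq_le// ltW.
pose H j t := integral_rV (fun y => h j (row_cons t y)).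
have I1n : 0 <= I1 ^+ n by rewrite exprn_ge0 ?Rintegral_oneDsqrV_ge0.
have [l hl] : exists l : seq (R * R), forall j, `|\int[mu]_t H j t - \sum_(p <- l) p.1 * H j p.2| <= tau / 2.
  apply: (@quadrature1 _ _ H (L * I1 ^+ n)).
  - by rewrite mulr_ge0// ltW.
  - by move=> j; exact: inner_integral_continuous (dh j).
  - by move=> j t; exact: inner_integral_bound.
  - move=> sg sg0; pose th := sg / (I1 ^+ n + 1).
    have th0 : 0 < th by rewrite divr_gt0// ltr_wpDl.
    exists (th ^+ 2 / (L * (2 * L))); first by rewrite divr_gt0 ?exprn_gt0// !mulr_gt0.
    move=> j t t' tt.
    have E : H j t - H j t' = integral_rV (fun y => h j (row_cons t y) + -1 * h j (row_cons t' y)).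
      rewrite (integral_rVD (dominated_row_cons t (dh j)) (dominatedZ (-1) (dominated_row_cons t' (dh j)))).
      by rewrite (integral_rVZ _ (dominated_row_cons t' (dh j))) mulN1r.
    rewrite E; apply: le_trans (_ : th * I1 ^+ n <= _); last first.
      rewrite /th mulrAC ler_pdivrMr ?ltr_wpDl// ler_wpM2l ?lerDl//; exact: ltW.
    apply: integral_rV_le.
    split.
      exact: (dominatedD (dominated_row_cons t (dh j)) (dominatedZ (-1) (dominated_row_cons t' (dh j)))).1.
    move=> y; rewrite mulN1r.
    apply: (@min_le_theta _ (L * `|t - t'|) (2 * L)) => //.
    - by rewrite mulr_gt0.
    - exact: wt_ge0.
    - apply: le_trans (hlip _ _ _) _; rewrite ler_pM2l// row_consB subrr.
      by apply: norm_row_cons_le => //; rewrite normr0.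
    - have aux s : `|h j (row_cons s y)| <= L * wt y ^+ 2.
        apply: le_trans (hL _ _) _; rewrite ler_pM2l// wt_row_cons exprMn ler_piMl ?sqr_ge0//.
        by rewrite expr2 mulr_ile1 ?oneDsqrV_ge0 ?oneDsqrV_le1.
      apply: le_trans (ler_normB _ _) _; apply: le_trans (lerD (aux t) (aux t')) _.
      by rewrite -mulrDl -mulr2n mulr_natl.
    - have LL : 0 < L * (2 * L) by rewrite !mulr_gt0.
      have -> : L * `|t - t'| * (2 * L) = `|t - t'| * (L * (2 * L)) by ring.
      by rewrite -ler_pdivlMr.
  - by rewrite divr_gt0.
(* the inner rules are multiplied by the outer weights, whose sum is at most S *)
pose S := \sum_(p <- l) `|p.1| + 1.
have S0 : 0 < S by rewrite ltr_wpDl// sumr_ge0.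
have /choice[r hr] : forall t : R, exists r : seq (R * 'rV[R]_n), forall j,
    `|H j t - \sum_(q <- r) q.1 * h j (row_cons t q.2)| <= tau / 2 / S.
  move=> t; apply: (IH J (fun j y => h j (row_cons t y))).
  - move=> j y; apply: le_trans (hL _ _) _; rewrite ler_pM2l// wt_row_cons exprMn ler_piMl ?sqr_ge0//.
    by rewrite expr2 mulr_ile1 ?oneDsqrV_ge0 ?oneDsqrV_le1.
  - move=> j z z'; apply: le_trans (hlip _ _ _) _; rewrite ler_pM2l// row_consB subrr.
    by apply: norm_row_cons_le => //; rewrite normr0.
  - by rewrite !divr_gt0.
exists (flatten [seq [seq (p.1 * q.1, row_cons p.2 q.2) | q <- r p.2] | p <- l]) => j.
rewrite integral_rVS big_flatten big_map /=.
have -> : \int[mu]_t integral_rV (fun y => h j (row_cons t y)) = \int[mu]_t H j t by [].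
set X := \sum_(p <- l) _.
have HX : `|\sum_(p <- l) p.1 * H j p.2 - X| <= tau / 2.
  rewrite /X -sumrB; apply: le_trans (ler_norm_sum _ _ _) _.
  apply: le_trans (_ : \sum_(p <- l) `|p.1| * (tau / 2 / S) <= _).
    apply: ler_sum => p _; rewrite big_map /=.
    under eq_bigr do rewrite -mulrA.
    by rewrite -mulr_sumr -mulrBr normrM ler_wpM2l.
  rewrite -mulr_suml mulrA ler_pdivrMr// mulrC ler_wpM2l ?divr_ge0 ?lerDl//; exact: ltW.
rewrite -[_ - X](subrKA (\sum_(p <- l) p.1 * H j p.2)) [tau]splitr.
exact: le_trans (ler_normD _ _) (lerD (hl j) HX).
Qed.
End Quadrature.

Section Moments.
Context {R : realType} {n : nat}.
Implicit Types (x z : 'rV[R]_n) (g G sg : 'rV[R]_n -> R).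

Definition rapid sg := continuous sg /\
  forall k : nat, exists C : R, forall z, (1 + `|z|) ^+ k * `|sg z| <= C.

Lemma oneDnorm_ge0 z k : 0 <= (1 + `|z|) ^+ k.
Proof. by rewrite exprn_ge0// addr_ge0. Qed.

(** Polynomial growth against the weight: a function that beats all powers of 1 + |z| is dominated. *)
Lemma wt_growth z : 1 <= (1 + `|z|) ^+ (2 * n) * wt z.
Proof.
rewrite mulnC exprM /wt.
have -> : (1 + `|z|) ^+ n = \prod_(i < n) (1 + `|z|).
  by rewrite big_const_ord iter_mulr_1.
rewrite -prodrXl -big_split /=; apply: (big_ind (fun u => 1 <= u)) => // [u v u1 v1|i _].
  by rewrite -[1]mulr1 ler_pM.
rewrite ler_pdivlMr; last by rewrite ltr_pwDl// sqr_ge0.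
rewrite mul1r /oneDsqr sqrrD expr1n mul1r.
have := coord_le_norm z i; rewrite -(ler_pXn2r (n := 2)) ?nnegrE// real_normK ?num_real//.
move=> H; apply: lerD => //; rewrite (le_trans _ (_ : 1 + `|z| *+ 2 <= _))//.
by rewrite lerDl mulrn_wge0.
Qed.

Lemma rapid_dominated_growth sg (M : nat) : rapid sg ->
  exists2 C : R, 0 <= C & forall g B, continuous g ->
    (forall z, `|g z| <= B * (1 + `|z|) ^+ M) ->
    dominated (fun z => g z * sg z) (B * C).
Proof.
move=> [cs hs]; have [C hC] := hs (M + 2 * n)%N.
have C0 : 0 <= C by rewrite (le_trans _ (hC 0))// mulr_ge0 ?oneDnorm_ge0.
exists C => // g B cg hg; split=> [z|z].
  by apply: continuousM; [exact: cg|exact: cs].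
have B0 : 0 <= B.
  by have := le_trans (normr_ge0 _) (hg 0); rewrite normr0 addr0 expr1n mulr1.
rewrite normrM; apply: le_trans (ler_wpM2r (normr_ge0 _) (hg z)) _.
rewrite -!mulrA ler_wpM2l//.
have W := wt_growth z; have H := hC z; rewrite exprD -mulrA in H.
apply: le_trans (_ : ((1 + `|z|) ^+ (2 * n) * wt z) * ((1 + `|z|) ^+ M * `|sg z|) <= _).
  by rewrite ler_peMl// mulr_ge0 ?oneDnorm_ge0.
apply: le_trans (_ : ((1 + `|z|) ^+ M * ((1 + `|z|) ^+ (2 * n) * `|sg z|)) * wt z <= _).
  by rewrite le_eqVlt; apply/orP; left; apply/eqP; ring.
by rewrite ler_wpM2r ?wt_ge0.
Qed.
End Moments.

(** * Mollification under vanishing moments *)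

Section MomentApprox.
Context {R : realType} {n : nat}.
Implicit Types (x z : 'rV[R]_n) (g G sg : 'rV[R]_n -> R).
Local Notation e i := (delta_mx 0 i : 'rV[R]_n).

(** Adding the coordinates of a point one after the other leads from 0 to the point, which reduces Taylor's
    formula to one variable. *)
Definition coord_proj (l : seq 'I_n) (z : 'rV[R]_n) : 'rV[R]_n :=
  \row_j (if j \in l then z 0 j else 0).

Lemma coord_proj_enum z : coord_proj (enum 'I_n) z = z.
Proof. by apply/rowP => j; rewrite mxE mem_enum. Qed.

Lemma coord_proj_nil z : coord_proj [::] z = 0.
Proof. by apply/rowP => j; rewrite !mxE. Qed.

Lemma coord_proj_cons i l z : i \notin l ->
  coord_proj (i :: l) z = coord_proj l z + z 0 i *: e i.
Proof.
move=> il; apply/rowP => j; rewrite !mxE inE eqxx /=.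
have [->|ji] := eqVneq j i; first by rewrite (negbTE il) add0r mulr1.
by rewrite mulr0 addr0.
Qed.

Lemma norm_coord_proj_le i l z (t : R) : i \notin l -> 0 <= t <= 1 ->
  `|coord_proj l z + (t * z 0 i) *: e i| <= `|z|.
Proof.
move=> il /andP[t0 t1]; apply: norm_le_coord => // j; rewrite !mxE eqxx /=.
have [->|ji] := eqVneq j i.
  rewrite (negbTE il) add0r mulr1 normrM (ger0_norm t0).
  by rewrite (le_trans _ (coord_le_norm z i))// ler_piMl.
by rewrite mulr0 addr0; case: ifP => _; rewrite ?normr0 ?coord_le_norm.
Qed.

Lemma continuous_coord_proj_affine G x (eps : R) l : continuous G ->
  continuous (fun z => G (x - eps *: coord_proj l z)).
Proof.
move=> cG z; apply/continuous_rVP => d d0.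
have /continuous_rVP/(_ _ d0)[r r0 hr] := cG (x - eps *: coord_proj l z).
exists (r / (`|eps| + 1)); first by rewrite divr_gt0// ltr_wpDl.
move=> y yz; apply: hr; rewrite opprD addrACA subrr add0r opprK addrC -scalerBr normrZ.
rewrite -normrN opprB.
have -> : coord_proj l y - coord_proj l z = coord_proj l (y - z).
  by apply/rowP => j; rewrite !mxE; case: ifP => _; rewrite ?subr0.
have P : `|coord_proj l (y - z)| <= `|y - z|.
  apply: norm_le_coord => // j; rewrite mxE.
  by case: ifP => _; rewrite ?normr0 ?coord_le_norm.
apply: le_lt_trans (_ : (`|eps| + 1) * `|y - z| < r).
  by rewrite ler_pM// lerDl.
by rewrite mulrC -ltr_pdivlMr// ltr_wpDl.
Qed.

Lemma continuous_coord (i : 'I_n) : continuous (fun z : 'rV[R]_n => z 0 i).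
Proof. exact: coord_continuous. Qed.

Lemma continuous_coord_pow (i : 'I_n) k : continuous (fun z : 'rV[R]_n => z 0 i ^+ k).
Proof.
elim: k => [|k IH] z.
  have -> : (fun z : 'rV[R]_n => z 0 i ^+ 0) = (fun=> 1) by apply/funext => y; rewrite expr0.
  exact: cst_continuous.
have -> : (fun z : 'rV[R]_n => z 0 i ^+ k.+1) = (fun z => z 0 i * z 0 i ^+ k).
  by apply/funext => y; rewrite exprS.
apply: (@continuousM _ _ (fun z : 'rV[R]_n => z 0 i) (fun z : 'rV[R]_n => z 0 i ^+ k) z).
  exact: continuous_coord.
exact: IH.
Qed.

Lemma rapid_coord_pow sg i k : rapid sg -> rapid (fun z => z 0 i ^+ k * sg z).
Proof.
move=> [cs hs]; split=> [z|m].
  apply: (@continuousM _ _ (fun z : 'rV[R]_n => z 0 i ^+ k) sg z); last exact: cs.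
  exact: continuous_coord_pow.
have [C hC] := hs (m + k)%N; exists C => z; apply: le_trans (hC z).
rewrite normrM exprD -mulrA ler_wpM2l ?oneDnorm_ge0// ler_wpM2r// normrX.
by rewrite lerXn2r ?nnegrE ?addr_ge0// (le_trans (coord_le_norm _ _))// lerDr.
Qed.

Lemma mpow_coord_pow (a : 'I_n -> nat) i k (z : 'rV[R]_n) :
  mpow z a * z 0 i ^+ k = mpow z (fun j => a j + k * (j == i))%N.
Proof.
rewrite /mpow; under [RHS]eq_bigr do rewrite exprD.
rewrite big_split /=; congr (_ * _).
rewrite (bigD1 i)//= eqxx muln1 big1 ?mulr1// => j ji.
by rewrite (negbTE ji) muln0 expr0.
Qed.

Definition vanishing_moments sg :=
  forall a : 'I_n -> nat, (exists i, a i != 0%N) -> integral_rV (fun z => mpow z a * sg z) = 0.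

Lemma vanishing_moments_coord_pow sg i k : vanishing_moments sg ->
  vanishing_moments (fun z => z 0 i ^+ k * sg z).
Proof.
move=> vs a [j aj].
have -> : (fun z => mpow z a * (z 0 i ^+ k * sg z)) =
    (fun z => mpow z (fun j => a j + k * (j == i))%N * sg z).
  by apply/funext => z; rewrite mulrA mpow_coord_pow.
by apply: vs; exists j; rewrite addn_eq0 negb_and aj.
Qed.

Lemma moment_coord_pow sg i k : vanishing_moments sg -> (0 < k)%N ->
  integral_rV (fun z => z 0 i ^+ k * sg z) = 0.
Proof.
move=> vs k0.
have -> : (fun z => z 0 i ^+ k * sg z) =
    (fun z => mpow z (fun j => 0 + k * (j == i))%N * sg z).
  apply/funext => z; rewrite -mpow_coord_pow /mpow big1 ?mul1r//.
by apply: vs; exists i; rewrite eqxx muln1 add0n -lt0n.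
Qed.

(** Taylor expansion in the coordinate [i], then the induction hypothesis for each coefficient, with the
    test function multiplied by a power of z_i: its moments still vanish, and the powers themselves integrate
    to 0, so that only the constant term survives.  The polynomial weight allows [G] to be controlled well
    near [x] and badly far away. *)
Lemma moment_approx_proj (m M : nat) (l : seq 'I_n) : (0 < m)%N -> uniq l ->
  forall sg, rapid sg -> vanishing_moments sg ->
  exists2 C : R, 0 <= C & forall G x (eps B : R), smoothR setT G -> 0 < eps <= 1 ->
    (forall s z, (size s <= size l * m)%N ->
       `|iter_partial s G (x - eps *: z)| <= B * (1 + `|z|) ^+ M) ->
    `|integral_rV (fun z => G (x - eps *: coord_proj l z) * sg z) - G x * integral_rV sg|
       <= C * eps ^+ m * B.
Proof.
move=> m0; elim: l => [|i l IH] /=.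
  move=> _ sg rs vs; exists 0 => // G x eps B sG e01 hB.
  have [C C0 /(_ (fun=> 1) 1) dC] := rapid_dominated_growth 0 rs.
  have ds : dominated sg (1 * C).
    have -> : sg = fun z => 1 * sg z by apply/funext => z; rewrite mul1r.
    by apply: dC => [|z]; [exact: cst_continuous|rewrite normr1 expr0 mulr1].
  have -> : (fun z => G (x - eps *: coord_proj [::] z) * sg z) = (fun z => G x * sg z).
    by apply/funext => z; rewrite coord_proj_nil scaler0 subr0.
  by rewrite (integral_rVZ _ ds) subrr normr0 !mul0r.
move=> /andP[il ul] sg rs vs.
have rk k := rapid_coord_pow i k rs.
have /choice[C hC] : forall k, exists C : R, 0 <= C /\ forall G x (eps B : R), smoothR setT G -> 0 < eps <= 1 ->
    (forall s z, (size s <= size l * m)%N ->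
       `|iter_partial s G (x - eps *: z)| <= B * (1 + `|z|) ^+ M) ->
    `|integral_rV (fun z => G (x - eps *: coord_proj l z) * (z 0 i ^+ k * sg z)) -
       G x * integral_rV (fun z => z 0 i ^+ k * sg z)| <= C * eps ^+ m * B.
  move=> k; have [C C0 hC] := IH ul _ (rk k) (vanishing_moments_coord_pow i k vs).
  by exists C.
have /choice[D hD] : forall k, exists D : R, 0 <= D /\ forall g B, continuous g ->
    (forall z, `|g z| <= B * (1 + `|z|) ^+ M) ->
    dominated (fun z => g z * (z 0 i ^+ k * sg z)) (B * D).
  by move=> k; have [D D0 hD] := rapid_dominated_growth M (rk k); exists D.
have [D' D'0 hD'] := rapid_dominated_growth (M + m) rs.
pose I1 := \int[@lebesgue_measure R]_t (oneDsqr t)^-1.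
have I1n : 0 <= I1 ^+ n by rewrite exprn_ge0 ?Rintegral_oneDsqrV_ge0.
exists (\sum_(k < m) C k + D' * I1 ^+ n).
  by rewrite addr_ge0 ?mulr_ge0// sumr_ge0// => k _; case: (hC k).
move=> G x eps B sG /andP[e0 e1] hB.
have B0 : 0 <= B.
  have := hB [::] 0 (leq0n _); rewrite normr0 addr0 expr1n mulr1.
  exact: le_trans.
have eps01 : 0 < eps <= 1 by rewrite e0.
pose Gk k := iter_partial (nseq k i) G.
pose c k : R := (- eps) ^+ k / k`!%:R.
pose A k z := c k * (Gk k (x - eps *: coord_proj l z) * (z 0 i ^+ k * sg z)).
(* the Taylor remainder in the coordinate i *)
pose rem z := G (x - eps *: coord_proj (i :: l) z) -
  \sum_(k < m) c k * (Gk k (x - eps *: coord_proj l z) * z 0 i ^+ k).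
have hGk k s z : (k < m)%N -> (size s <= size l * m)%N ->
    `|iter_partial s (Gk k) (x - eps *: z)| <= B * (1 + `|z|) ^+ M.
  move=> km sl; rewrite /Gk -iter_partial_cat; apply: hB.
  by rewrite size_cat size_nseq mulSn addnC leq_add// ltnW.
have cGk k : continuous (Gk k) by apply: smoothRT_continuous; exact: smoothR_iter.
have proj_norm z : `|coord_proj l z| <= `|z|.
  by have := @norm_coord_proj_le i l z 0 il; rewrite mul0r scale0r addr0 lexx ler01; apply.
have growth (u v : 'rV[R]_n) k : `|u| <= `|v| -> (1 + `|u|) ^+ k <= (1 + `|v|) ^+ k.
  by move=> uv; rewrite lerXn2r ?nnegrE ?addr_ge0// lerD2l.
have dA (k : 'I_m) : dominated (A k) (`|c k| * (B * D k)).
  apply: dominatedZ; apply: (hD k).2; first exact: continuous_coord_proj_affine.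
  move=> z; apply: le_trans (hGk k [::] _ (ltn_ord k) (leq0n _)) _.
  by rewrite ler_wpM2l// growth.
have remB z : `|rem z| <= (B * eps ^+ m) * (1 + `|z|) ^+ (M + m).
  have E t : x - eps *: coord_proj l z + (t * (- eps * z 0 i)) *: e i =
      x - eps *: (coord_proj l z + (t * z 0 i) *: e i).
    have -> : t * (- eps * z 0 i) = - (eps * (t * z 0 i)) by ring.
    by rewrite scaleNr scalerDr opprD addrA scalerA.
  have := @taylor_line R n setT G (x - eps *: coord_proj l z) i (- eps * z 0 i) (B * (1 + `|z|) ^+ M) m sG (fun _ _ => I).
  have -> : G (x - eps *: coord_proj l z + (- eps * z 0 i) *: e i) = G (x - eps *: coord_proj (i :: l) z).
    by have := E 1; rewrite !mul1r => ->; rewrite coord_proj_cons.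
  have -> : \sum_(k < m) iter_partial (nseq k i) G (x - eps *: coord_proj l z) * (- eps * z 0 i) ^+ k / k`!%:R
     = \sum_(k < m) c k * (Gk k (x - eps *: coord_proj l z) * z 0 i ^+ k).
    by apply: eq_bigr => k _; rewrite exprMn /c /Gk; ring.
  rewrite -/(rem z) => H; apply: le_trans (H _) _.
    move=> t t01; rewrite E; apply: le_trans (hB _ _ _) _.
      by rewrite size_nseq mulSn leq_addr.
    by rewrite ler_wpM2l// growth// norm_coord_proj_le.
  rewrite ler_pdivrMr ?ltr0n ?fact_gt0//.
  apply: le_trans (_ : B * eps ^+ m * (1 + `|z|) ^+ (M + m) * 1 <= _); last first.
    by rewrite ler_wpM2l ?ler1n ?fact_gt0// !mulr_ge0 ?oneDnorm_ge0// exprn_ge0// ltW.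
  rewrite mulr1 exprD normrM normrN (gtr0_norm e0) exprMn.
  have -> : B * eps ^+ m * ((1 + `|z|) ^+ M * (1 + `|z|) ^+ m) =
    B * (1 + `|z|) ^+ M * (eps ^+ m * (1 + `|z|) ^+ m) by ring.
  rewrite ler_wpM2l ?mulr_ge0 ?oneDnorm_ge0// ler_wpM2l ?exprn_ge0//; first exact: ltW.
  by rewrite lerXn2r ?nnegrE ?addr_ge0// (le_trans (coord_le_norm _ _))// lerDr.
have crem : continuous rem.
  move=> z; apply: continuousB; first exact: continuous_coord_proj_affine (smoothRT_continuous sG) _.
  have cterm k : {for z, continuous (fun z => c k * (Gk k (x - eps *: coord_proj l z) * z 0 i ^+ k))}.
    apply: (@continuousM _ _ (fun=> c k) (fun z => Gk k (x - eps *: coord_proj l z) * z 0 i ^+ k) z).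
      exact: cst_continuous.
    apply: (@continuousM _ _ (fun z => Gk k (x - eps *: coord_proj l z)) (fun z : 'rV[R]_n => z 0 i ^+ k) z).
      exact: continuous_coord_proj_affine.
    exact: continuous_coord_pow.
  have csum m' : {for z, continuous (fun z => \sum_(k < m') c k * (Gk k (x - eps *: coord_proj l z) * z 0 i ^+ k))}.
    elim: m' => [|m' IHm].
      have -> : (fun z => \sum_(k < 0) c k * (Gk k (x - eps *: coord_proj l z) * z 0 i ^+ k)) = (fun=> 0).
        by apply/funext => y; rewrite big_ord0.
      exact: cst_continuous.
    have -> : (fun z => \sum_(k < m'.+1) c k * (Gk k (x - eps *: coord_proj l z) * z 0 i ^+ k)) =
      (fun z => \sum_(k < m') c k * (Gk k (x - eps *: coord_proj l z) * z 0 i ^+ k) +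
         c m' * (Gk m' (x - eps *: coord_proj l z) * z 0 i ^+ m')).
      by apply/funext => y; rewrite big_ord_recr.
    by apply: continuousD.
  exact: csum.
have dR : dominated (fun z => rem z * sg z) (B * eps ^+ m * D') by exact: hD'.
have [[LA dSA] EA] := @integral_rV_sum R n _ (index_enum 'I_m) (fun (k : 'I_m) z => A k z)
  (fun k _ => ex_intro _ _ (dA k)).
have -> : (fun z => G (x - eps *: coord_proj (i :: l) z) * sg z) =
    (fun z => (\sum_(k < m) A k z) + rem z * sg z).
  apply/funext => z.
  have -> : \sum_(k < m) A k z =
      (\sum_(k < m) c k * (Gk k (x - eps *: coord_proj l z) * z 0 i ^+ k)) * sg z.
    by rewrite mulr_suml; apply: eq_bigr => k _; rewrite /A !mulrA.
  by rewrite -mulrDl /rem [X in _ = X * _]addrC subrK.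
rewrite (integral_rVD dSA dR) EA.
have Rb : `|integral_rV (fun z => rem z * sg z)| <= D' * I1 ^+ n * eps ^+ m * B.
  apply: le_trans (integral_rV_le dR) _.
  by rewrite le_eqVlt; apply/orP; left; apply/eqP; rewrite -/I1; ring.
(* only k = 0 contributes: the other moments vanish *)
have Ab (k : 'I_m) : `|integral_rV (A k) - (k == 0%N :> nat)%:R * (G x * integral_rV sg)| <= C k * eps ^+ m * B.
  have dk : dominated (fun z => Gk k (x - eps *: coord_proj l z) * (z 0 i ^+ k * sg z)) (B * D k).
    apply: (hD k).2; first exact: continuous_coord_proj_affine.
    move=> z; apply: le_trans (hGk k [::] _ (ltn_ord k) (leq0n _)) _.
    by rewrite ler_wpM2l// growth.
  have H := (hC k).2 (Gk k) x eps B (smoothR_iter _ sG) eps01 (fun s z sl => hGk k s z (ltn_ord k) sl).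
  rewrite (integral_rVZ _ dk).
  case: (posnP k) H => [k0|k0] H.
    rewrite k0 mul1r /c expr0 fact0 divr1 mul1r; move: H; rewrite k0 /Gk /=.
    have -> : (fun z => z 0 i ^+ 0 * sg z) = sg by apply/funext => z; rewrite expr0 mul1r.
    by [].
  rewrite moment_coord_pow// mulr0 subr0 in H; rewrite mul0r subr0 normrM.
  apply: le_trans H; rewrite ler_piMl//.
  rewrite /c normrM normrX normrN (gtr0_norm e0) normfV normr_nat.
  rewrite ler_pdivrMr ?ltr0n ?fact_gt0// mul1r.
  apply: le_trans (_ : 1 <= _); last by rewrite ler1n fact_gt0.
  by rewrite exprn_ile1// ltW.
rewrite addrAC; apply: le_trans (ler_normD _ _) _.
rewrite mulrDl mulrDl lerD//.
have -> : G x * integral_rV sg = \sum_(k < m) ((k == 0%N :> nat)%:R * (G x * integral_rV sg)).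
  rewrite (bigD1 (Ordinal m0))//= mul1r big1 ?addr0// => k.
  by rewrite -val_eqE /= => /negbTE ->; rewrite mul0r.
rewrite -sumrB; apply: le_trans (ler_norm_sum _ _ _) _.
by rewrite !mulr_suml; apply: ler_sum => k _; exact: Ab.
Qed.

Lemma moment_approx sg (m M : nat) : (0 < m)%N -> rapid sg -> vanishing_moments sg ->
  exists2 C : R, 0 <= C & forall G x (eps B : R), smoothR setT G -> 0 < eps <= 1 ->
    (forall s z, (size s <= n * m)%N ->
       `|iter_partial s G (x - eps *: z)| <= B * (1 + `|z|) ^+ M) ->
    `|integral_rV (fun z => G (x - eps *: z) * sg z) - G x * integral_rV sg| <= C * eps ^+ m * B.
Proof.
move=> m0 rs vs.
have [C C0 hC] := @moment_approx_proj m M (enum 'I_n) m0 (enum_uniq _) sg rs vs.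
exists C => // G x eps B sG e01; rewrite size_enum_ord in hC => hB.
have := hC G x eps B sG e01 hB.
have -> : (fun z => G (x - eps *: coord_proj (enum 'I_n) z) * sg z) =
    (fun z => G (x - eps *: z) * sg z) by apply/funext => z; rewrite coord_proj_enum.
by [].
Qed.
End MomentApprox.

(** * Convolution of functionals with smooth functions *)

Section Tame.
Context {R : realType} {n : nat}.
Implicit Types (x y z : 'rV[R]_n) (g h psi : 'rV[R]_n -> R) (w : ('rV[R]_n -> R) -> R).
Local Notation e i := (delta_mx 0 i : 'rV[R]_n).

(** The functions to which a functional with finitely many derivatives applies uniformly in translations. *)
Definition bsmooth g := smoothR setT g /\
  forall s, exists C : R, forall x, `|iter_partial s g x| <= C.

Definition schwR g := smoothR setT g /\
  forall s k, exists C : R, forall x, (1 + `|x|) ^+ k * `|iter_partial s g x| <= C.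

Lemma schwR_bsmooth g : schwR g -> bsmooth g.
Proof.
move=> [sg hg]; split=> // s; have [C hC] := hg s 0%N; exists C => x.
by have := hC x; rewrite expr0 mul1r.
Qed.

Lemma schwR_rapid g : schwR g -> rapid g.
Proof. by move=> [sg hg]; split; [exact: smoothRT_continuous|exact: (hg [::])]. Qed.

Lemma bsmooth_iter s g : bsmooth g -> bsmooth (iter_partial s g).
Proof.
move=> [sg hg]; split; first exact: smoothR_iter.
by move=> t; rewrite -iter_partial_cat.
Qed.

Lemma bsmooth_dbound m g : bsmooth g -> exists2 B, 0 < B & dbound m setT g B.
Proof.
move=> [_ hg].
have [//||B B0 hB] := @short_seqs_bound R n m (fun s B => forall x, `|iter_partial s g x| <= B).
  by move=> s B B' BB H x; rewrite (le_trans (H x)).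
by exists B => // s y sm _; exact: hB.
Qed.

Lemma lipschitz_dbound1 g B : smoothR setT g -> dbound 1 setT g B ->
  forall y z, `|g y - g z| <= n%:R * B * `|y - z|.
Proof.
move=> sg hB y z.
have B0 : 0 <= B by apply: dbound_ge0 hB; exact: (I : setT (0 : 'rV[R]_n)).
apply: (@lip_cube _ _ g z `|y - z|) => //; last by rewrite subrr normr0.
  by move=> i v _; exact: (smoothR_derivable sg).
by move=> i v _; exact: (hB [:: i]).
Qed.

Lemma bsmooth_lipschitz g : bsmooth g -> exists2 L : R, 0 < L &
  forall y z, `|g y - g z| <= L * `|y - z|.
Proof.
move=> bg; have [B B0 hB] := bsmooth_dbound 1 bg.
exists (n%:R * B + 1) => [|y z]; first by rewrite ltr_wpDl// mulr_ge0// ltW.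
rewrite (le_trans (lipschitz_dbound1 bg.1 hB y z))// ler_wpM2r// lerDl//.
Qed.

Lemma iter_partial_reflect psi s x y : smoothR setT psi ->
  iter_partial s (fun y => psi (x - y)) y = (-1) ^+ size s * iter_partial s psi (x - y).
Proof.
move=> sp; have [_ /(_ s y I)] := smoothR_affine x (-1) openT sp.
have -> : (fun y => psi (x + -1 *: y)) = (fun y => psi (x - y)).
  by apply/funext => v; rewrite scaleN1r.
by rewrite scaleN1r.
Qed.

Lemma smoothR_reflect psi x : smoothR setT psi -> smoothR setT (fun y => psi (x - y)).
Proof.
move=> sp; have [+ _] := smoothR_affine x (-1) openT sp.
have -> : (fun y => psi (x + -1 *: y)) = (fun y => psi (x - y)).
  by apply/funext => v; rewrite scaleN1r.
by [].
Qed.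

(** Real functionals on smooth functions that are continuous for the seminorms [dbound] on [K]: what is
    left of a compactly supported distribution after fixing a cut-off and taking real or imaginary parts. *)
Definition tame (K : set 'rV[R]_n) w :=
  (forall (c : R) g h, smoothR setT g -> smoothR setT h ->
     w (fun y => c * g y + h y) = c * w g + w h) /\
  exists (C : R) (m : nat), 0 <= C /\ forall g B, smoothR setT g -> 0 <= B ->
     dbound m K g B -> `|w g| <= C * B.

Definition convol w psi x := w (fun y => psi (x - y)).

Section OneFunctional.
Variables (K : set 'rV[R]_n) (w : ('rV[R]_n -> R) -> R).
Hypothesis tw : tame K w.

Lemma tame0 : w (fun=> 0) = 0.
Proof.
have [s0 _] := @smoothR_cst R n setT 0 openT.
have := tw.1 1 _ _ s0 s0; rewrite !mul1r addr0 => /eqP.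
by rewrite -[X in X == _]addr0 (inj_eq (addrI _)) eq_sym => /eqP.
Qed.

Lemma tameB g h : smoothR setT g -> smoothR setT h -> w (fun y => g y - h y) = w g - w h.
Proof.
move=> sg sh; have := tw.1 (-1) _ _ sh sg; rewrite mulN1r addrC => <-.
by congr w; apply/funext => y; rewrite mulN1r addrC.
Qed.

Lemma tameZ c g : smoothR setT g -> w (fun y => c * g y) = c * w g.
Proof.
move=> sg; have [s0 _] := @smoothR_cst R n setT 0 openT.
have := tw.1 c _ _ sg s0; rewrite tame0 addr0 => <-.
by congr w; apply/funext => y; rewrite addr0.
Qed.

Lemma tame_sum (J : Type) (r : seq J) (c : J -> R) (F : J -> 'rV[R]_n -> R) :
  (forall j, smoothR setT (F j)) ->
  w (fun y => \sum_(j <- r) c j * F j y) = \sum_(j <- r) c j * w (F j).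
Proof.
move=> sF; elim: r => [|j r IH].
  by rewrite big_nil -[RHS]tame0; congr w; apply/funext => y; rewrite big_nil.
have sr : smoothR setT (fun y => \sum_(j <- r) c j * F j y).
  have [] := smoothR_sum (F := fun j y => c j * F j y) r openT _ => //.
  by move=> i; have [] := smoothR_scale (c i) openT (sF i).
rewrite big_cons -IH -tw.1//; congr w; apply/funext => y.
by rewrite big_cons.
Qed.

Lemma convol_quad psi B m C : 0 <= B -> 0 <= C -> smoothR setT psi ->
  (forall g B, smoothR setT g -> 0 <= B -> dbound m K g B -> `|w g| <= C * B) ->
  dbound (m + 2) setT psi B ->
  forall x i (t : R),
  `|convol w psi (x + t *: e i) - convol w psi x - t * convol w ('D_(e i) psi) x| <= C * B * t ^+ 2.
Proof.
move=> B0 C0 sp hw hB x i t.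
have sD : smoothR setT ('D_(e i) psi) := smoothR_iter [:: i] sp.
have s1 := smoothR_reflect (x + t *: e i) sp.
have s2 := smoothR_reflect x sp.
have s3 := smoothR_reflect x sD.
have [s12 d12] := smoothR_sub_fun openT s1 s2.
have [s4 d4] := smoothR_scale t openT s3.
have [s5 d5] := smoothR_sub_fun openT s12 s4.
rewrite /convol -(tameB s1 s2) -(tameZ t s3) -(tameB s12 s4) -mulrA.
apply: hw => //; first by rewrite mulr_ge0// sqr_ge0.
move=> s y sm _; rewrite d5// d12// d4// !iter_partial_reflect//.
have -> : iter_partial s (fun y => 'D_(e i) psi (x - y)) y =
  (-1) ^+ size s * iter_partial s ('D_(e i) psi) (x - y) := iter_partial_reflect s x y sD.
have -> : iter_partial s ('D_(e i) psi) (x - y) = 'D_(e i) (iter_partial s psi) (x - y).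
  rewrite -[LHS]/(iter_partial s (iter_partial [:: i] psi) (x - y)) -iter_partial_cat.
  apply: (iter_partial_perm (s' := i :: s) openT sp I).
  by rewrite cats1 perm_rcons.
rewrite mulrCA -mulrBr -mulrBr normrM normrX normrN1 expr1n mul1r.
rewrite [x + _ - y]addrAC.
apply: (@quad_line _ _ setT) => //; first exact: smoothR_iter.
move=> u _; rewrite -iter_partial_cat; apply: hB => //.
by rewrite size_cat addnC leq_add2r.
Qed.

Lemma convol_bound psi B m C : 0 <= B -> smoothR setT psi ->
  (forall g B, smoothR setT g -> 0 <= B -> dbound m K g B -> `|w g| <= C * B) ->
  dbound m setT psi B -> forall x, `|convol w psi x| <= C * B.
Proof.
move=> B0 sp hw hB x; apply: hw => //; first exact: smoothR_reflect.
move=> s y sm _; rewrite iter_partial_reflect// normrM normrX normrN1 expr1n mul1r.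
exact: hB.
Qed.

(** The remainder of psi at order two is quadratic in all the seminorms of [w], so derivatives pass under
    [w]. *)
Lemma convol_smooth psi : bsmooth psi -> smoothR setT (convol w psi) /\
  forall s x, iter_partial s (convol w psi) x = convol w (iter_partial s psi) x.
Proof.
move=> bp; have [C [m [C0 hw]]] := tw.2.
pose G s := convol w (iter_partial s psi).
have [|h1 h2] := @smoothR_quad_family R n setT G openT; last by split=> // s x; exact: h2.
move=> s x _.
have bs := bsmooth_iter s bp.
have [B B0 hB] := bsmooth_dbound (m + 2) bs.
exists (C * B), 1; split=> // y _; split.
  apply: convol_bound hw _ _ => //; [exact: ltW|exact: bs.1|].
  by move=> t z tm; apply: hB; rewrite (leq_trans tm)// leq_addr.
move=> i t _; apply: convol_quad hw hB _ _ _ => //; [exact: ltW|exact: bs.1].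
Qed.

Lemma convol_bsmooth psi : bsmooth psi -> bsmooth (convol w psi).
Proof.
move=> bp; have [sc Ec] := convol_smooth bp; split=> // s.
have [C [m [C0 hw]]] := tw.2.
have bs := bsmooth_iter s bp; have [B B0 hB] := bsmooth_dbound m bs.
exists (C * B) => x; rewrite Ec; apply: convol_bound hw hB _; [exact: ltW|exact: bs.1].
Qed.

End OneFunctional.

Lemma bsmooth_mul_lipschitz a b (A LA Bb LB : R) :
  (forall z, `|a z| <= A) -> (forall z z', `|a z - a z'| <= LA * `|z - z'|) ->
  (forall z, `|b z| <= Bb) -> (forall z z', `|b z - b z'| <= LB * `|z - z'|) ->
  forall z z', `|a z * b z - a z' * b z'| <= (A * LB + LA * Bb) * `|z - z'|.
Proof.
move=> hA lA hB lB z z'.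
have -> : a z * b z - a z' * b z' = a z * (b z - b z') + (a z - a z') * b z' by ring.
apply: le_trans (ler_normD _ _) _; rewrite !normrM mulrDl -(mulrA A) (mulrAC LA).
by apply: lerD; apply: ler_pM.
Qed.

Lemma integral_rVB (f g : 'rV[R]_n -> R) L L' : dominated f L -> dominated g L' ->
  dominated (fun z => f z - g z) (L + L') /\
  integral_rV (fun z => f z - g z) = integral_rV f - integral_rV g.
Proof.
move=> df dg; have dN := dominatedZ (-1) dg.
have -> : (fun z => f z - g z) = (fun z => f z + -1 * g z) by apply/funext => z; rewrite mulN1r.
rewrite (integral_rVD df dN) (integral_rVZ (-1) dg) mulN1r; split=> //.
by have := dominatedD df dN; rewrite normrN1 mul1r.
Qed.

(** Convolution with [h] at scale [d], in the variables in which the mollifier does not depend on [d]. *)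
Definition average psi h (d : R) x := integral_rV (fun z => psi (x - d *: z) * h z).

Lemma average_dominated h : rapid h -> exists2 C : R, 0 <= C & forall g B, continuous g ->
   (forall z, `|g z| <= B) -> dominated (fun z => g z * h z) (B * C).
Proof.
move=> rh; have [C C0 hC] := rapid_dominated_growth 0 rh; exists C => // g B cg gB.
by apply: hC => // z; rewrite expr0 mulr1.
Qed.

Lemma average_smooth psi h d : bsmooth psi -> rapid h -> smoothR setT (average psi h d) /\
  forall s x, iter_partial s (average psi h d) x = average (iter_partial s psi) h d x.
Proof.
move=> bp rh.
have [D D0 hD] := average_dominated rh.
pose I1 := \int[@lebesgue_measure R]_t (oneDsqr t)^-1.
have I1n : 0 <= I1 ^+ n by rewrite exprn_ge0 ?Rintegral_oneDsqrV_ge0.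
pose G s := average (iter_partial s psi) h d.
have [|h1 h2] := @smoothR_quad_family R n setT G openT; last by split=> // s x; exact: h2.
move=> s x _; have bs := bsmooth_iter s bp.
have [B B0 hB] := bsmooth_dbound 2 bs.
have cc g y : continuous g -> continuous (fun z => g (y - d *: z)) by exact: continuous_affine.
have dom t y : (size t <= 2)%N -> dominated (fun z => iter_partial t (iter_partial s psi) (y - d *: z) * h z) (B * D).
  move=> t2; apply: hD => [|z]; last exact: hB.
  by apply: cc; apply: smoothRT_continuous; exact: (bsmooth_iter t bs).1.
exists (B * D * I1 ^+ n), 1; split=> // y _; split.
  by apply: integral_rV_le; exact: (dom [::]).
move=> i t _; rewrite /G /average.
have d1 := dom [::] (y + t *: e i) isT; have d2 := dom [::] y isT; have d3 := dom [:: i] y isT.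
have E : integral_rV (fun z => iter_partial s psi (y + t *: e i - d *: z) * h z) -
   integral_rV (fun z => iter_partial s psi (y - d *: z) * h z) -
   t * integral_rV (fun z => iter_partial (i :: s) psi (y - d *: z) * h z) =
   integral_rV (fun z => (iter_partial s psi (y - d *: z + t *: e i) - iter_partial s psi (y - d *: z)
      - t * 'D_(e i) (iter_partial s psi) (y - d *: z)) * h z).
  have [d12 E12] := integral_rVB d1 d2.
  have [_ E3] := integral_rVB d12 (dominatedZ t d3).
  rewrite -(integral_rVZ t d3) -E12 -E3.
  congr integral_rV; apply/funext => z; rewrite /= [y + _ - _]addrAC; ring.
rewrite E; have -> : B * D * I1 ^+ n * t ^+ 2 = (B * t ^+ 2 * D) * I1 ^+ n by ring.
apply: integral_rV_le; apply: hD => [z|z].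
  have cs : continuous (iter_partial s psi) by apply: smoothRT_continuous; exact: bs.1.
  have cD : continuous (iter_partial [:: i] (iter_partial s psi)).
    by apply: smoothRT_continuous; exact: (bsmooth_iter [:: i] bs).1.
  have ca : continuous (fun z => iter_partial s psi (y - d *: z + t *: e i)).
    have -> : (fun z => iter_partial s psi (y - d *: z + t *: e i)) =
       (fun z => iter_partial s psi ((y + t *: e i) - d *: z)).
      by apply/funext => v; rewrite addrAC.
    exact: cc.
  have cb := cc _ y cs.
  have cd : continuous (fun z => t * iter_partial [:: i] (iter_partial s psi) (y - d *: z)).
    move=> v; apply: (@continuousM _ _ (fun=> t) (fun z => iter_partial [:: i] (iter_partial s psi) (y - d *: z)) v).
      exact: cst_continuous.
    exact: (cc _ y cD).
  exact: (@continuousB _ _ _ (fun z => iter_partial s psi (y - d *: z + t *: e i) - iter_partial s psi (y - d *: z)) _ z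
    (@continuousB _ _ _ _ _ z (ca z) (cb z)) (cd z)).
apply: (@quad_line _ _ setT) => //; first exact: bs.1.
by move=> u _; exact: hB.
Qed.
End Tame.

(** * Exchange of averages and functionals *)

Section Fubini.
Context {R : realType} {n : nat}.
Implicit Types (x y z : 'rV[R]_n) (g h psi : 'rV[R]_n -> R) (w : ('rV[R]_n -> R) -> R).

Lemma rapid_wt_sq h : rapid h -> exists2 D : R, 0 <= D & forall z, `|h z| <= D * wt z ^+ 2.
Proof.
move=> [_ hh]; have [D hD] := hh ((2 * n) * 2)%N.
have D0 : 0 <= D by rewrite (le_trans _ (hD 0))// mulr_ge0 ?oneDnorm_ge0.
exists D => // z; have H := hD z; rewrite exprM in H.
have W := wt_growth z.
apply: le_trans (_ : ((1 + `|z|) ^+ (2 * n) * wt z) ^+ 2 * `|h z| <= _).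
  by rewrite ler_peMl// exprn_ege1.
by rewrite exprMn mulrAC ler_wpM2r// exprn_ge0// wt_ge0.
Qed.

Lemma eq_of_le_eps (a b C : R) : 0 <= C -> (forall tau : R, 0 < tau -> `|a - b| <= C * tau) -> a = b.
Proof.
move=> C0 H; apply/eqP; rewrite -subr_eq0 -normr_le0; apply/ler_addgt0Pl => eps eps0.
rewrite addr0 (le_trans (H (eps / (C + 1)) _))//.
  by rewrite divr_gt0// ltr_wpDl.
rewrite mulrCA ler_piMr//; first exact: ltW.
by rewrite ler_pdivrMr ?ltr_wpDl// mul1r lerDl.
Qed.

(** Replace the integral by a quadrature rule.  The rule is valid uniformly for the integrand to which [w]
    has been applied (index [None]) and for all derivatives of the integrand before applying [w]
    (index [Some]); [w] commutes with the finite sum, and its continuity absorbs the error. *)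
Lemma convol_average K w psi h (d : R) x : tame K w -> bsmooth psi -> schwR h ->
  average (convol w psi) h d x = convol w (average psi h d) x.
Proof.
move=> tw bp sh.
have rh := schwR_rapid sh.
have [C [m [C0 hw]]] := tw.2.
have [B B0 hB] := bsmooth_dbound m.+1 bp.
have bc := convol_bsmooth tw bp.
have [B' B'0 hB'] := bsmooth_dbound 1 bc.
have [Bh Bh0 hBh] := bsmooth_dbound 0 (schwR_bsmooth sh).
have [Lh Lh0 hLh] := bsmooth_lipschitz (schwR_bsmooth sh).
have [D D0 hD] := rapid_wt_sq rh.
pose B1 := B + B'.
have B10 : 0 <= B1 by rewrite addr_ge0// ltW.
(* the case distinction on the size makes the family bounded over its whole index type *)
pose F (j : option (seq 'I_n * 'rV[R]_n)) z :=
  match j with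
  | None => convol w psi (x - d *: z) * h z
  | Some p => if (size p.1 <= m)%N then iter_partial p.1 psi (p.2 - d *: z) * h z else 0
  end.
pose L := B1 * D + (B1 * Lh + (n%:R * B1 * `|d|) * Bh) + 1.
have L2 : 0 <= B1 * Lh + (n%:R * B1 * `|d|) * Bh.
  by rewrite addr_ge0 ?mulr_ge0// ltW.
have L0 : 0 < L by rewrite ltr_wpDl// addr_ge0// mulr_ge0.
have gen (g : 'rV[R]_n -> R) (a : 'rV[R]_n) : smoothR setT g -> dbound 1 setT g B1 ->
    (forall z, `|g (a - d *: z) * h z| <= L * wt z ^+ 2) /\
    (forall z z', `|g (a - d *: z) * h z - g (a - d *: z') * h z'| <= L * `|z - z'|).
  move=> sg hg; have lg := lipschitz_dbound1 sg hg; split=> [z|z z'].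
    rewrite normrM; apply: le_trans (_ : B1 * (D * wt z ^+ 2) <= _).
      by apply: ler_pM => //; exact: (hg [::]).
    rewrite mulrA ler_wpM2r ?exprn_ge0 ?wt_ge0// /L -addrA lerDl addr_ge0//.
  have la v v' : `|g (a - d *: v) - g (a - d *: v')| <= (n%:R * B1 * `|d|) * `|v - v'|.
    apply: le_trans (lg _ _) _.
    have -> : a - d *: v - (a - d *: v') = d *: (v' - v).
      by rewrite scalerBr opprB addrC addrA subrK.
    by rewrite normrZ [`|v' - v|]distrC !mulrA.
  apply: le_trans (@bsmooth_mul_lipschitz R n (fun z => g (a - d *: z)) h _ _ _ _
    (fun v => hg [::] (a - d *: v) isT I) la (fun v => hBh [::] v isT I) hLh z z') _.
  by rewrite ler_wpM2r// /L addrAC lerDr addr_ge0// mulr_ge0.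
have hF : (forall j z, `|F j z| <= L * wt z ^+ 2) /\
    (forall j z z', `|F j z - F j z'| <= L * `|z - z'|).
  have g1 : smoothR setT (convol w psi) /\ dbound 1 setT (convol w psi) B1.
    split; first exact: bc.1.
    by move=> s y s1 _; rewrite (le_trans (hB' s y s1 I))// /B1 lerDr ltW.
  have gs s : (size s <= m)%N -> smoothR setT (iter_partial s psi) /\ dbound 1 setT (iter_partial s psi) B1.
    move=> sm; split; first exact: (bsmooth_iter s bp).1.
    move=> t y t1 _; rewrite -iter_partial_cat (le_trans (hB _ y _ I))// ?/B1 ?lerDl ?ltW//.
    by rewrite size_cat -add1n leq_add.
  have [H1 H2] := (fun a => (gen _ a g1.1 g1.2).1, fun a => (gen _ a g1.1 g1.2).2).
  split=> -[[s xi]|] /=.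
  - case: (boolP (size s <= m)%N) => [sm|_] z; first exact: (gen _ xi (gs s sm).1 (gs s sm).2).1.
    by rewrite normr0 mulr_ge0 ?exprn_ge0 ?wt_ge0// ltW.
  - exact: H1.
  - case: (boolP (size s <= m)%N) => [sm|_] z z'; first exact: (gen _ xi (gs s sm).1 (gs s sm).2).2.
    by rewrite subrr normr0 mulr_ge0// ltW.
  - exact: H2.
have [sa Ea] := average_smooth d bp rh.
apply: (@eq_of_le_eps _ _ (1 + C)) => [|tau tau0]; first by rewrite addr_ge0.
have [l hl] := quadrature_rV L0 hF.1 hF.2 tau0.
pose S y := \sum_(p <- l) (p.1 * h p.2) * psi ((x - d *: p.2) - y).
have sS : smoothR setT S /\ forall s y, iter_partial s S y =
    \sum_(p <- l) (p.1 * h p.2) * ((-1) ^+ size s * iter_partial s psi ((x - d *: p.2) - y)).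
  have sp p := smoothR_scale (p.1 * h p.2) openT (smoothR_reflect (x - d *: p.2) bp.1).
  have [h1 h2] := smoothR_sum (F := fun p y => (p.1 * h p.2) * psi ((x - d *: p.2) - y)) l openT (fun p => (sp p).1).
  split=> // s y; rewrite h2//; apply: eq_bigr => p _.
  by rewrite (sp p).2// iter_partial_reflect//; exact: bp.1.
have ES : w S = \sum_(p <- l) p.1 * F None p.2.
  rewrite /S (tame_sum tw l (fun p => p.1 * h p.2) (F := fun p y => psi ((x - d *: p.2) - y))).
    by apply: eq_bigr => p _; rewrite /F /convol; ring.
  by move=> p; apply: smoothR_reflect; exact: bp.1.
have H1 : `|average (convol w psi) h d x - w S| <= tau by rewrite ES; exact: (hl None).
have H2 : `|convol w (average psi h d) x - w S| <= C * tau.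
  have sr := smoothR_reflect x sa.
  rewrite /convol -(tameB tw sr sS.1).
  have [sd dd] := smoothR_sub_fun openT sr sS.1.
  apply: hw => //; first exact: ltW.
  move=> s y sm _; rewrite dd// sS.2 iter_partial_reflect// Ea.
  have := hl (Some (s, x - y)); rewrite /F /= sm /average => Hs.
  have -> : \sum_(p <- l) p.1 * h p.2 * ((-1) ^+ size s * iter_partial s psi (x - d *: p.2 - y)) =
      (-1) ^+ size s * \sum_(p <- l) p.1 * (iter_partial s psi (x - y - d *: p.2) * h p.2).
    by rewrite mulr_sumr; apply: eq_bigr => p _; rewrite [x - _ - y]addrAC; ring.
  by rewrite -mulrBr normrM normrX normrN1 expr1n mul1r.
rewrite mulrDl mul1r -(subrKA (w S)); apply: le_trans (ler_normD _ _) _.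
by apply: lerD => //; rewrite distrC.
Qed.

(** Real counterpart of [rescale]. *)
Definition rescR g (eps : R) x := eps ^- n * g (eps^-1 *: x).

Lemma rescR_smooth g eps : smoothR setT g -> smoothR setT (rescR g eps) /\
  forall s x, iter_partial s (rescR g eps) x = eps ^- (n + size s) * iter_partial s g (eps^-1 *: x).
Proof.
move=> sg; have [h1 h2] := smoothR_affine 0 eps^-1 openT sg.
have E : (fun y => g (0 + eps^-1 *: y)) = (fun y => g (eps^-1 *: y)).
  by apply/funext => y; rewrite add0r.
rewrite E in h1 h2; have [h3 h4] := smoothR_scale (eps ^- n) openT h1.
by split=> // s x; rewrite h4// h2// add0r mulrA exprVn -invfM -exprD.
Qed.

Lemma rescR_bsmooth g eps : bsmooth g -> bsmooth (rescR g eps).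
Proof.
move=> bg; have [h1 h2] := rescR_smooth eps bg.1; split=> // s.
have [C hC] := bg.2 s; exists (`|eps ^- (n + size s)| * C) => x.
by rewrite h2 normrM ler_wpM2l.
Qed.

(** Both sides are the convolution of [g] at scale [eps] with [h] at scale [d]. *)
Lemma average_rescR_sym g h (eps d : R) x : 0 < eps -> 0 < d -> schwR g -> schwR h ->
  average (rescR g eps) h d x = average (rescR h d) g eps x.
Proof.
move=> e0 d0 sg sh.
have [D D0 hD] := average_dominated (schwR_rapid sh).
have br := rescR_bsmooth eps (schwR_bsmooth sg).
have [B B0 hB] := bsmooth_dbound 0 br.
have dF : dominated (fun z => rescR g eps (x - d *: z) * h z) (B * D).
  apply: hD => [|z]; last exact: (hB [::]).
  by apply: continuous_affine; apply: smoothRT_continuous; exact: br.1.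
have cd : 0 < eps / d by rewrite divr_gt0.
have := integral_rV_affine (d^-1 *: x) cd dF.
have [D' D'0 hD'] := average_dominated (schwR_rapid sg).
have br' := rescR_bsmooth d (schwR_bsmooth sh).
have [B' B'0 hB'] := bsmooth_dbound 0 br'.
have dF' : dominated (fun z => rescR h d (x - eps *: z) * g z) (B' * D').
  apply: hD' => [|z]; last exact: (hB' [::]).
  by apply: continuous_affine; apply: smoothRT_continuous; exact: br'.1.
have en : eps ^+ n != 0 by rewrite expf_neq0// gt_eqF.
have dn : d ^+ n != 0 by rewrite expf_neq0// gt_eqF.
have -> : (fun z => rescR g eps (x - d *: (d^-1 *: x - (eps / d) *: z)) * h (d^-1 *: x - (eps / d) *: z)) =
    (fun z => ((eps / d) ^- n) * (rescR h d (x - eps *: z) * g z)).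
  apply/funext => z; rewrite /rescR.
  have -> : x - d *: (d^-1 *: x - (eps / d) *: z) = eps *: z.
    have de : d * (eps / d) = eps by field; rewrite gt_eqF.
    by rewrite scalerBr !scalerA mulfV ?gt_eqF// scale1r de opprB addrC subrK.
  have -> : d^-1 *: (x - eps *: z) = d^-1 *: x - (eps / d) *: z.
    by rewrite scalerBr scalerA [d^-1 * eps]mulrC.
  rewrite scalerA mulVf ?gt_eqF// scale1r expr_div_n.
  by field; rewrite en dn.
have cn : (eps / d) ^- n != 0 by rewrite invr_eq0 expf_neq0// gt_eqF.
rewrite (integral_rVZ _ dF') => /(mulfI cn) E.
exact: esym E.
Qed.
End Fubini.

(** * Convolution at small scales *)

Section Scales.
Context {R : realType} {n : nat}.
Implicit Types (x y z : 'rV[R]_n) (g h psi : 'rV[R]_n -> R) (w : ('rV[R]_n -> R) -> R).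

Lemma expVr_le (eps : R) (a b : nat) : 0 < eps <= 1 -> (a <= b)%N -> eps ^- a <= eps ^- b.
Proof.
move=> /andP[e0 e1] ab; rewrite lef_pV2 ?posrE ?exprn_gt0//.
by rewrite ler_wiXn2l// ltW.
Qed.

(** A functional of order [m] sees [m] derivatives of the rescaled function, and each derivative costs one
    power of [eps]. *)
Lemma convol_rescR_bound K w g : tame K w -> schwR g -> exists N : nat, forall s,
  exists2 C : R, 0 <= C & forall eps x, 0 < eps <= 1 ->
    `|iter_partial s (convol w (rescR g eps)) x| <= C * eps ^- (N + size s).
Proof.
move=> tw sg; have bg := schwR_bsmooth sg.
have [C [m [C0 hw]]] := tw.2.
exists (n + m)%N => s.
have [B B0 hB] := bsmooth_dbound (m + size s) bg.
exists (C * B) => [|eps x e01]; first by rewrite mulr_ge0// ltW.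
have e0 : 0 < eps by case/andP: e01.
have br := rescR_bsmooth eps bg.
rewrite (convol_smooth tw br).2 -mulrA.
apply: (convol_bound (m := m) _ (bsmooth_iter s br).1 hw).
  by rewrite mulr_ge0 ?invr_ge0 ?exprn_ge0// ltW.
move=> t y tm _; rewrite -iter_partial_cat (rescR_smooth eps bg.1).2 normrM ger0_norm; last first.
  by rewrite invr_ge0 exprn_ge0// ltW.
rewrite mulrC ler_pM ?invr_ge0 ?exprn_ge0//; first exact: ltW.
- by apply: hB => //; rewrite size_cat leq_add2r.
- by apply: expVr_le => //; rewrite size_cat addnA leq_add2r leq_add2l.
Qed.

(** At distance [r] from [x] the rescaled function is evaluated at arguments larger than r / eps, where it is
    rapidly decreasing. *)
Lemma convol_rescR_far K w g (r : R) (k : nat) : tame K w -> schwR g -> 0 < r ->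
  exists2 C : R, 0 <= C & forall eps x, 0 < eps <= 1 ->
    (forall y, K y -> r <= `|x - y|) -> `|convol w (rescR g eps) x| <= C * eps ^+ k.
Proof.
move=> tw sg r0; have bg := schwR_bsmooth sg.
have [C [m [C0 hw]]] := tw.2.
pose k' := (k + (n + m))%N.
have [D D0 hD] : exists2 D : R, 0 < D & forall s, (size s <= m)%N ->
    forall x, (1 + `|x|) ^+ k' * `|iter_partial s g x| <= D.
  apply: (@short_seqs_bound R n m (fun s D => forall x, (1 + `|x|) ^+ k' * `|iter_partial s g x| <= D)).
    by move=> s; exact: sg.2.
  by move=> s B B' BB H x; rewrite (le_trans (H x)).
exists (C * (D * r ^- k')) => [|eps x e01 far].
  by rewrite mulr_ge0// mulr_ge0 ?invr_ge0 ?exprn_ge0// ltW.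
have e0 : 0 < eps by case/andP: e01.
have br := rescR_smooth eps bg.1.
rewrite -mulrA; apply: hw.
- exact: smoothR_reflect br.1.
- by rewrite !mulr_ge0 ?invr_ge0 ?exprn_ge0// ltW.
move=> t y tm Ky; rewrite iter_partial_reflect; last exact: br.1.
rewrite normrM normrX normrN1 expr1n mul1r br.2 normrM ger0_norm; last first.
  by rewrite invr_ge0 exprn_ge0// ltW.
apply: le_trans (_ : eps ^- (n + m) * (D * (r / eps) ^- k') <= _).
  rewrite ler_pM ?invr_ge0 ?exprn_ge0//; first exact: ltW.
    by apply: expVr_le => //; rewrite leq_add2l.
  rewrite ler_pdivlMr ?exprn_gt0 ?divr_gt0// mulrC.
  apply: le_trans (hD t tm (eps^-1 *: (x - y))); rewrite ler_wpM2r//.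
  rewrite lerXn2r ?nnegrE ?addr_ge0 ?divr_ge0//; try exact: ltW.
  rewrite normrZ gtr0_norm ?invr_gt0// mulrC ler_wpDl//.
  by rewrite ler_wpM2l ?far// invr_ge0 ltW.
rewrite /k' expr_div_n !exprD.
have en j : eps ^+ j != 0 by rewrite expf_neq0// gt_eqF.
have rn j : r ^+ j != 0 by rewrite expf_neq0// gt_eqF.
rewrite le_eqVlt; apply/orP; left; apply/eqP.
by field; rewrite !en !rn.
Qed.
End Scales.

Section Cutoff.
Context {R : realType}.

Lemma expR_ge_pow (k : nat) (u : R) : 0 <= u -> u ^+ k / k`!%:R <= expR u.
Proof.
elim: k u => [|k IH] u u0; first by rewrite expr0 fact0 divr1 -expR0 ler_expR.
have := @increment_le _ (fun u : R => 1 * u ^+ k.+1 / k.+1`!%:R) (fun u => 1 * u ^+ k / k`!%:R)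
  expR expR u u0 (fun t _ => is_derive_pow 1 k t) (fun t _ => is_derive_expR t).
rewrite !mul1r expr0n /= mul0r subr0 expR0 => H.
apply: le_trans (H _) _; last by rewrite lerBlDr lerDl.
by move=> t /andP[t0 _]; rewrite mul1r; exact: IH.
Qed.

(** The functions P(1/t) exp(-1/t), extended by 0, form a class closed under differentiation; see
    [is_derive_flat]. *)
Definition flat (P : {poly R}) (t : R) : R := if 0 < t then P.[t^-1] * expR (- t^-1) else 0.

Lemma poly_expRN_bounded (P : {poly R}) : exists2 C : R, 0 <= C &
  forall u, 0 <= u -> `|P.[u]| * expR (- u) <= C.
Proof.
exists (\sum_(i < size P) `|P`_i| * i`!%:R) => [|u u0].
  by apply: sumr_ge0 => i _; rewrite mulr_ge0.
rewrite horner_coef expRN ler_pdivrMr ?expR_gt0//.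
apply: le_trans (ler_norm_sum _ _ _) _; rewrite mulr_suml; apply: ler_sum => i _.
rewrite normrM -mulrA ler_wpM2l// ger0_norm ?exprn_ge0// mulrC -ler_pdivrMr ?ltr0n ?fact_gt0//.
exact: expR_ge_pow.
Qed.

(** Quadratic flatness at the origin is what makes all derivatives vanish there. *)
Lemma flat_quad P : exists2 C : R, 0 <= C & forall t, `|flat P t| <= C * t ^+ 2.
Proof.
have [C C0 hC] := poly_expRN_bounded ('X^2 * P); exists C => // t.
rewrite /flat; case: ifPn => [t0|_]; last by rewrite normr0 mulr_ge0// sqr_ge0.
have := hC t^-1 (ltac:(by rewrite invr_ge0 ltW)).
rewrite hornerM hornerXn normrM normrX (gtr0_norm (x := t^-1)) ?invr_gt0//.
rewrite normrM (gtr0_norm (x := expR _)) ?expR_gt0// exprVn -mulrA ler_pdivrMl ?exprn_gt0//.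
by rewrite [_ * C]mulrC.
Qed.

Lemma is_derive_flat P (t : R) :
  is_derive t (1 : R) (flat P) (flat ('X^2 * (P - P^`())) t).
Proof.
have [C C0 hC] := flat_quad P.
case: (ltrgtP t 0) => [t0|t0|->].
- have -> : flat ('X^2 * (P - P^`())) t = 0 by rewrite /flat ltNge ltW.
  apply: (@near_eq_is_derive _ _ _ (cst 0)).
  near=> u; rewrite /flat; have -> // : (0 < u) = false.
  by apply/negbTE; rewrite -leNgt; apply/ltW; near: u; exact: lt_nbhsl.
- have tn : t != 0 by rewrite gt_eqF.
  have dV : is_derive t (1 : R) (fun u : R => u^-1) (- t ^- 2).
    have d := @is_derive_id R R t (1 : R).
    apply: DeriveDef; first by apply: derivableV => //; exact: derivable_id.
    have := @deriveV _ _ (id : R -> R) t (1 : R) tn (@ex_derive _ _ _ _ _ _ _ d).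
    by rewrite derive_id /GRing.scale /= mulr1.
  have dH : is_derive (t^-1) (1 : R) (horner P) (P^`().[t^-1]).
    by apply: DeriveDef; [exact: derivable_horner|rewrite derivE derive1E].
  have dP := @is_derive1_comp _ _ _ t _ _ dH dV.
  have dN : is_derive t (1 : R) (fun u : R => - u^-1) (t ^- 2).
    by have := @is_deriveN _ _ _ _ _ _ _ dV; rewrite opprK.
  have dE := @is_derive1_comp _ _ _ t _ _ (is_derive_expR (- t^-1)) dN.
  have dM := @is_deriveM _ _ _ _ _ _ _ _ dP dE.
  have N : \near t, ((horner P \o (fun u : R => u^-1)) * (expR \o (fun u : R => - u^-1))) t = flat P t.
    near=> u; rewrite /flat; have -> // : (0 < u) = true.
    by near: u; exact: lt_nbhsr.
  apply: is_derive_eq (near_eq_is_derive N dM) _.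
  rewrite /flat t0 hornerM hornerXn hornerD hornerN /GRing.scale /= exprVn; ring.
- have -> : flat ('X^2 * (P - P^`())) 0 = 0 by rewrite /flat ltxx.
  apply: (@is_derive_quad _ _ _ _ _ _ C 1) => // u _.
  by rewrite mulr0 subr0 {2}/flat ltxx subr0 add0r [u *: _]mulr1.
Unshelve. all: by end_near. Qed.
End Cutoff.

(** * Cut-off functions *)

Section CubeCutoff.
Context {R : realType} {n : nat}.
Implicit Types (x y z c : 'rV[R]_n).
Local Notation e i := (delta_mx 0 i : 'rV[R]_n).

Lemma flat_continuous (P : {poly R}) : continuous (flat P).
Proof.
move=> t; apply: differentiable_continuous; apply/derivable1_diffP.
by case: (is_derive_flat P t).
Qed.

Lemma flat_affine_smooth (P : {poly R}) (i : 'I_n) (a b : R) :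
  smoothR setT (fun x : 'rV[R]_n => flat P (a * x 0 i + b)).
Proof.
pose C : set ('rV[R]_n -> R) := [set g | exists P, g = fun x => flat P (a * x 0 i + b)].
apply: (@smoothR_class _ _ setT C openT); last by exists P.
  move=> g x [Q ->] _.
  apply: (@continuous_comp _ _ _ (fun x : 'rV[R]_n => a * x 0 i + b) (flat Q)); last exact: flat_continuous.
  apply: (@continuousD _ _ _ (fun x : 'rV[R]_n => a * x 0 i) (fun=> b) x); last exact: cst_continuous.
  apply: (@continuousM _ _ (fun=> a) (fun x : 'rV[R]_n => x 0 i) x); first exact: cst_continuous.
  exact: continuous_coord.
move=> g j [Q ->]; pose k : R := a * (i == j)%:R.
exists (fun x => flat (k *: ('X^2 * (Q - Q^`()))) (a * x 0 i + b)).
  by exists (k *: ('X^2 * (Q - Q^`()))).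
move=> x _; apply: is_derive_of_line.
have -> : (fun u : R => flat Q (a * (x + u *: e j) 0 i + b)) =
    (flat Q \o (fun u : R => k * u + (a * x 0 i + b))).
  by apply/funext => u /=; congr flat; rewrite !mxE eqxx /= /k; ring.
have dk : is_derive (0 : R) (1 : R) (fun u : R => k * u + (a * x 0 i + b)) k.
  have d0 := @is_derive_id R R 0 (1 : R).
  have d1 := @is_deriveD _ _ _ _ _ _ _ _ _ (@is_deriveZ _ _ _ _ k _ _ _ d0) (@is_derive_cst R R R (a * x 0 i + b) 0 (1 : R)).
  apply: is_derive_eq d1 _.
  by rewrite addr0 /GRing.scale /= mulr1.
have dF : is_derive (k * 0 + (a * x 0 i + b)) (1 : R) (flat Q) (flat ('X^2 * (Q - Q^`())) (a * x 0 i + b)).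
  by rewrite mulr0 add0r; exact: is_derive_flat.
have dc := @is_derive1_comp _ (flat Q) (fun u : R => k * u + (a * x 0 i + b)) 0 _ _ dF dk.
apply: (is_derive_eq dc).
rewrite /flat; case: ifP => _; last by rewrite mul0r.
by rewrite hornerZ; ring.
Qed.

Definition ecut (t : R) := flat 1 t.

Lemma ecut_ge0 t : 0 <= ecut t.
Proof. by rewrite /ecut /flat; case: ifP => // _; rewrite hornerC mul1r expR_ge0. Qed.

Lemma ecut_gt0 t : 0 < t -> 0 < ecut t.
Proof. by move=> t0; rewrite /ecut /flat t0 hornerC mul1r expR_gt0. Qed.

Lemma ecut_eq0 t : t <= 0 -> ecut t = 0.
Proof. by move=> t0; rewrite /ecut /flat ltNge t0. Qed.

(** The quotient A / (A + B), where [A] is positive exactly inside the large cube and [B] exactly outside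
    the small one. *)
Lemma cube_cutoff c (r : R) : 0 < r -> exists theta : 'rV[R]_n -> R,
  [/\ smoothR setT theta, forall y, `|y - c| <= r -> theta y = 1 &
      forall y, 2 * r <= `|y - c| -> theta y = 0].
Proof.
move=> r0.
pose A y := \prod_(i < n) (ecut (1 * y 0 i + (2 * r - c 0 i)) * ecut (-1 * y 0 i + (2 * r + c 0 i))).
pose B y := \sum_(i < n) (ecut (1 * y 0 i + (- r - c 0 i)) + ecut (-1 * y 0 i + (- r + c 0 i))).
have sA : smoothR setT A.
  apply: (@smoothR_prod R n setT _ (index_enum 'I_n) (fun i y =>
    ecut (1 * y 0 i + (2 * r - c 0 i)) * ecut (-1 * y 0 i + (2 * r + c 0 i))) openT) => i.
  by have [] := smoothR_mul openT (flat_affine_smooth 1 i 1 (2 * r - c 0 i)) (flat_affine_smooth 1 i (-1) (2 * r + c 0 i)).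
have sB : smoothR setT B.
  have [] // := smoothR_sum (F := fun i y => ecut (1 * y 0 i + (- r - c 0 i)) + ecut (-1 * y 0 i + (- r + c 0 i))) (index_enum 'I_n) openT.
  by move=> i; have [] := smoothR_add openT (flat_affine_smooth 1 i 1 (- r - c 0 i)) (flat_affine_smooth 1 i (-1) (- r + c 0 i)).
have A0 y : 0 <= A y by apply: prodr_ge0 => i _; rewrite mulr_ge0 ?ecut_ge0.
have B0 y : 0 <= B y by apply: sumr_ge0 => i _; rewrite addr_ge0 ?ecut_ge0.
have Apos y : `|y - c| <= r -> 0 < A y.
  move=> yr; apply: prodr_gt0 => i _.
  have := le_trans (coord_le_norm (y - c) i) yr; rewrite !mxE ler_norml => /andP[h1 h2].
  by rewrite mulr_gt0// ecut_gt0//; move: h1 h2; lra.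
have Bz y : `|y - c| <= r -> B y = 0.
  move=> yr; apply: big1 => i _.
  have := le_trans (coord_le_norm (y - c) i) yr; rewrite !mxE ler_norml => /andP[h1 h2].
  by rewrite !ecut_eq0 ?addr0//; move: h1 h2; lra.
have Bpos y : ~ (`|y - c| <= r) -> 0 < B y.
  move=> yr; rewrite lt_neqAle B0 andbT eq_sym; apply/negP => /eqP By.
  apply: yr; apply: norm_le_coord => [|i]; first exact: ltW.
  rewrite !mxE leNgt; apply/negP => N.
  suff : 0 < B y by rewrite By ltxx.
  rewrite /B (bigD1 i)//=; apply: ltr_pwDl; last first.
    by apply: sumr_ge0 => j _; rewrite addr_ge0 ?ecut_ge0.
  have [yc|yc] := leP 0 (y 0 i - c 0 i).
    rewrite (ger0_norm yc) in N.
    by rewrite ltr_pwDl ?ecut_ge0// ecut_gt0//; move: N; lra.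
  rewrite (ltr0_norm yc) in N.
  by rewrite ltr_wpDl ?ecut_ge0// ecut_gt0//; move: N; lra.
have AB y : A y + B y != 0.
  rewrite gt_eqF//; have [yr|yr] := pselect (`|y - c| <= r).
    by rewrite ltr_pwDl ?Apos.
  by rewrite ltr_wpDl ?Bpos.
have [sAB _] := smoothR_add openT sA sB.
have [s _] := smoothR_mul openT sA (smoothR_inv openT sAB (fun y _ => AB y)).
exists (fun y => A y * (A y + B y)^-1); split=> // y yr.
  by rewrite (Bz y yr) addr0 mulfV// gt_eqF// Apos.
have -> : A y = 0; last by rewrite mul0r.
apply/eqP; apply: contraTT yr => Ay; rewrite -ltNge.
have h i : `|y 0 i - c 0 i| < 2 * r.
  have : ecut (1 * y 0 i + (2 * r - c 0 i)) * ecut (-1 * y 0 i + (2 * r + c 0 i)) != 0.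
    by move: Ay; rewrite /A prodf_seq_neq0 => /allP/(_ i (mem_index_enum _)).
  rewrite mulf_eq0 negb_or => /andP[h1 h2]; rewrite ltr_norml; apply/andP; split.
    by rewrite ltNge; apply/negP => N; move: h1; rewrite ecut_eq0 ?eqxx//; move: N; lra.
  by rewrite ltNge; apply/negP => N; move: h2; rewrite ecut_eq0 ?eqxx//; move: N; lra.
rewrite [ltLHS]/Num.norm /= mx_normrE; apply/bigmax_ltP; split; first by rewrite mulr_gt0.
by move=> -[a b] _ /=; rewrite (ord1 a) !mxE.
Qed.
End CubeCutoff.

Section Compact.
Context {R : realType} {n : nat}.

(** If [P] fails, the complements of the sets with [P] have the finite intersection property in [K], and a
    cluster point contradicts the local assumption. *)
Lemma compact_cube_ind (K : set 'rV[R]_n) (P : set 'rV[R]_n -> Prop) : compact K ->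
  P set0 -> (forall A B, A `<=` B -> P B -> P A) -> (forall A B, P A -> P B -> P (A `|` B)) ->
  (forall x, K x -> exists2 r : R, 0 < r & P [set y | `|y - x| <= r]) -> P K.
Proof.
move=> cK P0 Ps PU Px; apply: contrapT => NK.
pose F : set (set 'rV[R]_n) := [set A | P (K `&` ~` A)].
have FF : ProperFilter F.
  split; first by rewrite /F /= setC0 setIT.
  split; rewrite /F /=.
  - by rewrite setCT setI0.
  - move=> A B PA PB; rewrite /= setCI setIUr; exact: PU.
  - by move=> A B AB; apply: Ps; apply: setIS; exact: subsetC.
have FK : F K by rewrite /F /= setICr.
have [x [Kx cx]] := cK F FF FK.
have [r r0 Pr] := Px x Kx.
have FA : F (~` [set y | `|y - x| <= r]) by rewrite /F /= setCK; apply: Ps Pr => y [].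
have nx : nbhs x [set y | `|y - x| <= r].
  apply/nbhs_ballP; exists r => //= y; rewrite -ball_normE /= distrC; exact: ltW.
by have [y [h1 h2]] := cx _ _ FA nx.
Qed.

Lemma compact_closed_cube (c : 'rV[R]_n) (r : R) : compact [set y | `|y - c| <= r].
Proof.
apply: bounded_closed_compact.
  exists (`|c| + r); split; first exact: num_real.
  move=> M hM y /= yr; apply: le_trans (ltW hM).
  by rewrite -[y](subrK c) (le_trans (ler_normD _ _))// addrC lerD2l.
have -> : [set y | `|y - c| <= r] = (fun y : 'rV[R]_n => `|y - c|) @^-1` [set t | t <= r] by [].
apply: closed_comp; last exact: closed_le.
move=> y _; apply: (@continuous_of_lip _ _ _ _ 1 1) => // z _.
by rewrite mul1r (le_trans (ler_dist_dist _ _))// opprB addrA subrK.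
Qed.

(** Cut-offs chi and chi' of two pieces combine to 1 - (1 - chi)(1 - chi'). *)
Lemma compact_cutoff (K Omega : set 'rV[R]_n) : compact K -> open Omega -> K `<=` Omega ->
  exists (chi : 'rV[R]_n -> R) (K0 U : set 'rV[R]_n),
    [/\ smoothR setT chi, compact K0, K0 `<=` Omega, forall y, ~ K0 y -> chi y = 0 &
        open U /\ K `<=` U /\ forall y, U y -> chi y = 1].
Proof.
move=> cK oO KO.
pose P A := exists (chi : 'rV[R]_n -> R) (K0 U : set 'rV[R]_n),
    [/\ smoothR setT chi, compact K0, K0 `<=` Omega, forall y, ~ K0 y -> chi y = 0 &
        open U /\ A `<=` U /\ forall y, U y -> chi y = 1].
apply: (@compact_cube_ind K P) => //.
- exists (fun=> 0), set0, set0; split=> //; first by case: (@smoothR_cst R n setT 0 openT).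
    exact: compact0.
  by split; [exact: open0|split].
- move=> A B AB [chi [K0 [U [h1 h2 h3 h4 [h5 [h6 h7]]]]]]; exists chi, K0, U; split=> //.
  by split=> //; split=> //; exact: subset_trans h6.
- move=> A B [chi [K0 [U [h1 h2 h3 h4 [h5 [h6 h7]]]]]] [chi' [K0' [U' [h1' h2' h3' h4' [h5' [h6' h7']]]]]].
  exists (fun y => chi y + (1 - chi y) * chi' y), (K0 `|` K0'), (U `|` U'); split.
  + have [s1 _] := @smoothR_cst R n setT 1 openT.
    have [s2 _] := smoothR_sub_fun openT s1 h1.
    have [s3 _] := smoothR_mul openT s2 h1'.
    by have [] := smoothR_add openT h1 s3.
  + exact: compactU.
  + by move=> y [/h3|/h3'].
  + move=> y N; rewrite h4 ?h4' ?mulr0 ?addr0//; [by move=> ?; apply: N; right|by move=> ?; apply: N; left].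
  + split; first exact: openU.
    split; first exact: setUSS.
    move=> y [/h7 ->|/h7' ->]; first by rewrite subrr mul0r addr0.
    by rewrite mulr1 addrC subrK.
- move=> x Kx; have [r r0 hr] := open_cube oO (KO x Kx).
  have r2 : 0 < r / 2 by rewrite divr_gt0.
  have [theta [t1 t2 t3]] := cube_cutoff x r2.
  have E : 2 * (r / 2) = r by rewrite mulrC divfK.
  exists (r / 4); first by rewrite divr_gt0.
  exists theta, [set y | `|y - x| <= r], (ball x (r / 2)); split=> //.
  + exact: compact_closed_cube.
  + by move=> y /negP; rewrite -ltNge => /ltW yr; apply: t3; rewrite E.
  + split; first exact: ball_open.
    split=> y /=; rewrite -ball_normE /= distrC.
      by move/le_lt_trans; apply; rewrite ltr_pM2l// ltf_pV2 ?posrE// ltr_nat.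
    by move/ltW; exact: t2.
Qed.
End Compact.

(** * Real and imaginary parts of distributions *)

Section ComplexParts.
Local Open Scope complex_scope.
Context {R : realType}.
Implicit Types (z u : R[i]).

Lemma cReD z u : Re (z + u) = Re z + Re u. Proof. by case: z u => [a b] [c d]. Qed.
Lemma cImD z u : Im (z + u) = Im z + Im u. Proof. by case: z u => [a b] [c d]. Qed.
Lemma cReN z : Re (- z) = - Re z. Proof. by case: z. Qed.
Lemma cImN z : Im (- z) = - Im z. Proof. by case: z. Qed.
Lemma cReM z u : Re (z * u) = Re z * Re u - Im z * Im u. Proof. by case: z u => [a b] [c d]. Qed.
Lemma cImM z u : Im (z * u) = Re z * Im u + Im z * Re u. Proof. by case: z u => [a b] [c d]. Qed.

Lemma complexP z u : Re z = Re u -> Im z = Im u -> z = u.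
Proof. by case: z u => [a b] [c d] /= -> ->. Qed.

Lemma Re_le_normc z : `|Re z| <= normc z.
Proof. by case: z => a b /=; rewrite -sqrtr_sqr ler_wsqrtr// lerDl sqr_ge0. Qed.

Lemma Im_le_normc z : `|Im z| <= normc z.
Proof. by case: z => a b /=; rewrite -sqrtr_sqr ler_wsqrtr// lerDr sqr_ge0. Qed.

Lemma normc_le z : normc z <= `|Re z| + `|Im z|.
Proof.
case: z => a b /=; rewrite -[leRHS]ger0_norm ?addr_ge0// -sqrtr_sqr ler_wsqrtr//.
rewrite sqrrD !real_normK ?num_real// addrAC lerDl.
by rewrite mulrn_wge0// mulr_ge0.
Qed.
End ComplexParts.

Section DistributionParts.
Local Open Scope complex_scope.
Context {R : realType} {n : nat}.
Implicit Types (x y z : 'rV[R]_n) (g h : 'rV[R]_n -> R) (Omega K : set 'rV[R]_n).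

Lemma iter_partial_eq0 (f : 'rV[R]_n -> R) y (r : R) : 0 < r ->
  (forall z, `|z - y| <= r -> f z = 0) -> forall s, iter_partial s f y = 0.
Proof.
move=> r0 fz s.
have E z : ball y r z -> f z = 0 by rewrite -ball_normE /= distrC => /ltW /fz.
have oB : open (ball y r) by exact: ball_open.
rewrite (eq_iter_partial oB (g' := fun=> 0) E); last exact: ballxx.
by rewrite (@smoothR_cst R n setT 0 openT).2//; case: s.
Qed.

Lemma compact_far (K0 : set 'rV[R]_n) y : compact K0 -> ~ K0 y ->
  exists2 r : R, 0 < r & forall z, `|z - y| <= r -> ~ K0 z.
Proof.
move=> cK Ky; have cl : closed K0 by apply: compact_closed => //; exact: norm_hausdorff.
have [r r0 h] := @open_cube R n (~` K0) y (closed_openC cl) Ky.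
by exists r.
Qed.

Lemma supp_sub (phi : 'rV[R]_n -> R[i]) K0 : compact K0 -> (forall y, ~ K0 y -> phi y = 0) ->
  supp phi `<=` K0.
Proof.
move=> cK hphi; have cl : closed K0 by apply: compact_closed => //; exact: norm_hausdorff.
have := @closure_subset _ [set x | phi x != 0] K0; rewrite -((closure_id K0).1 cl); apply.
by move=> y /eqP N; apply: contrapT => /hphi.
Qed.

Lemma test_function_supported (phi : 'rV[R]_n -> R[i]) K0 Omega : compact K0 -> K0 `<=` Omega ->
  smooth setT phi -> (forall y, ~ K0 y -> phi y = 0) -> test_function Omega phi.
Proof.
move=> cK KO sphi hphi; have sK := supp_sub cK hphi.
split=> //; split; last exact: subset_trans sK KO.
by apply: subclosed_compact sK => //; exact: closed_closure.
Qed.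

(** The continuity estimate for real and imaginary parts separately. *)
Lemma dist_bound Omega (T : functional) K0 : Defs.distribution Omega T -> compact K0 -> K0 `<=` Omega ->
  exists (C : R) (m : nat), 0 <= C /\ forall phi (B : R), smooth setT phi -> 0 <= B ->
    (forall y, ~ K0 y -> phi y = 0) ->
    dbound m setT (fun y => Re (phi y)) B -> dbound m setT (fun y => Im (phi y)) B ->
    normc (T phi) <= C * B.
Proof.
move=> [_ hT] cK KO; have [C [m hC]] := hT K0 cK KO.
exists (`|C| * 2), m; split=> [|phi B sphi B0 phi0 h1 h2]; first by rewrite mulr_ge0.
have sK := supp_sub cK phi0.
have tphi := test_function_supported cK KO sphi phi0.
apply: le_trans (hC phi (2 * B) tphi sK _) _.
  move=> a x am; apply: le_trans (normc_le _) _; rewrite mulr_natl mulr2n.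
  by rewrite lerD//; [apply: h1|apply: h2] => //; rewrite size_mindices.
by rewrite -mulrA ler_wpM2r ?mulr_ge0// ler_norm.
Qed.

(** A distribution multiplied by [theta] accepts every smooth function, and real ones suffice by linearity. *)
Definition localize (T : @functional R n) (theta : 'rV[R]_n -> R[i]) g : R[i] :=
  T (fun y => theta y * (g y)%:C).

Lemma smooth_mul_real (theta : 'rV[R]_n -> R[i]) g : smooth setT theta -> smoothR setT g ->
  [/\ smooth setT (fun y => theta y * (g y)%:C),
   (fun y => Re (theta y * (g y)%:C)) = (fun y => Re (theta y) * g y) &
   (fun y => Im (theta y * (g y)%:C)) = (fun y => Im (theta y) * g y)].
Proof.
move=> [s1 s2] sg.
have E1 : (fun y => Re (theta y * (g y)%:C)) = (fun y => Re (theta y) * g y).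
  by apply/funext => y; rewrite cReM /= mulr0 subr0.
have E2 : (fun y => Im (theta y * (g y)%:C)) = (fun y => Im (theta y) * g y).
  by apply/funext => y; rewrite cImM /= mulr0 add0r.
split=> //; split; rewrite ?E1 ?E2.
  by case: (smoothR_mul openT s1 sg).
by case: (smoothR_mul openT s2 sg).
Qed.

(** Only the values on [K] matter if [theta] vanishes near every point of its support outside [K]: this
    will confine the remote part of a distribution to the complement of a cube. *)
Lemma localize_tame Omega T theta K0 K : Defs.distribution Omega T -> compact K0 -> K0 `<=` Omega ->
  smooth setT theta -> (forall y, ~ K0 y -> theta y = 0) ->
  (forall y, K0 y -> ~ K y -> exists2 r : R, 0 < r & forall z, `|z - y| <= r -> theta z = 0) ->
  tame K (fun g => Re (localize T theta g)) /\ tame K (fun g => Im (localize T theta g)).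
Proof.
move=> dT cK KO sth th0 thK.
have test g : smoothR setT g -> test_function Omega (fun y => theta y * (g y)%:C).
  move=> sg; have [s _ _] := smooth_mul_real sth sg.
  by apply: test_function_supported cK KO s _ => y /th0 ->; rewrite mul0r.
have lin (c : R) g h : smoothR setT g -> smoothR setT h ->
    localize T theta (fun y => c * g y + h y) = c%:C * localize T theta g + localize T theta h.
  move=> sg sh; rewrite /localize -(dT.1 c%:C _ _ (test g sg) (test h sh)); congr T.
  by apply/funext => y; apply: complexP; rewrite ?(cReM, cImM, cReD, cImD) /=; ring.
have [C [m [C0 hC]]] := dist_bound dT cK KO.
have [A1 A10 hA1] := compact_dbound m openT cK (fun _ _ => I) sth.1.
have [A2 A20 hA2] := compact_dbound m openT cK (fun _ _ => I) sth.2.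
pose A := A1 + A2.
have bnd g B : smoothR setT g -> 0 <= B -> dbound m K g B ->
    normc (localize T theta g) <= (C * (2 ^+ m * A)) * B.
  move=> sg B0 hB; have [s E1 E2] := smooth_mul_real sth sg; rewrite -mulrA.
  have P0 : 0 <= 2 ^+ m * A * B by rewrite !mulr_ge0 ?exprn_ge0// /A addr_ge0// ltW.
  have zero (f : 'rV[R]_n -> R) t y : (forall z, theta z = 0 -> f z = 0) -> ~ (K0 y /\ K y) ->
      `|iter_partial t (fun y => f y * g y) y| <= 2 ^+ m * A * B.
    move=> fth N.
    have [r r0 hr] : exists2 r : R, 0 < r & forall z, `|z - y| <= r -> theta z = 0.
      have [Ky|Ky] := pselect (K0 y).
        by apply: thK => // Ky'; apply: N.
      by have [r r0 hr] := compact_far cK Ky; exists r => // z /hr; exact: th0.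
    rewrite (iter_partial_eq0 r0) ?normr0// => z /hr /fth ->; exact: mul0r.
  have main (f : 'rV[R]_n -> R) Af : 0 <= Af -> Af <= A -> smoothR setT f -> (forall z, theta z = 0 -> f z = 0) ->
      dbound m K0 f Af -> dbound m setT (fun y => f y * g y) (2 ^+ m * A * B).
    move=> Af0 AfA sf fth hf t y tm _.
    have [[K0y Ky]|N] := pselect (K0 y /\ K y); last exact: zero.
    have h1 : dbound m (K0 `&` K) f Af by move=> u v um [v1 v2]; exact: hf.
    have h2 : dbound m (K0 `&` K) g B by move=> u v um [v1 v2]; exact: hB.
    have := dbound_mul openT (fun _ _ => I) sf sg h1 h2 tm (conj K0y Ky).
    by move/le_trans; apply; rewrite ler_wpM2r// ler_wpM2l ?exprn_ge0.
  apply: hC => //.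
  - by move=> y /th0 ->; rewrite mul0r.
  - rewrite E1; apply: (main _ A1) => //; [exact: ltW|by rewrite lerDl ltW|exact: sth.1|by move=> z ->].
  - rewrite E2; apply: (main _ A2) => //; [exact: ltW|by rewrite lerDr ltW|exact: sth.2|by move=> z ->].
have Q0 : 0 <= C * (2 ^+ m * A) by rewrite !mulr_ge0 ?exprn_ge0// /A addr_ge0// ltW.
split; split.
- by move=> c g h sg sh; rewrite lin// cReD cReM /= mul0r subr0.
- exists (C * (2 ^+ m * A)), m; split=> // g B sg B0 hB.
  by rewrite (le_trans (Re_le_normc _)) ?bnd.
- by move=> c g h sg sh; rewrite lin// cImD cImM /= mul0r addr0.
- exists (C * (2 ^+ m * A)), m; split=> // g B sg B0 hB.
  by rewrite (le_trans (Im_le_normc _)) ?bnd.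
Qed.

Lemma localize_split Omega T theta K0 (psi : 'rV[R]_n -> R[i]) : Defs.distribution Omega T ->
  compact K0 -> K0 `<=` Omega -> smooth setT theta -> (forall y, ~ K0 y -> theta y = 0) ->
  smooth setT psi ->
  T (fun y => theta y * psi y) = 'i * localize T theta (fun y => Im (psi y)) +
     localize T theta (fun y => Re (psi y)).
Proof.
move=> dT cK KO sth th0 [sp1 sp2].
have test g : smoothR setT g -> test_function Omega (fun y => theta y * (g y)%:C).
  move=> sg; have [s _ _] := smooth_mul_real sth sg.
  by apply: test_function_supported cK KO s _ => y /th0 ->; rewrite mul0r.
rewrite /localize -(dT.1 'i _ _ (test _ sp2) (test _ sp1)); congr T; apply/funext => y.
by apply: complexP; rewrite ?(cReM, cImM, cReD, cImD) /=; ring.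
Qed.
End DistributionParts.

(** * Mollifiers and the convolution net *)

Section Mollifier.
Local Open Scope complex_scope.
Context {R : realType} {n : nat}.
Implicit Types (x y z : 'rV[R]_n) (Omega K : set 'rV[R]_n) (rho psi : 'rV[R]_n -> R[i]).

(** The Schwartz condition bounds products with monomials; the largest coordinate of [x] turns a monomial
    into a power of the norm. *)
Lemma schwartz_parts rho : schwartz rho ->
  schwR (fun x => Re (rho x)) /\ schwR (fun x => Im (rho x)).
Proof.
move=> [[s1 s2] hr].
have key s k : exists C : R, forall x, (1 + `|x|) ^+ k * normc (partial (fun i => count_mem i s) rho x) <= C.
  have [C0 hC0] := hr (fun i => count_mem i s) (fun=> 0%N).
  have /choice[C hC] : forall i : 'I_n, exists C : R, forall x,
      `|mpow x (fun j => 0 + k * (j == i))%N| * normc (partial (fun i => count_mem i s) rho x) <= C.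
    by move=> i; exact: hr.
  exists (2 ^+ k * (C0 + (C0 + \sum_i `|C i|))) => x.
  set N := normc _.
  have N0 : 0 <= N by rewrite (le_trans _ (Re_le_normc _)).
  have H0 : N <= C0.
    by have := hC0 x; rewrite /mpow big1 ?normr1 ?mul1r// => i _.
  have C00 : 0 <= C0 by exact: le_trans N0 H0.
  have S0 : 0 <= \sum_i `|C i| by rewrite sumr_ge0.
  have [x0|x0] := eqVneq `|x| 0.
    rewrite x0 addr0 expr1n mul1r (le_trans H0)//.
    rewrite -[leLHS]mul1r ler_pM ?exprn_ege1 ?ler1n//.
    by rewrite lerDl addr_ge0.
  (* the sup norm is attained at a coordinate *)
  have [i xi] : exists i, `|x| = `|x 0 i|.
    have [[a i] /= E] := @mx_norm_neq0 R 1 n x x0.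
    by exists i; rewrite -(ord1 a).
  have M : `|mpow x (fun j => 0 + k * (j == i))%N| = `|x| ^+ k.
    by rewrite -mpow_coord_pow /mpow big1 ?mul1r// normrX xi.
  have Hi : `|x| ^+ k * N <= \sum_i `|C i|.
    have := hC i x; rewrite M -/N => /le_trans; apply.
    by rewrite (bigD1 i)//= (le_trans (ler_norm _))// lerDl sumr_ge0.
  apply: le_trans (_ : 2 ^+ k * (1 + `|x| ^+ k) * N <= _).
    rewrite ler_wpM2r//; have [x1|x1] := leP `|x| 1.
      apply: le_trans (_ : 2 ^+ k * 1 <= _); last by rewrite ler_wpM2l ?exprn_ge0// lerDl exprn_ge0.
      by rewrite mulr1 lerXn2r ?nnegrE ?addr_ge0//; move: x1; lra.
    apply: le_trans (_ : 2 ^+ k * `|x| ^+ k <= _); last by rewrite ler_wpM2l ?exprn_ge0// lerDr.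
    by rewrite -exprMn lerXn2r ?nnegrE ?addr_ge0 ?mulr_ge0//; move: x1; lra.
  rewrite -mulrA ler_wpM2l ?exprn_ge0// mulrDl mul1r lerD//.
  by rewrite (le_trans Hi)// lerDr.
split; split=> // s k; have [C hC] := key s k; exists C => x;
  apply: le_trans (hC x); rewrite ler_wpM2l ?oneDnorm_ge0// (iter_partial_mindices s openT _ (x := x) I)//.
  exact: (Re_le_normc (partial _ rho x)).
exact: (Im_le_normc (partial _ rho x)).
Qed.

Lemma mollifier_parts rho : mollifier rho ->
  [/\ schwR (fun x => Re (rho x)), schwR (fun x => Im (rho x)),
     vanishing_moments (fun x => Re (rho x)), vanishing_moments (fun x => Im (rho x)) &
     integral_rV (fun x => Re (rho x)) = 1 /\ integral_rV (fun x => Im (rho x)) = 0].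
Proof.
move=> [sr [r1 rm]]; have [s1 s2] := schwartz_parts sr.
split=> //; last by case: r1.
- move=> a aN; have := rm a aN; rewrite /integral_rVC => -[E _]; rewrite -[RHS]E.
  by congr integral_rV; apply/funext => z; rewrite cReM /= mul0r subr0.
- move=> a aN; have := rm a aN; rewrite /integral_rVC => -[_ E]; rewrite -[RHS]E.
  by congr integral_rV; apply/funext => z; rewrite cImM /= mul0r addr0.
Qed.

(** Cut-offs exist, so the chosen one in the definition of [pairing] is genuine. *)
Lemma cutoffs_xget Omega w : open Omega -> compact_distribution Omega w ->
  cutoffs Omega w (xget (fun=> 0) (cutoffs Omega w)).
Proof.
move=> oO [dw [K sK]]; have [cK KO _] := sK.
have [chi [K0 [U [h1 h2 h3 h4 [h5 [h6 h7]]]]]] := compact_cutoff cK oO KO.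
have sc : smooth setT (fun y => (chi y)%:C).
  split; first by [].
  by case: (@smoothR_cst R n setT 0 openT).
apply: xgetPex; exists (fun y => (chi y)%:C).
split; first by apply: test_function_supported h2 h3 sc _ => y /h4 ->.
by exists K, U; split=> //; split=> //; split=> // x /h7 ->.
Qed.

Lemma rescale_parts rho (eps : R) :
  (fun x => Re (rescale rho eps x)) = rescR (fun x => Re (rho x)) eps /\
  (fun x => Im (rescale rho eps x)) = rescR (fun x => Im (rho x)) eps.
Proof.
split; apply/funext => x; rewrite /rescale ?cReM ?cImM /rescR /=; ring.
Qed.

Lemma convolution_parts Omega w chi rho : compact_distribution Omega w ->
  test_function Omega chi -> chi = xget (fun=> 0) (cutoffs Omega w) -> smooth setT rho ->
  forall (eps : R) x,
  Re (convolution Omega w (rescale rho eps) x) =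
    convol (fun g => Re (localize w chi g)) (rescR (fun x => Re (rho x)) eps) x -
    convol (fun g => Im (localize w chi g)) (rescR (fun x => Im (rho x)) eps) x /\
  Im (convolution Omega w (rescale rho eps) x) =
    convol (fun g => Re (localize w chi g)) (rescR (fun x => Im (rho x)) eps) x +
    convol (fun g => Im (localize w chi g)) (rescR (fun x => Re (rho x)) eps) x.
Proof.
move=> [dw _] [sc [cs sO]] chiE [s1 s2] eps x.
have [E1 E2] := rescale_parts rho eps.
have spsi : smooth setT (fun y => rescale rho eps (x - y)).
  split.
    have -> : (fun y => Re (rescale rho eps (x - y))) = (fun y => rescR (fun x => Re (rho x)) eps (x - y)).
      by apply/funext => y; rewrite -E1.
    by apply: smoothR_reflect; case: (rescR_smooth eps s1).
  have -> : (fun y => Im (rescale rho eps (x - y))) = (fun y => rescR (fun x => Im (rho x)) eps (x - y)).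
    by apply/funext => y; rewrite -E2.
  by apply: smoothR_reflect; case: (rescR_smooth eps s2).
have chi0 y : ~ supp chi y -> chi y = 0.
  by move=> N; apply/eqP; apply: contra_notT N => cy; exact: subset_closure.
have := localize_split dw cs sO sc chi0 spsi.
rewrite /convolution /pairing -chiE => ->.
rewrite cReD cImD cReM cImM /= /convol.
have -> : (fun y => Im (rescale rho eps (x - y))) = (fun y => rescR (fun x => Im (rho x)) eps (x - y)).
  by apply/funext => y; rewrite -E2.
have -> : (fun y => Re (rescale rho eps (x - y))) = (fun y => rescR (fun x => Re (rho x)) eps (x - y)).
  by apply/funext => y; rewrite -E1.
by split; ring.
Qed.

Lemma test_function_tame Omega w chi : Defs.distribution Omega w -> test_function Omega chi ->
  tame setT (fun g => Re (localize w chi g)) /\ tame setT (fun g => Im (localize w chi g)).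
Proof.
move=> dw [sc [cs sO]]; apply: (localize_tame dw cs sO sc) => [y N|y _ /(_ I)//].
by apply/eqP; apply: contra_notT N => cy; exact: subset_closure.
Qed.
End Mollifier.

(** * Landau's inequality for nets *)

(** Taylor's formula of order two, solved for the first derivative. *)
Lemma landau_arith (R : realType) (A B D h g1 g0 : R) : 0 < h ->
  `|g1 - g0 - h * D| <= B * h ^+ 2 -> `|g1| <= A -> `|g0| <= A -> `|D| <= 2 * A / h + B * h.
Proof.
move=> h0 H h1 h2; rewrite -(ler_pM2l h0) mulrDr -{1}(gtr0_norm h0) -normrM.
have -> : h * (2 * A / h) = 2 * A by field; rewrite gt_eqF.
have -> : h * (B * h) = B * h ^+ 2 by ring.
have -> : h * D = - (g1 - g0 - h * D) + (g1 - g0) by ring.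
apply: le_trans (ler_normD _ _) _; rewrite normrN addrC; apply: lerD => //.
by rewrite (le_trans (ler_normB _ _))// mulr_natl mulr2n lerD.
Qed.

Lemma landau_arith_neg (R : realType) (A B D h g1 g0 : R) : 0 < h ->
  `|g1 - g0 - (- h) * D| <= B * (- h) ^+ 2 -> `|g1| <= A -> `|g0| <= A -> `|D| <= 2 * A / h + B * h.
Proof.
move=> h0; rewrite sqrrN => H h1 h2; rewrite -(normrN D).
by apply: (landau_arith h0 (g1 := g1) (g0 := g0)) => //; rewrite mulrN -mulNr.
Qed.

Section Nets.
Context {R : realType} {n : nat}.
Implicit Types (x y c : 'rV[R]_n) (v : R -> 'rV[R]_n -> R) (Q : set 'rV[R]_n).
Local Notation e i := (delta_mx 0 i : 'rV[R]_n).

(** The quantifier pattern shared by moderateness, negligibility and regularity. *)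
Definition eventually_le (f : R -> 'rV[R]_n -> R) Q (b : R -> R) :=
  exists C eta : R, 0 < C /\ 0 < eta <= 1 /\
    forall eps, 0 < eps <= eta -> forall x, Q x -> f eps x <= C * b eps.

Definition rmod v Q := forall s, exists m : nat,
  eventually_le (fun eps x => `|iter_partial s (v eps) x|) Q (fun eps => eps ^- m).

Definition rneg v s Q := forall m : nat,
  eventually_le (fun eps x => `|iter_partial s (v eps) x|) Q (fun eps => eps ^+ m).

Lemma eventually_leU f Q Q' b : (forall eps, 0 < eps <= 1 -> 0 <= b eps) ->
  eventually_le f Q b -> eventually_le f Q' b -> eventually_le f (Q `|` Q') b.
Proof.
move=> b0 [C [eta [C0 [/andP[e0 e1] H]]]] [C' [eta' [C'0 [/andP[e0' e1'] H']]]].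
exists (C + C'), (Num.min eta eta'); split; first exact: addr_gt0.
split; first by rewrite lt_min e0 e0' ge_min e1.
move=> eps; rewrite le_min => /and3P[ep h1 h2].
have be : 0 <= b eps by apply: b0; rewrite ep (le_trans h1).
move=> x [Qx|Qx].
  by rewrite (le_trans (H eps _ x Qx)) ?ep ?h1// ler_wpM2r// lerDl ltW.
by rewrite (le_trans (H' eps _ x Qx)) ?ep ?h2// ler_wpM2r// lerDr ltW.
Qed.

Lemma eventually_le_sub f Q Q' b : Q' `<=` Q -> eventually_le f Q b -> eventually_le f Q' b.
Proof.
move=> QQ [C [eta [C0 [e01 H]]]]; exists C, eta; split=> //; split=> // eps ee x Qx.
by apply: H => //; exact: QQ.
Qed.

Lemma eventually_le0 f b : eventually_le f set0 b.
Proof. by exists 1, 1; split=> //; split; [rewrite ltr01 lexx|]. Qed.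

(** From every point of a cube one can move by [h] in the direction of the centre without leaving the cube,
    so that interpolation needs no loss of domain. *)
Lemma cube_segment c (r h : R) x i : 0 <= h <= r -> `|x - c| <= r ->
  (forall t, 0 <= t <= 1 -> `|x + (t * h) *: e i - c| <= r) \/
  (forall t, 0 <= t <= 1 -> `|x + (t * (- h)) *: e i - c| <= r).
Proof.
move=> /andP[h0 hr] xr.
have r0 : 0 <= r by exact: le_trans xr.
have co j : `|x 0 j - c 0 j| <= r by have := le_trans (coord_le_norm (x - c) j) xr; rewrite !mxE.
have [xc|xc] := leP (x 0 i) (c 0 i); [left|right] => t /andP[t0 t1];
  (apply: norm_le_coord => // j; rewrite !mxE eqxx /=; have := co j;
   have [->|ji] := eqVneq j i; last by rewrite mulr0 addr0).
- rewrite mulr1 !ler_norml => /andP[H1 H2].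
  have th : 0 <= t * h by rewrite mulr_ge0.
  have th' : t * h <= h by rewrite ler_piMl.
  by apply/andP; split; move: H1 H2 xc th th' hr; lra.
- rewrite mulr1 mulrN !ler_norml => /andP[H1 H2].
  have th : 0 <= t * h by rewrite mulr_ge0.
  have th' : t * h <= h by rewrite ler_piMl.
  by apply/andP; split; move: H1 H2 xc th th' hr; lra.
Qed.

(** Landau's inequality with step eps^(m+M): first derivatives are O(eps^m) if the function is
    O(eps^(2m+M)) and its second derivatives are O(eps^-M). *)
Lemma rneg_cons (Omega : set 'rV[R]_n) v s i c (r : R) : 0 < r ->
  (forall y, `|y - c| <= r -> Omega y) ->
  (forall eps, 0 < eps <= 1 -> smoothR Omega (v eps)) ->
  rmod v [set y | `|y - c| <= r] -> rneg v s [set y | `|y - c| <= r] ->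
  rneg v (i :: s) [set y | `|y - c| <= r].
Proof.
move=> r0 QO sv md ng m.
have [M [C2 [eta2 [C20 [/andP[e20 e21] H2]]]]] := md [:: i, i & s].
have [C1 [eta1 [C10 [/andP[e10 e11] H1]]]] := ng (2 * m + M)%N.
exists (2 * C1 / r + C2 * r), (Num.min eta1 eta2).
split; first by rewrite addr_gt0// ?divr_gt0 ?mulr_gt0.
split; first by rewrite lt_min e10 e20 ge_min e11.
move=> eps; rewrite le_min => /and3P[ep he1 he2] x Qx.
have ep1 : eps <= 1 by exact: le_trans he1 e11.
have en k : eps ^+ k != 0 by rewrite expf_neq0// gt_eqF.
pose h := r * eps ^+ (m + M).
have h0 : 0 < h by rewrite mulr_gt0// exprn_gt0.
have hr : 0 <= h <= r by rewrite ltW//= /h ler_piMr ?exprn_ile1// ltW.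
have sg : smoothR Omega (iter_partial s (v eps)) by apply: smoothR_iter; apply: sv; rewrite ep.
have bA y : `|y - c| <= r -> `|iter_partial s (v eps) y| <= C1 * eps ^+ (2 * m + M).
  by move=> yr; apply: H1 => //; rewrite ep he1.
have bB y : `|y - c| <= r -> `|iter_partial [:: i; i] (iter_partial s (v eps)) y| <= C2 * eps ^- M.
  by move=> yr; rewrite -iter_partial_cat; apply: H2 => //; rewrite ep he2.
have goal : `|'D_(e i) (iter_partial s (v eps)) x| <=
    2 * (C1 * eps ^+ (2 * m + M)) / h + (C2 * eps ^- M) * h.
  have [seg|seg] := cube_segment i hr Qx.
    have Q1 := @quad_line _ _ Omega _ x i h _ sg (fun t t01 => QO _ (seg t t01)) (fun t t01 => bB _ (seg t t01)).
    apply: (landau_arith h0 Q1); apply: bA => //.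
    by have := seg 1; rewrite mul1r ler01 lexx; apply.
  have Q1 := @quad_line _ _ Omega _ x i (- h) _ sg (fun t t01 => QO _ (seg t t01)) (fun t t01 => bB _ (seg t t01)).
  apply: (landau_arith_neg h0 Q1); apply: bA => //.
  by have := seg 1; rewrite mul1r ler01 lexx; apply.
apply: le_trans goal _.
rewrite le_eqVlt; apply/orP; left; apply/eqP; rewrite /h mul2n -addnn !exprD.
by field; rewrite !en gt_eqF.
Qed.

Lemma rneg_all (Omega : set 'rV[R]_n) v c (r : R) : 0 < r ->
  (forall y, `|y - c| <= r -> Omega y) ->
  (forall eps, 0 < eps <= 1 -> smoothR Omega (v eps)) ->
  rmod v [set y | `|y - c| <= r] -> rneg v [::] [set y | `|y - c| <= r] ->
  forall s, rneg v s [set y | `|y - c| <= r].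
Proof. by move=> r0 QO sv md ng; elim => [//|i s IH]; exact: (rneg_cons i r0 QO sv md IH). Qed.
End Nets.

Section ComplexNets.
Context {R : realType} {n : nat}.
Implicit Types (x y c : 'rV[R]_n) (u : @net R n) (Omega V Q : set 'rV[R]_n).

Definition re_net u : R -> 'rV[R]_n -> R := fun eps x => Re (u eps x).
Definition im_net u : R -> 'rV[R]_n -> R := fun eps x => Im (u eps x).

Lemma smooth_sub V Omega (f : 'rV[R]_n -> R[i]) : V `<=` Omega -> smooth Omega f -> smooth V f.
Proof. by move=> VO [h1 h2]; split; exact: smoothR_sub VO _. Qed.

Lemma eventually_le_parts u Omega Q s b : open Omega -> Q `<=` Omega ->
  (forall eps, 0 < eps <= 1 -> smooth Omega (u eps)) ->
  eventually_le (fun eps x => normc (partial (fun i => count_mem i s) (u eps) x)) Q b ->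
  eventually_le (fun eps x => `|iter_partial s (re_net u eps) x|) Q b /\
  eventually_le (fun eps x => `|iter_partial s (im_net u eps) x|) Q b.
Proof.
move=> oO QO su [C [eta [C0 [/andP[e0 e1] H]]]].
split; exists C, eta; split=> //; split; rewrite ?e0 ?e1// => eps /andP[ep ee] x Qx;
  (have [s1 s2] : smooth Omega (u eps) by apply: su; rewrite ep (le_trans ee));
  apply: le_trans (H eps _ x Qx); rewrite ?ep ?ee//.
  rewrite (iter_partial_mindices s oO s1 (QO x Qx)).
  exact: (Re_le_normc (partial _ (u eps) x)).
rewrite (iter_partial_mindices s oO s2 (QO x Qx)).
exact: (Im_le_normc (partial _ (u eps) x)).
Qed.

Lemma eventually_le_complex u Q (a : 'I_n -> nat) b :
  eventually_le (fun eps x => `|iter_partial (mindices a) (re_net u eps) x|) Q b ->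
  eventually_le (fun eps x => `|iter_partial (mindices a) (im_net u eps) x|) Q b ->
  eventually_le (fun eps x => normc (partial a (u eps) x)) Q b.
Proof.
move=> [C [eta [C0 [/andP[e0 e1] H]]]] [C' [eta' [C'0 [/andP[e0' e1'] H']]]].
exists (C + C'), (Num.min eta eta'); split; first exact: addr_gt0.
split; first by rewrite lt_min e0 e0' ge_min e1.
move=> eps; rewrite le_min => /and3P[ep h1 h2] x Qx.
apply: le_trans (normc_le _) _; rewrite mulrDl.
by apply: lerD; [apply: H|apply: H'] => //; rewrite ep.
Qed.

Lemma moderate_rmod Omega u Q : open Omega -> moderate Omega u -> compact Q -> Q `<=` Omega ->
  rmod (re_net u) Q /\ rmod (im_net u) Q.
Proof.
move=> oO [su md] cQ QO; split=> s; have [m H] := md Q (fun i => count_mem i s) cQ QO; exists m.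
  by have [] := eventually_le_parts oO QO su H.
by have [] := eventually_le_parts oO QO su H.
Qed.

Lemma negligible_rneg Omega u Q : open Omega -> negligible_net Omega u -> compact Q -> Q `<=` Omega ->
  forall s, rneg (re_net u) s Q /\ rneg (im_net u) s Q.
Proof.
move=> oO [[su _] ng] cQ QO s; split=> m; have H := ng Q (fun i => count_mem i s) m cQ QO.
  by have [] := eventually_le_parts oO QO su H.
by have [] := eventually_le_parts oO QO su H.
Qed.

(** Compactness reduces the defining estimates to small cubes. *)
Lemma moderate_of_local Omega u : (forall eps, 0 < eps <= 1 -> smooth Omega (u eps)) ->
  (forall x, Omega x -> exists2 r : R, 0 < r &
     rmod (re_net u) [set y | `|y - x| <= r] /\ rmod (im_net u) [set y | `|y - x| <= r]) ->
  moderate Omega u.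
Proof.
move=> su H; split=> // K a cK KO.
pose f (eps : R) x := normc (partial a (u eps) x).
have pw (A : set 'rV[R]_n) k k' : (k <= k')%N -> forall f : R -> 'rV[R]_n -> R,
    eventually_le f A (fun eps => eps ^- k) -> eventually_le f A (fun eps => eps ^- k').
  move=> kk g [C [eta [C0 [/andP[e0 e1] hh]]]]; exists C, eta; split=> //.
  split; first by rewrite e0 e1.
  move=> eps /andP[ep ee] x Ax; apply: le_trans (hh eps _ x Ax) _; first by rewrite ep ee.
  rewrite ler_wpM2l//; first exact: ltW.
  by apply: expVr_le => //; rewrite ep (le_trans ee).
have pos k eps : 0 < eps <= 1 -> 0 <= eps ^- k :> R.
  by move=> /andP[ep _]; rewrite invr_ge0 exprn_ge0// ltW.
apply: (@compact_cube_ind R n K (fun A => exists m, eventually_le f A (fun eps => eps ^- m)) cK).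
- by exists 0%N; exact: eventually_le0.
- by move=> A B AB [m h]; exists m; exact: eventually_le_sub h.
- move=> A B [m h] [m' h']; exists (m + m')%N; apply: eventually_leU; first exact: pos.
    by apply: pw h; rewrite leq_addr.
  by apply: pw h'; rewrite leq_addl.
- move=> x Kx; have [r r0 [h1 h2]] := H x (KO x Kx); exists r => //.
  have [m1 H1] := h1 (mindices a); have [m2 H2] := h2 (mindices a); exists (m1 + m2)%N.
  by apply: eventually_le_complex; [apply: pw H1; rewrite leq_addr|apply: pw H2; rewrite leq_addl].
Qed.

(** The derivatives of higher order are supplied on each small cube by [rneg_all]. *)
Lemma negligible_of_local Omega u : (forall eps, 0 < eps <= 1 -> smooth Omega (u eps)) ->
  (forall x, Omega x -> exists2 r : R, 0 < r & (forall y, `|y - x| <= r -> Omega y) /\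
     [/\ rmod (re_net u) [set y | `|y - x| <= r], rmod (im_net u) [set y | `|y - x| <= r],
         rneg (re_net u) [::] [set y | `|y - x| <= r] & rneg (im_net u) [::] [set y | `|y - x| <= r]]) ->
  negligible_net Omega u.
Proof.
move=> su H; split.
  apply: moderate_of_local => // x /H[r r0 [_ [h1 h2 _ _]]]; by exists r.
move=> K a m cK KO.
pose f (eps : R) x := normc (partial a (u eps) x).
apply: (@compact_cube_ind R n K (fun A => eventually_le f A (fun eps => eps ^+ m)) cK).
- exact: eventually_le0.
- by move=> A B AB; exact: eventually_le_sub.
- by move=> A B; apply: eventually_leU => eps /andP[ep _]; rewrite exprn_ge0// ltW.
- move=> x Kx; have [r r0 [QO [h1 h2 h3 h4]]] := H x (KO x Kx); exists r => //.
  apply: eventually_le_complex.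
    by apply: (rneg_all r0 QO _ h1 h3) => eps /su[].
  by apply: (rneg_all r0 QO _ h2 h4) => eps /su[].
Qed.
End ComplexNets.

(** * Moderate and negligible nets *)

Section NetAlgebra.
Context {R : realType} {n : nat}.
Implicit Types (x y c : 'rV[R]_n) (u v w : @net R n) (Omega V Q : set 'rV[R]_n).

Lemma normc_triangle (a b c d : R) :
  normc ((a - c) +i* (b - d))%C <= normc (a +i* b)%C + normc (c +i* d)%C.
Proof.
apply: le_trans (le_normcD (a +i* b)%C (- (c +i* d))%C) _.
by rewrite (normcN (c +i* d)%C).
Qed.

Lemma partial_sub Omega (f g : 'rV[R]_n -> R[i]) : open Omega -> smooth Omega f -> smooth Omega g ->
  smooth Omega (fun x => f x - g x) /\
  forall a x, Omega x ->
    normc (partial a (fun x => f x - g x) x) <= normc (partial a f x) + normc (partial a g x).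
Proof.
move=> oO [f1 f2] [g1 g2].
have [s1 d1] := smoothR_sub_fun oO f1 g1; have [s2 d2] := smoothR_sub_fun oO f2 g2.
have e1 : (fun x => Re (f x - g x)) = (fun x => Re (f x) - Re (g x)).
  by apply/funext => y; rewrite cReD cReN.
have e2 : (fun x => Im (f x - g x)) = (fun x => Im (f x) - Im (g x)).
  by apply/funext => y; rewrite cImD cImN.
split; first by split; rewrite ?e1 ?e2.
by move=> a x Ox; rewrite /partial e1 e2 d1// d2//; exact: normc_triangle.
Qed.

Lemma moderate_sub Omega u v : open Omega -> moderate Omega u -> moderate Omega v ->
  moderate Omega (net_sub u v).
Proof.
move=> oO [su mu] [sv mv]; split.
  by move=> eps ee; have [] := partial_sub oO (su eps ee) (sv eps ee).
move=> K a cK KO.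
have [m [C [eta [C0 [/andP[e0 e1] H]]]]] := mu K a cK KO.
have [m' [C' [eta' [C'0 [/andP[e0' e1'] H']]]]] := mv K a cK KO.
exists (m + m')%N, (C + C'), (Num.min eta eta'); split; first exact: addr_gt0.
split; first by rewrite lt_min e0 e0' ge_min e1.
move=> eps; rewrite le_min => /and3P[ep h1 h2] x Kx.
have ee : 0 < eps <= 1 by rewrite ep (le_trans h1).
have [_ H1] := partial_sub oO (su eps ee) (sv eps ee).
apply: le_trans (H1 a x (KO x Kx)) _; rewrite mulrDl; apply: lerD.
  apply: le_trans (H eps _ x Kx) _; first by rewrite ep h1.
  by rewrite ler_pM2l// expVr_le// leq_addr.
apply: le_trans (H' eps _ x Kx) _; first by rewrite ep h2.
by rewrite ler_pM2l// expVr_le// leq_addl.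
Qed.

Lemma negligible_sub Omega u v : open Omega -> negligible_net Omega u -> negligible_net Omega v ->
  negligible_net Omega (net_sub u v).
Proof.
move=> oO [[su mu] nu] [[sv mv] nv]; split; first exact: moderate_sub.
move=> K a m cK KO.
have [C [eta [C0 [/andP[e0 e1] H]]]] := nu K a m cK KO.
have [C' [eta' [C'0 [/andP[e0' e1'] H']]]] := nv K a m cK KO.
exists (C + C'), (Num.min eta eta'); split; first exact: addr_gt0.
split; first by rewrite lt_min e0 e0' ge_min e1.
move=> eps; rewrite le_min => /and3P[ep h1 h2] x Kx.
have ee : 0 < eps <= 1 by rewrite ep (le_trans h1).
have [_ H1] := partial_sub oO (su eps ee) (sv eps ee).
apply: le_trans (H1 a x (KO x Kx)) _; rewrite mulrDl.
by apply: lerD; [apply: H|apply: H'] => //; rewrite ep ?h1 ?h2.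
Qed.

Lemma smooth0 Omega : open Omega -> smooth Omega (fun _ : 'rV[R]_n => 0 : R[i]).
Proof. by move=> oO; have [s0 _] := smoothR_cst 0 oO; split. Qed.

Lemma negligible0 Omega : open Omega -> negligible_net Omega (fun _ _ => 0).
Proof.
move=> oO; have [s0 d0] := smoothR_cst (n := n) (0 : R) oO.
have z a (x : 'rV[R]_n) : Omega x -> normc (partial a (fun=> 0 : R[i]) x) = 0.
  by move=> Ox; rewrite /partial /= !d0//; case: (mindices a) => [|? ?]; exact: complex.ComplexField.Normc.normc0.
split.
  split=> [eps _|K a cK KO]; first exact: smooth0.
  exists 0%N, 1, 1; split=> //; split; first by rewrite ltr01 lexx.
  by move=> eps ee x Kx; rewrite z ?expr0 ?invr1 ?mulr1//; exact: KO.
move=> K a m cK KO; exists 1, 1; split=> //; split; first by rewrite ltr01 lexx.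
move=> eps /andP[ep _] x Kx; rewrite z; last exact: KO.
by rewrite mul1r exprn_ge0// ltW.
Qed.

Lemma net_subxx u : net_sub u u = (fun _ _ => 0).
Proof. by apply/funext => eps; apply/funext => x; rewrite /net_sub subrr. Qed.

Lemma negligible_sym Omega u v : open Omega -> negligible_net Omega (net_sub u v) ->
  negligible_net Omega (net_sub v u).
Proof.
move=> oO H; have := negligible_sub oO (negligible0 oO) H.
by congr (negligible_net _ _); apply/funext => eps; apply/funext => x; rewrite /net_sub sub0r opprB.
Qed.

Lemma negligible_trans Omega u v w : open Omega -> negligible_net Omega (net_sub u v) ->
  negligible_net Omega (net_sub v w) -> negligible_net Omega (net_sub u w).
Proof.
move=> oO H1 /(negligible_sym oO) H2; have := negligible_sub oO H1 H2.
by congr (negligible_net _ _); apply/funext => eps; apply/funext => x; rewrite /net_sub opprB addrA subrK.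
Qed.

Lemma negligible_restrict V Omega u : V `<=` Omega -> negligible_net Omega u -> negligible_net V u.
Proof.
move=> VO [[su mu] nu]; split.
  split=> [eps ee|K a cK KV]; first exact: smooth_sub VO (su eps ee).
  by apply: mu => // y /KV/VO.
by move=> K a m cK KV; apply: nu => // y /KV/VO.
Qed.

Lemma gclassP Omega u v : open Omega -> moderate Omega u -> negligible_net Omega (net_sub u v) ->
  gclass Omega u = gclass Omega v.
Proof.
move=> oO mu nuv; apply/seteqP; split=> w [mw nw]; split=> //.
  exact: negligible_trans nw nuv.
by apply: negligible_trans nw _ => //; exact: negligible_sym.
Qed.

(** Negligibility is a local property: the sheaf property of the ideal. *)
Lemma negligible_cover Omega u : open Omega -> (forall eps, 0 < eps <= 1 -> smooth Omega (u eps)) ->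
  (forall x, Omega x -> exists V, [/\ open V, V `<=` Omega, V x & negligible_net V u]) ->
  negligible_net Omega u.
Proof.
move=> oO su H; apply: negligible_of_local => // x /H[V [oV VO Vx nV]].
have [r r0 QV] := open_cube oV Vx; exists r => //; split; first by move=> y /QV/VO.
have cQ := (@compact_closed_cube R n x r); have QV' : [set y | `|y - x| <= r] `<=` V by move=> y /QV.
have [h1 h2] := moderate_rmod oV (proj1 nV) cQ QV'.
by have [h3 h4] := negligible_rneg oV nV cQ QV' [::]; split.
Qed.

End NetAlgebra.

(** * Regular distributions *)

Section RegularDistributions.
Local Open Scope complex_scope.
Context {R : realType} {n : nat}.
Implicit Types (x y c : 'rV[R]_n) (g psi : 'rV[R]_n -> R) (f phi : 'rV[R]_n -> R[i]).
Implicit Types (Omega V Q K : set 'rV[R]_n).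

(** A cut-off supported in [Omega] makes a function on [Omega] globally smooth, whatever its values
    outside. *)
Lemma smoothR_zero_extension Omega K0 g psi : open Omega -> compact K0 -> K0 `<=` Omega ->
  smoothR Omega g -> smoothR setT psi -> (forall y, ~ K0 y -> psi y = 0) ->
  smoothR setT (fun y => g y * psi y).
Proof.
move=> oO cK KO sg sp p0 s x _.
have [Kx|Kx] := pselect (K0 x).
  have [sm _] := smoothR_mul oO sg (smoothR_sub (@subsetT _ Omega) sp).
  exact: sm (KO x Kx).
have oC : open (~` K0) by apply: closed_openC; exact: compact_closed.
have [s0 _] := smoothR_cst (n := n) (0 : R) oC.
suff : smoothR (~` K0) (fun y => g y * psi y) by apply.
by apply: eq_smoothR s0 => // y /p0 ->; rewrite mulr0.
Qed.

Lemma compact_support_dominated K : compact K -> exists2 D : R, 0 <= D & forall g B,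
  continuous g -> 0 <= B -> (forall y, `|g y| <= B) -> (forall y, ~ K y -> g y = 0) ->
  dominated g (D * B).
Proof.
move=> cK; have [r rK] : exists r : R, forall y, K y -> `|y| <= r.
  have [M [_ HM]] := compact_bounded cK; exists (`|M| + 1) => y Ky.
  by apply: HM => //; rewrite (le_lt_trans (ler_norm _))// ltrDl.
exists ((1 + `|r|) ^+ (2 * n)); first by rewrite exprn_ge0// addr_ge0.
move=> g B cg B0 gB g0; split=> // z.
have [Kz|Kz] := pselect (K z); last first.
  by rewrite g0// normr0 !mulr_ge0 ?exprn_ge0 ?addr_ge0// wt_ge0.
rewrite (le_trans (gB z))// mulrAC ler_peMl//.
rewrite (le_trans (wt_growth z))// ler_wpM2r ?wt_ge0//.
by rewrite lerXn2r ?nnegrE ?addr_ge0// lerD2l (le_trans (rK z Kz))// ler_norm.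
Qed.

Definition regular f : @functional R n := fun phi => integral_rVC (fun y => f y * phi y).

Lemma integrand_parts f phi :
  (fun y => Re (f y * phi y)) = (fun y => Re (f y) * Re (phi y) - Im (f y) * Im (phi y)) /\
  (fun y => Im (f y * phi y)) = (fun y => Re (f y) * Im (phi y) + Im (f y) * Re (phi y)).
Proof. by split; apply/funext => y; rewrite ?cReM ?cImM. Qed.

Lemma regular_integrand Omega K f : open Omega -> smooth Omega f -> compact K -> K `<=` Omega ->
  exists2 D : R, 0 <= D & forall phi b, smooth setT phi -> (forall y, ~ K y -> phi y = 0) ->
    0 <= b -> (forall y, normc (phi y) <= b) ->
    dominated (fun y => Re (f y * phi y)) (D * b) /\ dominated (fun y => Im (f y * phi y)) (D * b).
Proof.
move=> oO [f1 f2] cK KO.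
have [A1 A10 H1] := compact_dbound 0 oO cK KO f1.
have [A2 A20 H2] := compact_dbound 0 oO cK KO f2.
have [D D0 HD] := compact_support_dominated cK.
exists (D * (A1 + A2)); first by rewrite mulr_ge0// addr_ge0// ltW.
move=> phi b [p1 p2] p0 b0 pb.
have r0 y : ~ K y -> Re (phi y) = 0 by move=> /p0 ->.
have i0 y : ~ K y -> Im (phi y) = 0 by move=> /p0 ->.
have rb y : `|Re (phi y)| <= b by exact: le_trans (Re_le_normc _) (pb y).
have ib y : `|Im (phi y)| <= b by exact: le_trans (Im_le_normc _) (pb y).
have bnd u v A (h : 'rV[R]_n -> R) y : dbound 0 K h A -> 0 < A -> (~ K y -> u = 0) -> `|u| <= b -> v = h y ->
    `|v * u| <= A * b.
  move=> hA A0 u0 ub ->; have [Ky|Ky] := pselect (K y); last by rewrite u0// mulr0 normr0 mulr_ge0// ltW.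
  rewrite normrM ler_pM//; exact: (hA [::]).
have cont g1 g2 h1 h2 : smoothR Omega g1 -> smoothR Omega g2 -> smoothR setT h1 -> smoothR setT h2 ->
    (forall y, ~ K y -> h1 y = 0) -> (forall y, ~ K y -> h2 y = 0) ->
    continuous (fun y => g1 y * h1 y + g2 y * h2 y).
  move=> s1 s2 t1 t2 z1 z2; apply: smoothRT_continuous.
  by have [] := smoothR_add openT (smoothR_zero_extension oO cK KO s1 t1 z1)
    (smoothR_zero_extension oO cK KO s2 t2 z2).
have [e1 e2] := integrand_parts f phi.
rewrite e1 e2 -!mulrA; split; apply: HD => //.
- have -> : (fun y => Re (f y) * Re (phi y) - Im (f y) * Im (phi y)) =
    (fun y => Re (f y) * Re (phi y) + Im (f y) * (- Im (phi y))).
    by apply/funext => y; rewrite mulrN.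
  apply: cont => //; first by have [] := smoothR_opp openT p2.
  by move=> y /i0 ->; rewrite oppr0.
- by rewrite mulr_ge0// addr_ge0// ltW.
- move=> y; apply: le_trans (ler_normB _ _) _; rewrite mulrDl; apply: lerD.
    by apply: (bnd _ _ _ _ y H1) => //; exact: r0.
  by apply: (bnd _ _ _ _ y H2) => //; exact: i0.
- by move=> y Ky; rewrite r0// i0// !mulr0 subr0.
- by apply: cont.
- by rewrite mulr_ge0// addr_ge0// ltW.
- move=> y; apply: le_trans (ler_normD _ _) _; rewrite mulrDl; apply: lerD.
    by apply: (bnd _ _ _ _ y H1) => //; exact: i0.
  by apply: (bnd _ _ _ _ y H2) => //; exact: r0.
- by move=> y Ky; rewrite r0// i0// !mulr0 addr0.
Qed.

Lemma test_function_bounded Omega phi : test_function Omega phi ->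
  exists2 b : R, 0 <= b & forall y, normc (phi y) <= b.
Proof.
move=> [sp [cs _]]; have [p1 p2] := sp.
have [A1 A10 H1] := compact_dbound 0 openT cs (@subsetT _ _) p1.
have [A2 A20 H2] := compact_dbound 0 openT cs (@subsetT _ _) p2.
exists (A1 + A2) => [|y]; first by rewrite addr_ge0// ltW.
have [Ky|Ky] := pselect (supp phi y).
  apply: le_trans (normc_le _) _; apply: lerD; first exact: (H1 [::]).
  exact: (H2 [::]).
suff -> : phi y = 0 by rewrite complex.ComplexField.Normc.normc0 addr_ge0// ltW.
by apply: contra_notP Ky => /eqP h; exact: subset_closure.
Qed.

Lemma test_function_off Omega phi y : test_function Omega phi -> ~ supp phi y -> phi y = 0.
Proof. by move=> _ Ky; apply: contra_notP Ky => /eqP h; exact: subset_closure. Qed.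

(** A distribution of order 0 on each compact set. *)
Lemma regular_distribution Omega f : open Omega -> smooth Omega f ->
  Defs.distribution Omega (regular f).
Proof.
move=> oO sf; split.
  have dom phi : test_function Omega phi -> exists L,
      dominated (fun y => Re (f y * phi y)) L /\ dominated (fun y => Im (f y * phi y)) L.
    move=> tp; have [b b0 pb] := test_function_bounded tp.
    have [sp [cs sO]] := tp; have [D D0 H] := regular_integrand oO sf cs sO.
    by exists (D * b); apply: H => // y; exact: (test_function_off tp).
  move=> c phi psi /dom[L [d1 d2]] /dom[L' [d1' d2']].
  have e1 : (fun y => Re (f y * (c * phi y + psi y))) =
     (fun y => Re c * Re (f y * phi y) + (- Im c) * Im (f y * phi y) + Re (f y * psi y)).
    by apply/funext => y; rewrite !(cReM,cImM,cReD,cImD); ring.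
  have e2 : (fun y => Im (f y * (c * phi y + psi y))) =
     (fun y => Re c * Im (f y * phi y) + Im c * Re (f y * phi y) + Im (f y * psi y)).
    by apply/funext => y; rewrite !(cReM,cImM,cReD,cImD); ring.
  have z1 := dominatedZ (Re c) d1; have z2 := dominatedZ (- Im c) d2.
  have z3 := dominatedZ (Re c) d2; have z4 := dominatedZ (Im c) d1.
  apply: complexP; rewrite /regular /integral_rVC /= ?e1 ?e2.
    rewrite (integral_rVD (dominatedD z1 z2) d1') (integral_rVD z1 z2) (integral_rVZ _ d1) (integral_rVZ _ d2).
    by rewrite cReD cReM /= mulNr.
  rewrite (integral_rVD (dominatedD z3 z4) d2') (integral_rVD z3 z4) (integral_rVZ _ d1) (integral_rVZ _ d2).
  by rewrite cImD cImM.
move=> K cK KO; have [D D0 H] := regular_integrand oO sf cK KO.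
pose I1 : R := \int[@lebesgue_measure R]_t (oneDsqr t)^-1.
exists (2 * D * I1 ^+ n), 0%N => phi b tp sK pb.
have pb' y : normc (phi y) <= b.
  have := pb (fun=> 0%N) y; rewrite /partial.
  have -> : mindices (fun _ : 'I_n => 0%N) = [::].
    by apply/nilP; rewrite /nilp size_mindices /mlen big1.
  have -> : mlen (fun _ : 'I_n => 0%N) = 0%N by rewrite /mlen big1.
  by rewrite /=; case: (phi y) => u v H1; exact: H1.
have b0 : 0 <= b by apply: le_trans (pb' 0); apply: le_trans (Re_le_normc _).
have [d1 d2] : dominated (fun y => Re (f y * phi y)) (D * b) /\ dominated (fun y => Im (f y * phi y)) (D * b).
  apply: H => //; first by case: tp.
  by move=> y Ky; apply: (test_function_off tp) => /sK.
apply: le_trans (normc_le _) _; rewrite /=.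
have -> : 2 * D * I1 ^+ n * b = D * b * I1 ^+ n + D * b * I1 ^+ n by ring.
by apply: lerD; exact: integral_rV_le.
Qed.

Lemma distribution0 Omega T : open Omega -> Defs.distribution Omega T -> T (fun=> 0) = 0.
Proof.
move=> oO [lin _]; have t0 : test_function Omega (fun=> 0).
  by apply: (@test_function_supported _ _ _ set0) => //; [exact: compact0|exact: (smooth0 openT)].
have := lin 1 _ _ t0 t0.
under eq_fun do rewrite mul1r addr0.
by rewrite mul1r => /eqP; rewrite -subr_eq subrr eq_sym => /eqP.
Qed.

End RegularDistributions.

(** * Local representatives of distributions *)

Section LocalRepresentatives.
Local Open Scope complex_scope.
Context {R : realType} {n : nat}.
Implicit Types (x y c : 'rV[R]_n) (f phi : 'rV[R]_n -> R[i]) (rho : 'rV[R]_n -> R[i]).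
Implicit Types (Omega V Q K : set 'rV[R]_n) (T w : @functional R n).

Lemma real_mul_parts (theta : 'rV[R]_n -> R) phi :
  (fun y => Re ((theta y)%:C * phi y)) = (fun y => theta y * Re (phi y)) /\
  (fun y => Im ((theta y)%:C * phi y)) = (fun y => theta y * Im (phi y)).
Proof. by split; apply/funext => y; rewrite ?cReM ?cImM /= mul0r ?subr0 ?addr0. Qed.

Lemma smooth_real_mul (theta : 'rV[R]_n -> R) phi : smoothR setT theta -> smooth setT phi ->
  smooth setT (fun y => (theta y)%:C * phi y).
Proof.
move=> st [p1 p2]; have [e1 e2] := real_mul_parts theta phi.
by split; rewrite ?e1 ?e2; [have [] := smoothR_mul openT st p1|have [] := smoothR_mul openT st p2].
Qed.

Lemma test_function_sub V Omega phi : V `<=` Omega -> test_function V phi -> test_function Omega phi.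
Proof. by move=> VO [h1 [h2 h3]]; split=> //; split=> // y /h3/VO. Qed.

Lemma open_ball_cube x (r : R) : open [set y | `|y - x| < r].
Proof.
have -> : [set y | `|y - x| < r] = ball x r.
  by rewrite -ball_normE; apply/funext => y /=; rewrite distrC.
exact: ball_open.
Qed.

(** A distribution cut off by [theta] has compact support and is still continuous, by Leibniz' rule. *)
Lemma cutoff_compact_distribution Omega T (theta : 'rV[R]_n -> R) K0 : open Omega ->
  Defs.distribution Omega T -> smoothR setT theta -> compact K0 -> K0 `<=` Omega ->
  (forall y, ~ K0 y -> theta y = 0) ->
  compact_distribution Omega (fun phi => T (fun y => (theta y)%:C * phi y)).
Proof.
move=> oO dT st cK KO t0.
have tf phi : smooth setT phi -> test_function Omega (fun y => (theta y)%:C * phi y).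
  move=> sp; apply: (test_function_supported cK KO); first exact: smooth_real_mul.
  by move=> y /t0 ->; rewrite mul0r.
have [lin bnd] := dT.
split.
  split.
    move=> c phi psi [sp _] [sq _].
    rewrite -lin; [|exact: tf|exact: tf].
    by congr T; apply/funext => y; ring.
  move=> K cK' KO'.
  have [C [m [C0 H]]] := dist_bound dT cK KO.
  have [A A0 HA] : exists2 A, 0 < A & dbound m setT theta A.
    have [A A0 HA] := compact_dbound m openT cK (@subsetT _ _) st; exists A => // s y sm _.
    have [Ky|Ky] := pselect (K0 y); first exact: HA.
    have [r r0 hr] := compact_far cK Ky.
    by rewrite (@iter_partial_eq0 _ _ theta y r)// ?normr0 ?ltW// => z /hr /t0.
  exists (C * (2 ^+ m * A)), m => phi b [sp _] _ pb.
  have [p1 p2] := sp; have [e1 e2] := real_mul_parts theta phi.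
  have b0 : 0 <= b.
    have := pb (fun=> 0%N) 0; rewrite /mlen big1// => /(_ isT); apply: le_trans.
    exact: le_trans (Re_le_normc _).
  have d1 : dbound m setT (fun y => Re (phi y)) b.
    move=> s y sm _; rewrite (iter_partial_mindices s openT p1 I).
    apply: le_trans (pb (fun i => count_mem i s) y _); last by rewrite mlen_count.
    exact: (Re_le_normc (partial _ phi y)).
  have d2 : dbound m setT (fun y => Im (phi y)) b.
    move=> s y sm _; rewrite (iter_partial_mindices s openT p2 I).
    apply: le_trans (pb (fun i => count_mem i s) y _); last by rewrite mlen_count.
    exact: (Im_le_normc (partial _ phi y)).
  rewrite -mulrA; apply: H.
  - exact: smooth_real_mul.
  - by rewrite !mulr_ge0// ?exprn_ge0// ltW.
  - by move=> y /t0 ->; rewrite mul0r.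
  - by rewrite e1; apply: (dbound_mul openT (@subsetT _ _) st p1).
  - by rewrite e2; apply: (dbound_mul openT (@subsetT _ _) st p2).
exists K0; split=> // phi tp; rewrite -[RHS](distribution0 oO dT); congr T; apply/funext => y.
have [Ky|Ky] := pselect (K0 y); last by rewrite t0// mul0r.
suff -> : phi y = 0 by rewrite mulr0.
by apply: (test_function_off tp) => sy; have [_ [_ /(_ y sy)[]]] := tp.
Qed.

(** Every distribution agrees near every point with a compactly supported one, so [dist_embedding] is a
    condition near every point. *)
Lemma local_representative Omega T x : open Omega -> Defs.distribution Omega T -> Omega x ->
  exists V w, [/\ open V, V `<=` Omega, V x, compact_distribution Omega w & eq_dist_on V T w].
Proof.
move=> oO dT Ox; have [r r0 rO] := open_cube oO Ox.
have r20 : 0 < r / 2 by rewrite divr_gt0.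
have [theta [st t1 t0]] := cube_cutoff x r20.
have off y : ~ [set y | `|y - x| <= r] y -> theta y = 0.
  move=> /negP; rewrite -ltNge => h; apply: t0.
  by rewrite mulrCA divff ?mulr1 ?ltW.
exists [set y | `|y - x| < r / 2], (fun phi => T (fun y => (theta y)%:C * phi y)); split.
- exact: open_ball_cube.
- move=> y /= h; apply: rO; rewrite (le_trans (ltW h))// ler_piMr ?ltW//.
  by rewrite invf_lt1// ltr1n.
- by rewrite /= subrr normr0.
- by apply: (cutoff_compact_distribution oO dT st (@compact_closed_cube R n x r)).
- move=> phi tp; congr T; apply/funext => y.
  have [Vy|Vy] := pselect (`|y - x| < r / 2); first by rewrite t1 ?ltW// mul1r.
  suff -> : phi y = 0 by rewrite mulr0.
  by apply: (test_function_off tp) => sy; have [_ [_ /(_ y sy)]] := tp.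
Qed.

Definition conv_net Omega w rho : @net R n := fun eps => convolution Omega w (rescale rho eps).

(** The derivatives fall on the mollifier, whatever the distribution. *)
Lemma conv_net_smooth Omega w rho : open Omega -> compact_distribution Omega w -> schwartz rho ->
  forall eps V, open V -> smooth V (conv_net Omega w rho eps) /\
   forall s x, V x ->
    iter_partial s (fun x => Re (conv_net Omega w rho eps x)) x =
      iter_partial s (convol (fun g => Re (localize w (xget (fun=> 0) (cutoffs Omega w)) g)) (rescR (fun x => Re (rho x)) eps)) x -
      iter_partial s (convol (fun g => Im (localize w (xget (fun=> 0) (cutoffs Omega w)) g)) (rescR (fun x => Im (rho x)) eps)) x
   /\ iter_partial s (fun x => Im (conv_net Omega w rho eps x)) x =
      iter_partial s (convol (fun g => Re (localize w (xget (fun=> 0) (cutoffs Omega w)) g)) (rescR (fun x => Im (rho x)) eps)) x +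
      iter_partial s (convol (fun g => Im (localize w (xget (fun=> 0) (cutoffs Omega w)) g)) (rescR (fun x => Re (rho x)) eps)) x.
Proof.
move=> oO cw sr eps V oV; have [tchi _] := cutoffs_xget oO cw.
have [h1 h2] := schwartz_parts sr.
have [t1 t2] := test_function_tame (proj1 cw) tchi.
have P := convolution_parts cw tchi erefl (proj1 sr) eps.
set W1 := (fun g => Re (localize w _ g)) in t1 P *; set W2 := (fun g => Im (localize w _ g)) in t2 P *.
have b1 := rescR_bsmooth eps (schwR_bsmooth h1); have b2 := rescR_bsmooth eps (schwR_bsmooth h2).
have s11 := smoothR_sub (@subsetT _ V) (proj1 (convol_smooth t1 b1)).
have s12 := smoothR_sub (@subsetT _ V) (proj1 (convol_smooth t1 b2)).
have s21 := smoothR_sub (@subsetT _ V) (proj1 (convol_smooth t2 b1)).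
have s22 := smoothR_sub (@subsetT _ V) (proj1 (convol_smooth t2 b2)).
have e1 : (fun x => Re (conv_net Omega w rho eps x)) = (fun x =>
    convol W1 (rescR (fun x => Re (rho x)) eps) x - convol W2 (rescR (fun x => Im (rho x)) eps) x).
  by apply/funext => x; have [] := P x.
have e2 : (fun x => Im (conv_net Omega w rho eps x)) = (fun x =>
    convol W1 (rescR (fun x => Im (rho x)) eps) x + convol W2 (rescR (fun x => Re (rho x)) eps) x).
  by apply/funext => x; have [] := P x.
have [sa da] := smoothR_sub_fun oV s11 s22; have [sb db] := smoothR_add oV s12 s21.
split; first by split; rewrite ?e1 ?e2.
by move=> s x Vx; rewrite e1 e2 da// db.
Qed.

Lemma conv_net_rmod Omega w rho Q : open Omega -> compact_distribution Omega w -> schwartz rho ->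
  rmod (re_net (conv_net Omega w rho)) Q /\ rmod (im_net (conv_net Omega w rho)) Q.
Proof.
move=> oO cw sr; have [tchi _] := cutoffs_xget oO cw.
have [h1 h2] := schwartz_parts sr.
have [t1 t2] := test_function_tame (proj1 cw) tchi.
have D eps := (conv_net_smooth oO cw sr eps openT).2.
have [N11 H11] := convol_rescR_bound t1 h1; have [N12 H12] := convol_rescR_bound t1 h2.
have [N21 H21] := convol_rescR_bound t2 h1; have [N22 H22] := convol_rescR_bound t2 h2.
split=> s.
  have [C1 C10 B1] := H11 s; have [C2 C20 B2] := H22 s.
  exists (N11 + N22 + size s)%N, (C1 + C2 + 1), 1; split; first by rewrite ltr_wpDl// addr_ge0.
  split; first by rewrite ltr01 lexx.
  move=> eps ee x _; rewrite (D eps s x I).1.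
  have ei0 : 0 <= eps ^- (N11 + N22 + size s) by rewrite invr_ge0 exprn_ge0//; case/andP: ee => /ltW.
  apply: le_trans (ler_normB _ _) _; rewrite mulrDl mul1r mulrDl -[leLHS]addr0 lerD// lerD//.
    by rewrite (le_trans (B1 _ _ ee))// ler_wpM2l// expVr_le// leq_add2r leq_addr.
  by rewrite (le_trans (B2 _ _ ee))// ler_wpM2l// expVr_le// leq_add2r leq_addl.
have [C1 C10 B1] := H12 s; have [C2 C20 B2] := H21 s.
exists (N12 + N21 + size s)%N, (C1 + C2 + 1), 1; split; first by rewrite ltr_wpDl// addr_ge0.
split; first by rewrite ltr01 lexx.
move=> eps ee x _; rewrite (D eps s x I).2.
have ei0 : 0 <= eps ^- (N12 + N21 + size s) by rewrite invr_ge0 exprn_ge0//; case/andP: ee => /ltW.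
apply: le_trans (ler_normD _ _) _; rewrite mulrDl mul1r mulrDl -[leLHS]addr0 lerD// lerD//.
  by rewrite (le_trans (B1 _ _ ee))// ler_wpM2l// expVr_le// leq_add2r leq_addr.
by rewrite (le_trans (B2 _ _ ee))// ler_wpM2l// expVr_le// leq_add2r leq_addl.
Qed.

End LocalRepresentatives.

(** * Mollification of regular distributions *)

Section RegularConvolution.
Local Open Scope complex_scope.
Context {R : realType} {n : nat}.
Implicit Types (x y c : 'rV[R]_n) (f phi : 'rV[R]_n -> R[i]) (rho : 'rV[R]_n -> R[i]).
Implicit Types (g F : 'rV[R]_n -> R).
Implicit Types (Omega V Q K : set 'rV[R]_n) (T w : @functional R n).

Lemma average_approx F g (m : nat) : bsmooth F -> schwR g -> vanishing_moments g ->
  exists2 C : R, 0 <= C & forall eps x, 0 < eps <= 1 ->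
    `|average F g eps x - F x * integral_rV g| <= C * eps ^+ m.
Proof.
move=> bF sg vg; have [C C0 H] := moment_approx 0 (ltn0Sn m) (schwR_rapid sg) vg.
have [B B0 HB] := bsmooth_dbound (n * m.+1) bF.
exists (C * B); first by rewrite mulr_ge0// ltW.
move=> eps x ee; have [ep e1] := andP ee.
apply: le_trans (H F x eps B (proj1 bF) ee _) _.
  by move=> s z hs; rewrite expr0 mulr1; exact: HB.
rewrite mulrAC; apply: ler_wpM2l; first by rewrite mulr_ge0// ltW.
by rewrite exprS ler_piMl// exprn_ge0// ltW.
Qed.

(** Substituting y = x - eps z moves the scale from the mollifier to the density. *)
Lemma integral_reflect_rescR K F g eps x : compact K -> bsmooth F -> (forall y, ~ K y -> F y = 0) ->
  schwR g -> 0 < eps ->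
  integral_rV (fun y => F y * rescR g eps (x - y)) = average F g eps x.
Proof.
move=> cK bF F0 sg ep; have [D D0 HD] := compact_support_dominated cK.
have sb := rescR_bsmooth eps (schwR_bsmooth sg).
have [B1 B10 H1] := bsmooth_dbound 0 bF; have [B2 B20 H2] := bsmooth_dbound 0 sb.
have dh : dominated (fun y => F y * rescR g eps (x - y)) (D * (B1 * B2)).
  apply: HD.
  - apply: smoothRT_continuous; have [] := smoothR_mul openT (proj1 bF) (smoothR_reflect x (proj1 sb)).
    by [].
  - by rewrite mulr_ge0// ltW.
  - by move=> y; rewrite normrM ler_pM//; [exact: (H1 [::])|exact: (H2 [::])].
  - by move=> y /F0 ->; rewrite mul0r.
have H := integral_rV_affine x ep dh.
have e1 : (fun z => F (x - eps *: z) * rescR g eps (x - (x - eps *: z))) =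
    (fun z => eps ^- n * (F (x - eps *: z) * g z)).
  apply/funext => z; rewrite /rescR subKr scalerA mulVf ?gt_eqF// scale1r.
  by rewrite mulrCA.
move: H; rewrite e1.
have [C C0 HC] := average_dominated (schwR_rapid sg).
have d2 : dominated (fun z => F (x - eps *: z) * g z) (B1 * C).
  apply: (HC (fun z => F (x - eps *: z))); first exact: (@continuous_affine R n F x eps (smoothRT_continuous (proj1 bF))).
  by move=> z; exact: (H1 [::]).
rewrite (integral_rVZ _ d2) => /mulfI H; symmetry; apply: H.
by rewrite invr_neq0// expf_neq0// gt_eqF.
Qed.

(** The part of [w] near a point is given by the density; the function theta (1 - chi) g vanishes near the
    support of [w] and contributes nothing, although the support of theta need not lie where chi = 1. *)
Lemma localize_regular_split Omega V w f theta K : open Omega -> V `<=` Omega -> compact_distribution Omega w ->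
  eq_dist_on V (regular f) w -> smoothR setT theta -> compact K -> K `<=` V ->
  (forall y, ~ K y -> theta y = 0) ->
  forall chi, cutoffs Omega w chi -> forall g, smoothR setT g ->
  localize w chi g = integral_rVC (fun y => f y * (theta y * g y)%:C) +
    localize w (fun y => (1 - theta y)%:C * chi y) g.
Proof.
move=> oO VO [dw [K1 sK1]] ew st cK KV t0 chi [tchi [K2 [U [sK2 [oU [KU cU]]]]]] g sg.
have [lin _] := dw.
have gc : smooth setT (fun y => (g y)%:C).
  by split=> //=; have [] := smoothR_cst (n := n) (0 : R) openT.
have stg : smooth setT (fun y => (theta y)%:C * (g y)%:C) by exact: smooth_real_mul.
have chig : smooth setT (fun y => chi y * (g y)%:C).
  by have [] := smooth_mul_real (proj1 tchi) sg.
have s1t : smoothR setT (fun y => 1 - theta y).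
  by have [] := smoothR_sub_fun openT (proj1 (smoothR_cst (n := n) (1 : R) openT)) st.
have KO : K `<=` Omega by move=> y /KV/VO.
have tA : test_function Omega (fun y => (theta y)%:C * (chi y * (g y)%:C)).
  apply: (test_function_supported cK KO); first exact: smooth_real_mul.
  by move=> y /t0 ->; rewrite mul0r.
have tB : test_function Omega (fun y => (1 - theta y)%:C * (chi y * (g y)%:C)).
  have [_ [cs sO]] := tchi.
  apply: (test_function_supported cs sO); first exact: smooth_real_mul.
  by move=> y /(test_function_off tchi) ->; rewrite mul0r mulr0.
have tD : test_function V (fun y => (theta y)%:C * (g y)%:C).
  by apply: (test_function_supported cK KV) => // y /t0 ->; rewrite mul0r.
have tE : test_function (Omega `\` K2) (fun y => (theta y)%:C * (g y)%:C - (theta y)%:C * (chi y * (g y)%:C)).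
  have cKU : compact (K `&` ~` U) by apply: compact_closedI => //; exact: open_closedC.
  apply: (test_function_supported cKU).
  - by move=> y [Ky Uy]; split; [exact: KO|move=> /KU].
  - by have [] := partial_sub openT stg (proj1 tA).
  - move=> y /not_andP[/t0 ->|/contrapT Uy]; first by rewrite !mul0r subr0.
    by rewrite cU// mul1r subrr.
(* theta (1 - chi) g is supported away from the support of w *)
have E0 := (let: And3 _ _ e := sK2 in e) _ tE.
have tE' : test_function Omega (fun y => (theta y)%:C * (g y)%:C - (theta y)%:C * (chi y * (g y)%:C)).
  by apply: test_function_sub tE; exact: subDsetl.
have L1 := lin 1 _ _ tE' tA; have L2 := lin 1 _ _ tA tB.
have q1 : (fun y => 1 * ((theta y)%:C * (g y)%:C - (theta y)%:C * (chi y * (g y)%:C)) + (theta y)%:C * (chi y * (g y)%:C)) =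
  (fun y => (theta y)%:C * (g y)%:C) by apply/funext => y; rewrite mul1r subrK.
have q2 : (fun y => 1 * ((theta y)%:C * (chi y * (g y)%:C)) + (1 - theta y)%:C * (chi y * (g y)%:C)) =
  (fun y => chi y * (g y)%:C).
  by apply/funext => y; rewrite mul1r -mulrDl -rmorphD /= addrC subrK mul1r.
rewrite q1 E0 mulr0 add0r -(ew _ tD) in L1.
rewrite q2 -L1 mul1r in L2.
rewrite /localize L2; congr (_ + _).
  by rewrite /regular; congr integral_rVC; apply/funext => y; rewrite rmorphM.
by congr w; apply/funext => y; rewrite mulrA.
Qed.

End RegularConvolution.

Section RegularNegligible.
Local Open Scope complex_scope.
Context {R : realType} {n : nat}.
Implicit Types (x y c : 'rV[R]_n) (f phi : 'rV[R]_n -> R[i]) (rho : 'rV[R]_n -> R[i]).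
Implicit Types (g F : 'rV[R]_n -> R).
Implicit Types (Omega V Q K : set 'rV[R]_n) (T w : @functional R n).

Lemma compact_support_bsmooth K F : compact K -> smoothR setT F -> (forall y, ~ K y -> F y = 0) ->
  bsmooth F.
Proof.
move=> cK sF F0; split=> // s.
have [B B0 H] := compact_dbound (size s) openT cK (@subsetT _ _) sF; exists B => y.
have [Ky|Ky] := pselect (K y); first exact: H.
have [r r0 hr] := compact_far cK Ky.
by rewrite (@iter_partial_eq0 _ _ F y r)// ?normr0 ?ltW// => z /hr /F0.
Qed.

Lemma rneg_bound (v : R -> 'rV[R]_n -> R) Q :
  (forall m : nat, exists2 C : R, 0 <= C & forall eps x, 0 < eps <= 1 -> Q x -> `|v eps x| <= C * eps ^+ m) ->
  rneg v [::] Q.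
Proof.
move=> H m; have [C C0 HC] := H m; exists (C + 1), 1; split; first by rewrite ltr_wpDl.
split; first by rewrite ltr01 lexx.
move=> eps ee x Qx; apply: le_trans (HC eps x ee Qx) _.
by rewrite ler_wpM2r// ?lerDl// exprn_ge0//; case/andP: ee => /ltW.
Qed.

Lemma four_terms (a1 a2 t1 t2 f1 c1 c2 c3 c4 p : R) : `|a1 - f1| <= c1 * p -> `|a2| <= c2 * p ->
  `|t1| <= c3 * p -> `|t2| <= c4 * p ->
  `|f1 - (a1 + t1 - (a2 + t2))| <= (c1 + c2 + c3 + c4) * p /\
  `|f1 - (a2 + t2 + (a1 + t1))| <= (c1 + c2 + c3 + c4) * p.
Proof.
rewrite !ler_norml => /andP[h1 h1'] /andP[h2 h2'] /andP[h3 h3'] /andP[h4 h4'].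
rewrite !mulrDl; move: (c1 * p) (c2 * p) (c3 * p) (c4 * p) h1 h1' h2 h2' h3 h3' h4 h4'.
by move=> p1 p2 p3 p4 h1 h1' h2 h2' h3 h3' h4 h4'; split; apply/andP; split; lra.
Qed.

Lemma conv_net_moderate Omega V w rho : open Omega -> open V -> compact_distribution Omega w -> schwartz rho ->
  moderate V (conv_net Omega w rho).
Proof.
move=> oO oV cw sr; apply: moderate_of_local.
  by move=> eps _; have [] := conv_net_smooth oO cw sr eps oV.
by move=> x _; exists 1 => //; exact: conv_net_rmod.
Qed.

Lemma constant_moderate Omega f : open Omega -> smooth Omega f -> moderate Omega (fun=> f).
Proof.
move=> oO [f1 f2]; split=> // K a cK KO; exists 0%N.
have [A1 A10 H1] := compact_dbound (size (mindices a)) oO cK KO f1.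
have [A2 A20 H2] := compact_dbound (size (mindices a)) oO cK KO f2.
exists (A1 + A2), 1; split; first exact: addr_gt0.
split; first by rewrite ltr01 lexx.
move=> eps _ x Kx; rewrite expr0 invr1 mulr1; apply: le_trans (normc_le _) _.
by rewrite lerD//; [exact: H1|exact: H2].
Qed.

(** Near x_0 the mollified distribution is the mollified density, up to a remote part: the first is [f] up
    to O(eps^m) by the moment conditions, the second is O(eps^m) by decay. *)
Lemma regular_negligible Omega V w f rho : open Omega -> open V -> V `<=` Omega -> smooth Omega f ->
  mollifier rho -> compact_distribution Omega w -> eq_dist_on V (regular f) w ->
  negligible_net V (net_sub (fun=> f) (conv_net Omega w rho)).
Proof.
move=> oO oV VO [f1 f2] mr cw ew; have sr := proj1 mr.
have md : moderate V (net_sub (fun=> f) (conv_net Omega w rho)).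
  apply: moderate_sub => //; last exact: conv_net_moderate.
  by apply: constant_moderate => //; exact: smooth_sub VO (conj f1 f2).
apply: negligible_of_local => [|x0 Vx0]; first exact: (proj1 md).
have [r' r'0 rV] := open_cube oV Vx0.
pose r := r' / 2; have r0 : 0 < r by rewrite divr_gt0.
have rr : 2 * r = r' by rewrite mulrCA divff ?mulr1.
have r2r : r / 2 <= r by rewrite ler_pdivrMr// ler_peMr ?ler1n// ltW.
have rr' : r / 2 <= r' by rewrite (le_trans r2r)// -rr ler_peMl ?ltW// ltr1n.
exists (r / 2); first by rewrite divr_gt0.
have QV : forall y, `|y - x0| <= r / 2 -> V y by move=> y h; apply: rV; exact: le_trans h _.
split=> //.
have [m1 m2] := moderate_rmod oV md (@compact_closed_cube R n x0 (r / 2)) QV.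
have [theta [st th1 th0]] := cube_cutoff x0 r0.
pose K := [set y : 'rV[R]_n | `|y - x0| <= r'].
have cK : compact K by exact: compact_closed_cube.
have KV : K `<=` V by move=> y /rV.
have KO : K `<=` Omega by move=> y /KV/VO.
have t0 y : ~ K y -> theta y = 0.
  by move=> /negP; rewrite -ltNge -rr => h; apply: th0; exact: ltW.
pose F1 y := Re (f y) * theta y; pose F2 y := Im (f y) * theta y.
have F10 y : ~ K y -> F1 y = 0 by move=> /t0 h; rewrite /F1 h mulr0.
have F20 y : ~ K y -> F2 y = 0 by move=> /t0 h; rewrite /F2 h mulr0.
have bF1 : bsmooth F1 by apply: (compact_support_bsmooth cK _ F10); exact: (smoothR_zero_extension oO cK KO f1 st t0).
have bF2 : bsmooth F2 by apply: (compact_support_bsmooth cK _ F20); exact: (smoothR_zero_extension oO cK KO f2 st t0).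
have cchi := cutoffs_xget oO cw; have tchi := proj1 cchi.
set chi := xget _ _ in cchi tchi.
pose tl := localize w (fun y => (1 - theta y)%:C * chi y).
have spl := localize_regular_split oO VO cw ew st cK KV t0 cchi.
have s1t : smoothR setT (fun y => 1 - theta y).
  by have [] := smoothR_sub_fun openT (proj1 (smoothR_cst (n := n) (1 : R) openT)) st.
pose KT := [set y : 'rV[R]_n | r <= `|y - x0|].
have [tt1 tt2] : tame KT (fun g => Re (tl g)) /\ tame KT (fun g => Im (tl g)).
  have [_ [cs sO]] := tchi.
  apply: (localize_tame (proj1 cw) cs sO).
  - exact: smooth_real_mul (proj1 tchi).
  - by move=> y /(test_function_off tchi) ->; rewrite mulr0.
  - move=> y _ /negP; rewrite -ltNge => yr; exists (r - `|y - x0|); first by rewrite subr_gt0.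
    move=> z zy; rewrite th1 ?subrr ?mul0r//.
    have -> : z - x0 = (z - y) + (y - x0) by rewrite addrA subrK.
    by rewrite (le_trans (ler_normD _ _))// -lerBrDr.
have [h1 h2 v1 v2 [i1 i2]] := mollifier_parts mr.
have cv g eps x : schwR g -> 0 < eps ->
    convol (fun g => Re (localize w chi g)) (rescR g eps) x =
      average F1 g eps x + convol (fun g => Re (tl g)) (rescR g eps) x /\
    convol (fun g => Im (localize w chi g)) (rescR g eps) x =
      average F2 g eps x + convol (fun g => Im (tl g)) (rescR g eps) x.
  move=> sg ep; rewrite /convol.
  have sre := smoothR_reflect x (proj1 (rescR_bsmooth eps (schwR_bsmooth sg))).
  rewrite (spl _ sre) cReD cImD; split; congr (_ + _).
    rewrite -(integral_reflect_rescR x cK bF1 F10 sg ep) /=; congr integral_rV.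
    by apply/funext => y; rewrite cReM /= mulr0 subr0 mulrA.
  rewrite -(integral_reflect_rescR x cK bF2 F20 sg ep) /=; congr integral_rV.
  by apply/funext => y; rewrite cImM /= mulr0 add0r mulrA.
have far x y : `|x - x0| <= r / 2 -> KT y -> r / 2 <= `|x - y|.
  move=> xr yr; have : r <= `|x - y| + `|x - x0|.
    rewrite (le_trans yr)//; have -> : y - x0 = (x - x0) - (x - y) by rewrite opprB [RHS]addrC addrA subrK.
    by rewrite [leRHS]addrC ler_normB.
  by move: xr; move: (`|_|) (`|_|) => a b; lra.
have r20 : 0 < r / 2 by rewrite divr_gt0.
have cp := convolution_parts cw tchi erefl (proj1 sr).
have fin : forall m : nat, exists2 C : R, 0 <= C & forall eps x, 0 < eps <= 1 -> `|x - x0| <= r / 2 ->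
   `|Re (f x - conv_net Omega w rho eps x)| <= C * eps ^+ m /\
   `|Im (f x - conv_net Omega w rho eps x)| <= C * eps ^+ m.
  move=> m.
  have [c1 c10 a1] := average_approx m bF1 h1 v1; have [c2 c20 a2] := average_approx m bF2 h2 v2.
  have [c3 c30 b1] := convol_rescR_far m tt1 h1 r20; have [c4 c40 b2] := convol_rescR_far m tt2 h2 r20.
  have [d1 d10 p1] := average_approx m bF2 h1 v1; have [d2 d20 p2] := average_approx m bF1 h2 v2.
  have [d3 d30 q1] := convol_rescR_far m tt2 h1 r20; have [d4 d40 q2] := convol_rescR_far m tt1 h2 r20.
  exists ((c1 + c2 + c3 + c4) + (d1 + d2 + d3 + d4)); first by rewrite !addr_ge0.
  move=> eps x ee xr; have [ep e1] := andP ee.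
  have fr y : KT y -> r / 2 <= `|x - y| by exact: far.
  have p0 : 0 <= eps ^+ m by rewrite exprn_ge0// ltW.
  have F1x : F1 x = Re (f x) by rewrite /F1 th1 ?mulr1// (le_trans xr).
  have F2x : F2 x = Im (f x) by rewrite /F2 th1 ?mulr1// (le_trans xr).
  have [C1 C2] := cp eps x.
  rewrite !cReD !cImD cReN cImN /conv_net C1 C2.
  rewrite !(fun g sg => (cv g eps x sg ep).1)// !(fun g sg => (cv g eps x sg ep).2)//.
  have A1 := a1 eps x ee; have A2 := a2 eps x ee; rewrite i1 mulr1 F1x in A1; rewrite i2 mulr0 subr0 in A2.
  have P1 := p1 eps x ee; have P2 := p2 eps x ee; rewrite i1 mulr1 F2x in P1; rewrite i2 mulr0 subr0 in P2.
  have [X1 _] := four_terms A1 A2 (b1 eps x ee fr) (b2 eps x ee fr).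
  have [_ X2] := four_terms P1 P2 (q1 eps x ee fr) (q2 eps x ee fr).
  split; [apply: le_trans X1 _|apply: le_trans X2 _]; rewrite ler_wpM2r//.
    by rewrite lerDl !addr_ge0.
  by rewrite lerDr !addr_ge0.
by split=> //; apply: rneg_bound => m; have [C C0 H] := fin m; exists C => // eps x ee /(H eps x ee)[].
Qed.

End RegularNegligible.

(** * Ultradifferentiable functions as regular nets *)

Section Superset.
Context {R : realType} {n : nat}.
Implicit Types (f phi : 'rV[R]_n -> R[i]) (rho : 'rV[R]_n -> R[i]).
Implicit Types (Omega V Q K : set 'rV[R]_n) (T w : @functional R n).

(** Nets representing the density [f] and the constant net differ negligibly on the members of a cover,
    hence on [Omega]. *)
Lemma dist_embedding_regular Omega f rho : open Omega -> smooth Omega f -> mollifier rho ->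
  dist_embedding rho Omega (regular f) = gclass Omega (fun=> f).
Proof.
move=> oO sf mr; have mf := constant_moderate oO sf; apply/seteqP; split=> u [mu H]; split=> //.
  apply: negligible_cover => //; first by have [] := moderate_sub oO mu mf.
  move=> x Ox.
  have [V [w [oV VO Vx cw ew]]] := local_representative oO (regular_distribution oO sf) Ox.
  exists V; split=> //.
  have := regular_negligible oO oV VO sf mr cw ew; move=> /(negligible_sym oV).
  exact: negligible_trans (H V w oV VO cw ew).
move=> V w oV VO cw ew.
have := regular_negligible oO oV VO sf mr cw ew.
by apply: negligible_trans => //; exact: negligible_restrict VO _.
Qed.

Lemma ultradiff_reg_net Omega M f : ultradiff Omega M f ->
  reg_net Omega M bounded_sequences (fun=> f).
Proof.
move=> [sf H]; split=> // K cK KO; have [c [c0 Hc]] := H K cK KO.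
exists (fun=> 0); split; first by split=> //; exists 0.
exists c, 1; split=> //; split; first by rewrite ltr01 lexx.
by move=> a eps ee x Kx; rewrite oppr0 powRr0 mulr1; exact: Hc.
Qed.

Lemma ultradiff_colombeau_sub Omega M rho : open Omega -> mollifier rho ->
  ultradiff_colombeau Omega M `<=`
    reg_colombeau Omega M bounded_sequences `&` dist_colombeau rho Omega.
Proof.
move=> oO mr _ [f uf <-]; have [sf _] := uf; split.
  by exists (fun=> f) => //; exact: ultradiff_reg_net.
split; first by exists (fun=> f) => //; exact: constant_moderate.
exists (regular f); first exact: regular_distribution.
exact: dist_embedding_regular.
Qed.

End Superset.

(** * Averaging at two scales *)

Section TwoScale.
Context {R : realType} {n : nat}.
Implicit Types (x y z c : 'rV[R]_n) (g h : 'rV[R]_n -> R) (w : ('rV[R]_n -> R) -> R).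
Implicit Types (K Q : set 'rV[R]_n).

(** Averaging the net of [w] and [g] at scale [d] is averaging the net of [w] and [h] at scale [eps]. *)
Lemma scale_swap K w g h (eps d : R) x : tame K w -> schwR g -> schwR h -> 0 < eps -> 0 < d ->
  average (convol w (rescR g eps)) h d x = average (convol w (rescR h d)) g eps x.
Proof.
move=> tw sg sh e0 d0.
rewrite (convol_average d x tw (rescR_bsmooth eps (schwR_bsmooth sg)) sh).
rewrite (convol_average eps x tw (rescR_bsmooth d (schwR_bsmooth sh)) sg).
by congr (convol w _ x); apply/funext => y; exact: average_rescR_sym.
Qed.

(** The choice of exponents: with eps <= d^(q+1), a gain of eps per order outweighs the loss of [q] powers
    of [d] per order. *)
Lemma exp_scale_le (d eps : R) (q m N : nat) : 0 < d <= 1 -> 0 < eps -> eps <= d ^+ q.+1 ->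
  eps ^+ (m + N) * d ^- (N + q * (m + N)) <= d ^+ m.
Proof.
move=> /andP[d0 d1] e0 ed.
have -> : d ^+ m = (d ^+ q.+1) ^+ (m + N) * d ^- (N + q * (m + N)).
  rewrite -exprM mulSn -addnA [X in d ^+ (m + X)]addnC exprD.
  rewrite [(N + _)%N in RHS]addnC -mulrA [(q * (m + N) + N)%N]addnC.
  by rewrite divff ?mulr1// expf_neq0// gt_eqF.
apply: ler_wpM2r; first by rewrite invr_ge0 exprn_ge0// ltW.
by apply: lerXn2r => //; rewrite nnegrE ?exprn_ge0// ltW.
Qed.

(** Moment expansion at the small scale [eps] of the net at the larger scale [d]; in dimension [n], the
    expansion of order [m] involves derivatives up to order n m, hence the exponent n + 1. *)
Lemma swap_approx K w g h (m : nat) : tame K w -> schwR g -> schwR h -> vanishing_moments g ->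
  exists2 C : R, 0 <= C & forall eps d x, 0 < eps -> 0 < d <= 1 -> eps <= d ^+ n.+1 ->
    `|average (convol w (rescR h d)) g eps x - convol w (rescR h d) x * integral_rV g| <= C * d ^+ m.
Proof.
move=> tw sg sh vg; have [N HN] := convol_rescR_bound tw sh.
have m0 : (0 < m.+1 + N)%N by [].
have [C C0 H] := moment_approx 0 m0 (schwR_rapid sg) vg.
have [B B0 HB] : exists2 B : R, 0 < B & forall s, (size s <= n * (m.+1 + N))%N ->
    forall d x, 0 < d <= 1 -> `|iter_partial s (convol w (rescR h d)) x| <= B * d ^- (N + size s).
  apply: short_seqs_bound => [s|s B B' BB HB d x d01].
    by have [A A0 HA] := HN s; exists A => d x; exact: HA.
  apply: le_trans (HB d x d01) _; rewrite ler_wpM2r// invr_ge0 exprn_ge0//.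
  by case/andP: d01 => /ltW.
exists (C * B); first by rewrite mulr_ge0// ltW.
move=> eps d x e0 d01 ed; have [d0 d1] := andP d01.
have e1 : 0 < eps <= 1 by rewrite e0 (le_trans ed)// exprn_ile1// ltW.
have sm := (convol_smooth tw (rescR_bsmooth d (schwR_bsmooth sh))).1.
apply: le_trans (H _ x eps (B * d ^- (N + n * (m.+1 + N))) sm e1 _) _.
  move=> s z hs; rewrite expr0 mulr1; apply: le_trans (HB s hs d _ d01) _.
  by rewrite ler_pM2l// expVr_le// leq_add2l.
have := exp_scale_le m.+1 N d01 e0 ed => hh.
have -> : C * eps ^+ (m.+1 + N) * (B * d ^- (N + n * (m.+1 + N))) =
   C * B * (eps ^+ (m.+1 + N) * d ^- (N + n * (m.+1 + N))) by ring.
apply: ler_wpM2l; first by rewrite mulr_ge0// ltW.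
by rewrite (le_trans hh)// exprS ler_piMl// exprn_ge0// ltW.
Qed.

(** Far from [x] only the crude bound is available, but there d |z| > r / 2 and the factor |z|^k pays for
    it. *)
Lemma weighted_bound g x0 x z (r d A D : R) (k : nat) : 0 < r -> 0 < d -> 0 <= A -> 0 <= D ->
  `|x - x0| <= r / 2 -> (forall y, `|y - x0| <= r -> `|g y| <= A) ->
  (forall y, `|g y| <= D * d ^- k) ->
  `|g (x - d *: z)| <= (A + D * (2 / r) ^+ k) * (1 + `|z|) ^+ k.
Proof.
move=> r0 d0 A0 D0 xr gA gD.
have z1 : 1 <= (1 + `|z|) ^+ k by rewrite exprn_ege1// lerDl.
have rk : 0 <= D * (2 / r) ^+ k by rewrite mulr_ge0// exprn_ge0// divr_ge0// ltW.
have [dz|dz] := leP (d * `|z|) (r / 2).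
  apply: le_trans (gA _ _) _.
    have -> : x - d *: z - x0 = (x - x0) - d *: z by rewrite addrAC.
    rewrite (le_trans (ler_normB _ _))// normrZ gtr0_norm//.
    by rewrite (splitr r) lerD.
  apply: (@le_trans _ _ (A * (1 + `|z|) ^+ k)); first by rewrite ler_peMr.
  by rewrite ler_wpM2r ?lerDl// (le_trans _ z1).
apply: le_trans (gD _) _.
apply: (@le_trans _ _ (D * (2 / r) ^+ k * (1 + `|z|) ^+ k)); last first.
  by rewrite ler_wpM2r ?lerDr// (le_trans _ z1).
have z0 : 0 < 1 + `|z| by rewrite ltr_wpDr.
have rz : 0 < 2 / r * (1 + `|z|) by rewrite mulr_gt0// divr_gt0.
rewrite -mulrA; apply: ler_wpM2l => //; rewrite -exprMn -exprVn.
apply: lerXn2r; rewrite ?nnegrE ?invr_ge0; [exact: ltW|exact: ltW|].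
rewrite -(ler_pM2l d0) divff ?gt_eqF//; apply: ltW.
have -> : d * (2 / r * (1 + `|z|)) = (d + d * `|z|) / (r / 2).
  by field; rewrite gt_eqF.
by rewrite ltr_pdivlMr ?divr_gt0// mul1r ltr_wpDl// ltW.
Qed.

End TwoScale.

Section TwoScaleEstimate.
Context {R : realType} {n : nat}.
Implicit Types (x y z c : 'rV[R]_n) (g h : 'rV[R]_n -> R) (w : ('rV[R]_n -> R) -> R).
Implicit Types (K Q : set 'rV[R]_n).

Lemma expVr_scale (eps d : R) (q k : nat) : 0 < eps -> 0 < d -> d ^+ q <= eps ->
  eps ^- k <= d ^- (q * k).
Proof.
move=> e0 d0 h; rewrite lef_pV2 ?posrE ?exprn_gt0// exprM.
by apply: lerXn2r => //; rewrite nnegrE ?exprn_ge0// ltW.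
Qed.

Variables (Ka Kb : set 'rV[R]_n) (wa wb : ('rV[R]_n -> R) -> R) (ga gb h : 'rV[R]_n -> R) (c : R).
Hypotheses (ta : tame Ka wa) (tb : tame Kb wb).
Hypotheses (sa : schwR ga) (sb : schwR gb) (sh : schwR h).
Hypotheses (va : vanishing_moments ga) (vb : vanishing_moments gb) (vh : vanishing_moments h).
Hypotheses (ia : integral_rV ga = 1) (ib : integral_rV gb = 0) (ih : integral_rV h = 1).

Let P eps x := convol wa (rescR ga eps) x + c * convol wb (rescR gb eps) x.

Lemma two_scale_smooth eps : smoothR setT (P eps) /\ forall s x,
  iter_partial s (P eps) x = iter_partial s (convol wa (rescR ga eps)) x +
    c * iter_partial s (convol wb (rescR gb eps)) x.
Proof.
have s1 := (convol_smooth ta (rescR_bsmooth eps (schwR_bsmooth sa))).1.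
have s2 := (convol_smooth tb (rescR_bsmooth eps (schwR_bsmooth sb))).1.
have [s3 d3] := smoothR_scale c openT s2; have [s4 d4] := smoothR_add openT s1 s3.
by split=> // s x; rewrite d4// d3.
Qed.

Lemma two_scale_global_bound : exists N : nat, forall k : nat, exists2 D : R, 0 < D & forall s eps x,
  (size s <= k)%N -> 0 < eps <= 1 -> `|iter_partial s (P eps) x| <= D * eps ^- (N + k).
Proof.
have [N1 H1] := convol_rescR_bound ta sa; have [N2 H2] := convol_rescR_bound tb sb.
exists (N1 + N2)%N => k.
have [D D0 HD] : exists2 D : R, 0 < D & forall s, (size s <= k)%N -> forall eps x, 0 < eps <= 1 ->
    `|iter_partial s (P eps) x| <= D * eps ^- (N1 + N2 + size s).
  apply: short_seqs_bound => [s|s B B' BB HB eps x e01].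
    have [C1 C10 B1] := H1 s; have [C2 C20 B2] := H2 s; exists (C1 + `|c| * C2) => eps x e01.
    rewrite (two_scale_smooth eps).2 (le_trans (ler_normD _ _))// mulrDl lerD//.
      by rewrite (le_trans (B1 eps x e01))// ler_wpM2l// expVr_le// leq_add2r leq_addr.
    rewrite normrM -mulrA ler_wpM2l//.
    by rewrite (le_trans (B2 eps x e01))// ler_wpM2l// expVr_le// leq_add2r leq_addl.
  apply: le_trans (HB eps x e01) _; rewrite ler_wpM2r// invr_ge0 exprn_ge0//.
  by case/andP: e01 => /ltW.
exists D => // s eps x hs e01; apply: le_trans (HD s hs eps x e01) _.
by rewrite ler_pM2l// expVr_le// leq_add2l.
Qed.

Variables (x0 : 'rV[R]_n) (r : R) (b : nat).
Hypothesis r0 : 0 < r.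
Hypothesis local_bound : forall s,
  eventually_le (fun eps x => `|iter_partial s (P eps) x|) [set y | `|y - x0| <= r] (fun eps => eps ^- b).

Lemma two_scale_local_bound k : exists2 B : R, 1 <= B & forall s eps x, (size s <= k)%N -> 0 < eps <= B^-1 ->
  `|x - x0| <= r -> `|iter_partial s (P eps) x| <= B * eps ^- b.
Proof.
have [B B0 HB] : exists2 B : R, 0 < B & forall s, (size s <= k)%N -> 1 <= B /\
   forall eps x, 0 < eps <= B^-1 -> `|x - x0| <= r -> `|iter_partial s (P eps) x| <= B * eps ^- b.
  apply: short_seqs_bound => [s|s B B' BB [B1 HB]].
    have [C [eta [C0 [/andP[e0 e1] H]]]] := local_bound s.
    have ei : 1 <= eta^-1 by rewrite invf_ge1.
    exists (C + eta^-1); split; first by rewrite (le_trans ei)// lerDr ltW.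
    move=> eps x /andP[ep ee] xr.
    apply: le_trans (H eps _ x xr) _; last first.
      by rewrite ler_wpM2r ?lerDl ?(le_trans _ ei)// invr_ge0 exprn_ge0// ltW.
    rewrite ep (le_trans ee)// -[leRHS]invrK lef_pV2 ?posrE ?lerDr ?invr_gt0 ?ltW//.
    by rewrite addr_gt0// invr_gt0.
  have B0 : 0 < B by exact: lt_le_trans B1.
  split; first exact: le_trans BB.
  move=> eps x /andP[ep ee] xr.
  apply: le_trans (HB eps x _ xr) _; last first.
    by rewrite ler_wpM2r// invr_ge0 exprn_ge0// ltW.
  by rewrite ep (le_trans ee)// lef_pV2 ?posrE// (lt_le_trans B0).
by exists B => [|s eps x hs]; [have [] := HB [::]|have [_] := HB s hs; apply].
Qed.

(** Moment expansion at the larger scale [d]: the derivatives are O(eps^-b) near x_0 with a fixed [b],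
    hence O(d^(-2(n+1)b)), a loss that does not grow with the order. *)
Lemma two_scale_average m : exists2 C : R, 1 <= C & forall eps d x, 0 < d <= 1 -> 0 < eps <= C^-1 ->
  d ^+ (2 * n.+1) <= eps -> `|x - x0| <= r / 2 ->
  `|average (P eps) h d x - P eps x| <= C * d ^+ m.
Proof.
have [N HN] := two_scale_global_bound.
(* the excess 2 (n+1) b compensates eps^-b <= d^(-2(n+1)b), and k absorbs the global bound *)
pose m' := (m.+1 + 2 * n.+1 * b)%N; have m'0 : (0 < m')%N by [].
pose k := (2 * n.+1 * (N + n * m'))%N.
have [D D0 HD] := HN (n * m')%N; have [B B1 HB] := two_scale_local_bound (n * m').
have B0 : 0 < B by exact: lt_le_trans B1.
have [C C0 H] := moment_approx k m'0 (schwR_rapid sh) vh.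
pose E := B + D * (2 / r) ^+ k.
have E0 : 0 < E by rewrite ltr_wpDr// mulr_ge0 ?exprn_ge0 ?divr_ge0 ?ltW.
have CE : 0 <= C * E by rewrite mulr_ge0// ltW.
exists (B + C * E); first by rewrite (le_trans B1)// lerDl.
move=> eps d x d01 /andP[ep ee] de xr; have [d0 d1] := andP d01.
have eB : 0 < eps <= B^-1.
  by rewrite ep (le_trans ee)// lef_pV2 ?posrE ?lerDl// ltr_wpDr.
have e01 : 0 < eps <= 1.
  by rewrite ep; case/andP: eB => _ h1; rewrite (le_trans h1)// invf_le1.
rewrite -[X in _ - X]mulr1 -ih.
have dd : 0 <= d ^- (2 * n.+1 * b) by rewrite invr_ge0 exprn_ge0// ltW.
have dd1 : 1 <= d ^- (2 * n.+1 * b) by rewrite invf_ge1 ?exprn_gt0// exprn_ile1// ltW.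
apply: le_trans (H (P eps) x d (E * d ^- (2 * n.+1 * b)) (two_scale_smooth eps).1 d01 _) _.
  move=> s z hs.
  have A0 : 0 <= B * d ^- (2 * n.+1 * b) by rewrite mulr_ge0// ltW.
  have gA y : `|y - x0| <= r -> `|iter_partial s (P eps) y| <= B * d ^- (2 * n.+1 * b).
    move=> yr; apply: le_trans (HB s eps y hs eB yr) _.
    by rewrite ler_pM2l//; exact: expVr_scale.
  have gD y : `|iter_partial s (P eps) y| <= D * d ^- k.
    by apply: le_trans (HD s eps y hs e01) _; rewrite ler_pM2l//; exact: expVr_scale.
  apply: le_trans (weighted_bound z r0 d0 A0 (ltW D0) xr gA gD) _.
  apply: ler_wpM2r; first exact: oneDnorm_ge0.
  rewrite /E [leRHS]mulrDl; apply: lerD => //; rewrite ler_peMr//.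
  by rewrite mulr_ge0 ?exprn_ge0 ?divr_ge0 ?ltW.
have -> : C * d ^+ m' * (E * d ^- (2 * n.+1 * b)) = C * E * d ^+ m.+1.
  by rewrite /m' exprD; field; rewrite expf_neq0// gt_eqF.
apply: ler_pM => //; first by rewrite exprn_ge0// ltW.
  by rewrite lerDr ltW.
by rewrite exprS ler_piMl// exprn_ge0// ltW.
Qed.

(** Compare both nets with their common average.  The part with I g_b = 0 disappears in the limit, so the
    real part of the net, a difference of two such terms, is approximated by a single one. *)
Lemma two_scale m : exists2 C : R, 1 <= C & forall eps d x, 0 < d <= 1 -> 0 < eps <= C^-1 ->
  d ^+ (2 * n.+1) <= eps -> eps <= d ^+ n.+1 -> `|x - x0| <= r / 2 ->
  `|P eps x - convol wa (rescR h d) x| <= C * d ^+ m.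
Proof.
have [C1 C11 H1] := two_scale_average m.
have [C2 C20 H2] := swap_approx m ta sa sh va; have [C3 C30 H3] := swap_approx m tb sb sh vb.
exists (C1 + C2 + `|c| * C3).
  by rewrite (le_trans C11)// -addrA lerDl addr_ge0// mulr_ge0.
have C10 : 0 < C1 by exact: lt_le_trans C11.
move=> eps d x d01 /andP[ep ee] de ed xr; have [d0 d1] := andP d01.
have e1 : 0 < eps <= C1^-1.
  rewrite ep (le_trans ee)// lef_pV2 ?posrE//.
    by rewrite -addrA lerDl addr_ge0// mulr_ge0.
  by rewrite -addrA ltr_wpDr// addr_ge0// mulr_ge0.
have := H1 eps d x d01 e1 de xr.
have bs1 := convol_bsmooth ta (rescR_bsmooth eps (schwR_bsmooth sa)).
have bs2 := convol_bsmooth tb (rescR_bsmooth eps (schwR_bsmooth sb)).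
have [D D0 HD] := average_dominated (schwR_rapid sh).
have dom g : bsmooth g -> exists L, dominated (fun z => g (x - d *: z) * h z) L.
  move=> bg; have [B B0 HB] := bsmooth_dbound 0 bg; exists (B * D).
  apply: (HD (fun z => g (x - d *: z))); first exact: (@continuous_affine R n g x d (smoothRT_continuous (proj1 bg))).
  by move=> z; exact: (HB [::]).
have [L1 L1d] := dom _ bs1; have [L2 L2d] := dom _ bs2.
have -> : average (P eps) h d x = average (convol wa (rescR ga eps)) h d x +
    c * average (convol wb (rescR gb eps)) h d x.
  rewrite /average -(integral_rVZ _ L2d) -(integral_rVD L1d (dominatedZ c L2d)).
  by congr integral_rV; apply/funext => z; rewrite /P; ring.
rewrite (scale_swap x ta sa sh ep d0) (scale_swap x tb sb sh ep d0) => A1.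
have A2 := H2 eps d x ep d01 ed; have A3 := H3 eps d x ep d01 ed.
rewrite ia mulr1 in A2; rewrite ib mulr0 subr0 in A3.
move: A1 A2 A3; move: (average _ _ _ _) (average _ _ _ _) (P eps x) (convol _ _ _) => a3 a2 p v A1 A2 A3.
have -> : p - v = - (a2 + c * a3 - p) + (a2 - v) + c * a3 by ring.
rewrite !mulrDl (le_trans (ler_normD _ _))// lerD//.
  by rewrite (le_trans (ler_normD _ _))// normrN lerD.
by rewrite normrM -mulrA ler_wpM2l.
Qed.

End TwoScaleEstimate.

(** * Embedded nets of uniform growth are Cauchy *)

Section Chain.
Context {R : realType}.
Implicit Types (v : R -> R).

Lemma pow_2exp_small (a eps : R) : 0 < a -> 0 <= eps <= 2^-1 -> exists j : nat, eps ^+ (2 ^ j) <= a.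
Proof.
move=> a0 /andP[e0 e2]; pose j := Num.bound a^-1.
have jl : (j <= 2 ^ j)%N by rewrite ltnW// ltn_expl.
exists j; apply: (@le_trans _ _ (2^-1 ^+ (2 ^ j))).
  by apply: lerXn2r => //; rewrite nnegrE.
apply: (@le_trans _ _ (2^-1 ^+ j)).
  by apply: ler_wiXn2l => //; rewrite invf_le1// ler1n.
rewrite exprVn -[leRHS]invrK lef_pV2 ?posrE ?exprn_gt0 ?invr_gt0//.
have /ltW h : a^-1 < j%:R by apply: archi_boundP; rewrite invr_ge0 ltW.
by rewrite (le_trans h)// -natrX ler_nat ltnW// ltn_expl.
Qed.

(** Squaring eps repeatedly reaches every smaller eps', and the errors eps^m, eps^(2m), ... are summable. *)
Lemma chain_le v (eta C : R) (m : nat) : (0 < m)%N -> 0 < eta <= 2^-1 -> 0 <= C ->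
  (forall eps eps', 0 < eps <= eta -> eps ^+ 2 <= eps' <= eps -> `|v eps - v eps'| <= C * eps ^+ m) ->
  forall eps eps', 0 < eps' -> eps' <= eps -> eps <= eta -> `|v eps - v eps'| <= 2 * C * eps ^+ m.
Proof.
move=> m0 /andP[eta0 eta2] C0 H eps eps' e'0 ee ele.
have e0 : 0 < eps by exact: lt_le_trans ee.
have [j] : exists j : nat, eps ^+ (2 ^ j) <= eps'.
  by apply: pow_2exp_small => //; rewrite (ltW e0) (le_trans ele).
elim: j eps e0 ee ele => [|j IH] eps e0 ee ele hj.
  rewrite expr1 in hj; have -> : eps' = eps by apply/eqP; rewrite eq_le ee.
  by rewrite subrr normr0 !mulr_ge0// exprn_ge0// ltW.
have em0 : 0 <= C * eps ^+ m by rewrite mulr_ge0// exprn_ge0// ltW.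
(* one step if eps' is above the square, otherwise pass to the square *)
have [h|h] := leP (eps ^+ 2) eps'.
  apply: le_trans (H eps eps' _ _) _; rewrite ?e0 ?h//.
  by rewrite -mulrA ler_peMl// ler1n.
have e2 : eps ^+ 2 <= eps by rewrite expr2 ler_piMl ?(ltW e0)// (le_trans ele)// (le_trans eta2)// invf_le1// ler1n.
have A1 : `|v eps - v (eps ^+ 2)| <= C * eps ^+ m by apply: H; rewrite ?e0// lexx.
have A2 : `|v (eps ^+ 2) - v eps'| <= 2 * C * (eps ^+ 2) ^+ m.
  apply: IH; [by rewrite exprn_gt0|exact: ltW|exact: le_trans ele|].
  by rewrite -exprM -expnS.
have hm : eps ^+ m <= 2^-1.
  rewrite -(prednK m0) exprS (le_trans _ (le_trans ele eta2))// ler_piMr ?(ltW e0)//.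
  by rewrite exprn_ile1 ?(ltW e0)// (le_trans ele)// (le_trans eta2)// invf_le1// ler1n.
have -> : v eps - v eps' = (v eps - v (eps ^+ 2)) + (v (eps ^+ 2) - v eps') by rewrite addrA subrK.
apply: le_trans (ler_normD _ _) _.
have -> : 2 * C * eps ^+ m = C * eps ^+ m + C * eps ^+ m by ring.
apply: lerD => //; apply: le_trans A2 _.
rewrite exprAC expr2.
have -> : 2 * C * (eps ^+ m * eps ^+ m) = (2 * eps ^+ m) * (C * eps ^+ m) by ring.
by rewrite ler_piMl// -ler_pdivlMl// mulr1.
Qed.

Lemma root_scale (eps : R) (q : nat) : 0 < eps <= 1 -> exists2 d : R, 0 < d <= 1 & d ^+ q.+1 = eps.
Proof.
move=> /andP[e0 e1]; exists (eps `^ q.+1%:R^-1).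
  rewrite powR_gt0//=; apply: (@le_trans _ _ (eps `^ 0)); last by rewrite powRr0.
  by apply: ger_powR; rewrite ?e0// invr_ge0.
by rewrite -powR_mulrn ?powR_ge0// -powRrM mulVf// powRr1// ltW.
Qed.

End Chain.

Section CauchyNets.
Context {R : realType} {n : nat}.
Implicit Types (x y : 'rV[R]_n) (g h : 'rV[R]_n -> R) (w : ('rV[R]_n -> R) -> R).
Implicit Types (Omega V Q : set 'rV[R]_n) (u : @net R n) (rho : 'rV[R]_n -> R[i]).

(** For eps^2 <= eps' <= eps = d^(n+1) both members are within O(d^((n+1)m)) = O(eps^m) of the same net at
    scale [d]. *)
Lemma two_scale_cauchy Ka Kb wa wb ga gb h (c : R) (P : R -> 'rV[R]_n -> R) x0 (r : R) b : tame Ka wa -> tame Kb wb ->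
  schwR ga -> schwR gb -> schwR h -> vanishing_moments ga -> vanishing_moments gb ->
  vanishing_moments h -> integral_rV ga = 1 -> integral_rV gb = 0 -> integral_rV h = 1 ->
  (forall eps x, P eps x = convol wa (rescR ga eps) x + c * convol wb (rescR gb eps) x) -> 0 < r ->
  (forall s, eventually_le (fun eps x => `|iter_partial s (P eps) x|) [set y | `|y - x0| <= r]
     (fun eps => eps ^- b)) ->
  forall m, (0 < m)%N -> exists2 C : R, 1 <= C & forall eps eps' x, 0 < eps' -> eps' <= eps -> eps <= C^-1 ->
    `|x - x0| <= r / 2 -> `|P eps x - P eps' x| <= C * eps ^+ m.
Proof.
move=> ta tb sa sb sh va vb vh ia ib ih PE r0 loc m m0.
have eP : P = fun eps x => convol wa (rescR ga eps) x + c * convol wb (rescR gb eps) x.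
  by apply/funext => eps; apply/funext => x.
rewrite {}eP in loc *.
have [C C1 H] := two_scale ta tb sa sb sh va vb vh ia ib ih r0 loc (n.+1 * m).
have C0 : 0 < C by exact: lt_le_trans C1.
exists (4 * C); first by rewrite (le_trans C1)// ler_peMl ?(ltW C0)// ler1n.
move=> eps eps' x e'0 ee ele xr.
have -> : 4 * C = 2 * (2 * C) by ring.
have C40 : 0 < (4 * C)^-1 by rewrite invr_gt0 mulr_gt0.
have C42 : (4 * C)^-1 <= 2^-1.
  by rewrite lef_pV2 ?posrE ?mulr_gt0//; move: C1; lra.
have C4C : (4 * C)^-1 <= C^-1.
  by rewrite lef_pV2 ?posrE ?mulr_gt0// ler_peMl ?(ltW C0)// ler1n.
apply: (@chain_le _ (fun eps => convol wa (rescR ga eps) x + c * convol wb (rescR gb eps) x) (4 * C)^-1) ele => //.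
- by rewrite C40.
- by rewrite mulr_ge0// ltW.
move=> {}eps {}eps' {e'0 ee} /andP[e0 ele] /andP[h1 h2].
have e1 : eps <= 1 by rewrite (le_trans ele)// (le_trans C42)// invf_le1// ler1n.
have [d d01 de] := @root_scale _ eps n (introT andP (conj e0 e1)).
have [d0 d1] := andP d01.
have dde : d ^+ (2 * n.+1) = eps ^+ 2 by rewrite mulnC exprM de.
have e2 : eps ^+ 2 <= eps by rewrite expr2 ler_piMl// ltW.
have e'0 : 0 < eps' by apply: lt_le_trans h1; rewrite exprn_gt0.
have A1 := H eps d x d01 _ _ _ xr; have A2 := H eps' d x d01 _ _ _ xr.
rewrite dde de exprM de in A1 A2.
have {}A1 := A1 (introT andP (conj e0 (le_trans ele C4C))) e2 (lexx _).
have {}A2 := A2 (introT andP (conj e'0 (le_trans h2 (le_trans ele C4C)))) h1 h2.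
have -> : 2 * C * eps ^+ m = C * eps ^+ m + C * eps ^+ m by ring.
rewrite distrC in A2; move: A1 A2; set p1 := (X in `|X - _|); set p2 := (X in _ -> `|_ - X| <= _ -> _).
move: (convol wa (rescR h d) x) => t A1 A2.
by have := le_trans (ler_normD _ _) (lerD A1 A2); rewrite addrA subrK.
Qed.

Lemma eventually_le_add f f1 f2 Q (b : R -> R) :
  (forall eps x, 0 < eps <= 1 -> Q x -> f eps x <= f1 eps x + f2 eps x) ->
  eventually_le f1 Q b -> eventually_le f2 Q b -> eventually_le f Q b.
Proof.
move=> H [C [eta [C0 [/andP[e0 e1] h]]]] [C' [eta' [C'0 [/andP[e0' e1'] h']]]].
exists (C + C'), (Num.min eta eta'); split; first exact: addr_gt0.
split; first by rewrite lt_min e0 e0' ge_min e1.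
move=> eps; rewrite le_min => /and3P[ep h1 h2] x Qx.
apply: le_trans (H eps x _ Qx) _; first by rewrite ep (le_trans h1).
by rewrite mulrDl lerD//; [apply: h => //; rewrite ep|apply: h' => //; rewrite ep].
Qed.

(** Locally [u] is a convolution net up to a negligible one; its real and imaginary parts are combinations
    to which [two_scale_cauchy] applies, with the real part of the mollifier as averaging function. *)
Lemma local_cauchy Omega T u rho x0 (r0 : R) (b : nat) : open Omega -> mollifier rho ->
  Defs.distribution Omega T -> dist_embedding rho Omega T u -> Omega x0 -> 0 < r0 ->
  (forall s, eventually_le (fun eps x => `|iter_partial s (re_net u eps) x|) [set y | `|y - x0| <= r0] (fun eps => eps ^- b) /\
    eventually_le (fun eps x => `|iter_partial s (im_net u eps) x|) [set y | `|y - x0| <= r0] (fun eps => eps ^- b)) ->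
  exists2 r : R, 0 < r & forall m, (0 < m)%N -> exists2 C : R, 1 <= C & forall eps eps' x,
    0 < eps' -> eps' <= eps -> eps <= C^-1 -> `|x - x0| <= r ->
    `|re_net u eps x - re_net u eps' x| <= C * eps ^+ m /\
    `|im_net u eps x - im_net u eps' x| <= C * eps ^+ m.
Proof.
move=> oO mr dT [mu du] Ox r00 loc.
have [V [w [oV VO Vx cw ew]]] := local_representative oO dT Ox.
have ng := du V w oV VO cw ew.
have [r' r'0 rV] := open_cube oV Vx.
pose r := Num.min r0 r'; have r0r : 0 < r by rewrite lt_min r00.
have QV : [set y | `|y - x0| <= r] `<=` V.
  by move=> y /= h; apply: rV; rewrite (le_trans h)// ge_min lexx orbT.
have cQ : compact [set y | `|y - x0| <= r] by exact: compact_closed_cube.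
have nr := negligible_rneg oV ng cQ QV.
have [su _] := mu.
have [sc _] := conv_net_moderate oO oV cw (proj1 mr).
have [tchi _] := cutoffs_xget oO cw.
have [t1 t2] := test_function_tame (proj1 cw) tchi.
have [h1 h2 v1 v2 [i1 i2]] := mollifier_parts mr.
have cp := convolution_parts cw tchi erefl (proj1 (proj1 mr)).
set w1 := (fun g => Re (localize w _ g)) in t1 cp; set w2 := (fun g => Im (localize w _ g)) in t2 cp.
pose P1 eps x := Re (conv_net Omega w rho eps x); pose P2 eps x := Im (conv_net Omega w rho eps x).
have low : forall b, forall eps : R, 0 < eps <= 1 -> eps ^+ 0 <= eps ^- b.
  by move=> k eps /andP[e0 e1]; rewrite expr0 invf_ge1 ?exprn_gt0// exprn_ile1// ltW.
have weak f : eventually_le f [set y | `|y - x0| <= r] (fun eps => eps ^+ 0) ->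
    eventually_le f [set y | `|y - x0| <= r] (fun eps => eps ^- b).
  move=> [C [eta [C0 [/andP[e0 e1] H]]]]; exists C, eta; split=> //; split; first by rewrite e0.
  move=> eps /andP[ep ee] x Qx; apply: le_trans (H eps _ x Qx) _; first by rewrite ep.
  by rewrite ler_pM2l// low// ep (le_trans ee).
have r_r0 : [set y | `|y - x0| <= r] `<=` [set y | `|y - x0| <= r0].
  by move=> y /= h; rewrite (le_trans h)// ge_min lexx.
have loc1 s : eventually_le (fun eps x => `|iter_partial s (P1 eps) x|) [set y | `|y - x0| <= r] (fun eps => eps ^- b).
  apply: (eventually_le_add _ (eventually_le_sub r_r0 (loc s).1) (weak _ ((nr s).1 0%N))).
  move=> eps x e01 /QV Vx'.
  have -> : P1 eps = fun x => re_net u eps x - re_net (net_sub u (conv_net Omega w rho)) eps x.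
    by apply/funext => y; rewrite /re_net /net_sub cReD cReN opprB addrC subrK.
  have [_ ->//] := smoothR_sub_fun oV (smooth_sub VO (su eps e01)).1 (proj1 (proj1 (proj1 ng) eps e01)).
  exact: ler_normB.
have loc2 s : eventually_le (fun eps x => `|iter_partial s (P2 eps) x|) [set y | `|y - x0| <= r] (fun eps => eps ^- b).
  apply: (eventually_le_add _ (eventually_le_sub r_r0 (loc s).2) (weak _ ((nr s).2 0%N))).
  move=> eps x e01 /QV Vx'.
  have -> : P2 eps = fun x => im_net u eps x - im_net (net_sub u (conv_net Omega w rho)) eps x.
    by apply/funext => y; rewrite /im_net /net_sub cImD cImN opprB addrC subrK.
  have [_ ->//] := smoothR_sub_fun oV (smooth_sub VO (su eps e01)).2 (proj2 (proj1 (proj1 ng) eps e01)).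
  exact: ler_normB.
have E1 eps x : P1 eps x = convol w1 (rescR (fun x => Re (rho x)) eps) x + (-1) * convol w2 (rescR (fun x => Im (rho x)) eps) x.
  by rewrite mulN1r; have [] := cp eps x.
have E2 eps x : P2 eps x = convol w2 (rescR (fun x => Re (rho x)) eps) x + 1 * convol w1 (rescR (fun x => Im (rho x)) eps) x.
  by rewrite mul1r addrC; have [] := cp eps x.
have c1 := two_scale_cauchy t1 t2 h1 h2 h1 v1 v2 v1 i1 i2 i1 E1 r0r loc1.
have c2 := two_scale_cauchy t2 t1 h1 h2 h1 v1 v2 v1 i1 i2 i1 E2 r0r loc2.
exists (r / 2); first by rewrite divr_gt0.
move=> m m0; have [C1 C11 H1] := c1 m m0; have [C2 C21 H2] := c2 m m0.
have [C3 [eta3 [C30 [/andP[e30 e31] H3]]]] := (nr [::]).1 m.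
have [C4 [eta4 [C40 [/andP[e40 e41] H4]]]] := (nr [::]).2 m.
have C10 : 0 < C1 by exact: lt_le_trans C11.
have C20 : 0 < C2 by exact: lt_le_trans C21.
(* one constant that also encodes the thresholds for eps *)
pose C := C1 + C2 + 2 * C3 + 2 * C4 + eta3^-1 + eta4^-1.
have i30 : 0 < eta3^-1 by rewrite invr_gt0. have i40 : 0 < eta4^-1 by rewrite invr_gt0.
have C0 : 0 < C by rewrite /C; move: C10 C20 C30 C40 i30 i40; lra.
exists C; first by rewrite /C; move: C11 C20 C30 C40 i30 i40; lra.
move=> eps eps' x e'0 ee ele xr.
have e0 : 0 < eps by exact: lt_le_trans ee.
have leC (a : R) : 0 < a -> a <= C -> eps <= a^-1.
  by move=> a0 aC; rewrite (le_trans ele)// lef_pV2.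
have l1 : eps <= C1^-1 by apply: leC => //; rewrite /C; move: C10 C20 C30 C40 i30 i40; lra.
have l2 : eps <= C2^-1 by apply: leC => //; rewrite /C; move: C10 C20 C30 C40 i30 i40; lra.
have l3 : eps <= eta3.
  by rewrite -(invrK eta3); apply: leC => //; rewrite /C; move: C10 C20 C30 C40 i30 i40; lra.
have l4 : eps <= eta4.
  by rewrite -(invrK eta4); apply: leC => //; rewrite /C; move: C10 C20 C30 C40 i30 i40; lra.
have Qx : `|x - x0| <= r by rewrite (le_trans xr)// ler_piMr ?(ltW r0r)// invf_le1// ler1n.
have em : 0 <= eps ^+ m by rewrite exprn_ge0// ltW.
have emm : eps' ^+ m <= eps ^+ m by apply: lerXn2r => //; rewrite nnegrE ltW.
have fin (p p' q q' A B : R) : 0 < A -> 0 < B -> A + 2 * B <= C -> `|p - p'| <= A * eps ^+ m ->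
    `|q| <= B * eps ^+ m -> `|q'| <= B * eps' ^+ m -> `|(p + q) - (p' + q')| <= C * eps ^+ m.
  move=> A0 B0 AB hp hq hq'.
  have {}hq' : `|q'| <= B * eps ^+ m by rewrite (le_trans hq')// ler_pM2l.
  have -> : p + q - (p' + q') = (p - p') + (q - q') by ring.
  apply: (@le_trans _ _ ((A + 2 * B) * eps ^+ m)); last by rewrite ler_wpM2r.
  rewrite (le_trans (ler_normD _ _))// mulrDl lerD// (le_trans (ler_normB _ _))//.
  by rewrite mulr_natl mulr2n mulrDl lerD.
have dec1 e y : re_net u e y = P1 e y + re_net (net_sub u (conv_net Omega w rho)) e y.
  by rewrite /P1 /re_net /net_sub cReD cReN addrC subrK.
have dec2 e y : im_net u e y = P2 e y + im_net (net_sub u (conv_net Omega w rho)) e y.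
  by rewrite /P2 /im_net /net_sub cImD cImN addrC subrK.
rewrite !dec1 !dec2; split.
  apply: (fin _ _ _ _ C1 C3) => //; first by rewrite /C; move: C10 C20 C30 C40 i30 i40; lra.
  - exact: H1.
  - by apply: H3 => //; rewrite e0.
  - by apply: H3 => //; rewrite e'0 (le_trans ee).
apply: (fin _ _ _ _ C2 C4) => //; first by rewrite /C; move: C10 C20 C30 C40 i30 i40; lra.
- exact: H2.
- by apply: H4 => //; rewrite e0.
- by apply: H4 => //; rewrite e'0 (le_trans ee).
Qed.

End CauchyNets.

(** * Limits of sequences of smooth functions *)

Section SequenceLimits.
Context {R : realType}.
Implicit Types (a : nat -> R) (l C : R).

(** Pointwise convergence in the form in which limits of inequalities are taken. *)
Definition tends a l := forall tau : R, 0 < tau -> exists J, forall j, (J <= j)%N -> `|a j - l| <= tau.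

Lemma tends_le a l (b B : R) : tends a l -> (exists J, forall j, (J <= j)%N -> `|a j - b| <= B) ->
  `|l - b| <= B.
Proof.
move=> H [J HJ]; apply/ler_addgt0Pr => tau t0; have [J' H'] := H tau t0.
have := H' (maxn J J') (leq_maxr _ _); have := HJ (maxn J J') (leq_maxl _ _).
move: (a _) => c h1 h2; have -> : l - b = (c - b) - (c - l) by ring.
by rewrite (le_trans (ler_normB _ _))// lerD.
Qed.

Lemma dyadic_small (tau : R) : 0 < tau -> exists J : nat, forall j, (J <= j)%N -> 2^-1 ^+ j <= tau.
Proof.
have half01 : 0 <= (2 : R)^-1 <= 2^-1 by rewrite invr_ge0 ler0n lexx.
move=> t0; have [J HJ] := pow_2exp_small t0 half01.
exists (2 ^ J)%N => j Jj; apply: le_trans HJ.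
by apply: ler_wiXn2l => //; rewrite invf_le1// ler1n.
Qed.

Lemma telescope_le a C J : 0 <= C -> (forall j, (J <= j)%N -> `|a j.+1 - a j| <= C * 2^-1 ^+ j) ->
  forall j k, (J <= j)%N -> `|a (j + k)%N - a j| <= 2 * C * (2^-1 ^+ j - 2^-1 ^+ (j + k)).
Proof.
move=> C0 H j k Jj; elim: k => [|k IH]; first by rewrite addn0 !subrr normr0 mulr0.
rewrite addnS -(subrK (a (j + k)%N) (a (j + k).+1)) -addrA (le_trans (ler_normD _ _))//.
apply: le_trans (lerD (H _ (leq_trans Jj (leq_addr k j))) IH) _.
rewrite exprS le_eqVlt; apply/orP; left; apply/eqP.
by field.
Qed.

Lemma tends_rate a l C J : 0 <= C -> (forall j, (J <= j)%N -> `|a j.+1 - a j| <= C * 2^-1 ^+ j) ->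
  tends a l -> forall j, (J <= j)%N -> `|l - a j| <= 2 * C * 2^-1 ^+ j.
Proof.
move=> C0 H al j Jj; apply: (tends_le al); exists j => k jk.
rewrite -(subnKC jk) (le_trans (telescope_le C0 H _ Jj))// ler_wpM2l ?mulr_ge0//.
by rewrite gerBl exprn_ge0.
Qed.

(** The limit is the supremum of the sequence lowered by its own error bound. *)
Lemma geometric_limit a C J : 0 <= C -> (forall j, (J <= j)%N -> `|a j.+1 - a j| <= C * 2^-1 ^+ j) ->
  exists l, tends a l.
Proof.
move=> C0 H; have T := telescope_le C0 H.
(* nondecreasing, and at most a k + 2 C 2^-k for every k *)
pose b j := a (J + j)%N - 2 * C * 2^-1 ^+ (J + j).
pose A := [set b j | j in setT].
have pw j : 0 <= 2 * C * 2^-1 ^+ j :> R by rewrite !mulr_ge0// exprn_ge0.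
have ub k j : b j <= a (J + k)%N + 2 * C * 2^-1 ^+ (J + k).
  rewrite /b; have [jk|kj] := leqP j k.
    have := T (J + j)%N (k - j)%N (leq_addr _ _); rewrite -addnA subnKC//.
    by rewrite ler_norml mulrBr => /andP[h1 h2]; move: (pw (J + k)%N) (pw (J + j)%N) h1 h2; lra.
  have := T (J + k)%N (j - k)%N (leq_addr _ _); rewrite -addnA subnKC ?(ltnW kj)//.
  by rewrite ler_norml mulrBr => /andP[h1 h2]; move: (pw (J + k)%N) (pw (J + j)%N) h1 h2; lra.
have hs : has_sup A.
  by split; [exists (b 0%N), 0%N|exists (a (J + 0)%N + 2 * C * 2^-1 ^+ (J + 0)) => _ [j _ <-]; exact: ub].
exists (sup A) => tau t0.
have t1 : 0 < tau / (2 * C + 1) by rewrite divr_gt0// ltr_wpDl// mulr_ge0.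
have [J' HJ'] := dyadic_small t1.
exists (maxn J J') => j; rewrite geq_max => /andP[Jj J'j].
have h1 : a j - 2 * C * 2^-1 ^+ j <= sup A.
  by apply: ub_le_sup; [exact: proj2 hs|exists (j - J)%N => //; rewrite /b subnKC].
have h2 : sup A <= a j + 2 * C * 2^-1 ^+ j.
  by apply: ge_sup; [exact: proj1 hs|move=> _ [k _ <-]; rewrite -(subnKC Jj); exact: ub].
have h3 : 2 * C * 2^-1 ^+ j <= tau.
  apply: le_trans (_ : (2 * C + 1) * (tau / (2 * C + 1)) <= _); last first.
    by rewrite mulrC divfK// gt_eqF// ltr_wpDl// mulr_ge0.
  by apply: ler_pM; rewrite ?mulr_ge0 ?exprn_ge0// ?lerDl//; exact: HJ'.
by rewrite ler_norml; apply/andP; split; move: h1 h2 h3; lra.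
Qed.

End SequenceLimits.

Section LimitFamily.
Context {R : realType} {n : nat}.
Implicit Types (x y : 'rV[R]_n) (v : nat -> 'rV[R]_n -> R) (Omega Q : set 'rV[R]_n).
Local Notation e i := (delta_mx 0 i : 'rV[R]_n).

(** The limits of all derivatives satisfy the quadratic estimates of the approximants, whose constants are
    locally uniform, so [smoothR_quad_family] applies. *)
Lemma limit_family Omega v : open Omega -> (forall j, smoothR Omega (v j)) ->
  (forall x, Omega x -> exists2 r : R, 0 < r & (forall y, `|y - x| <= r -> Omega y) /\
     forall s, exists C J, 0 <= C /\ forall j y, (J <= j)%N -> `|y - x| <= r ->
       `|iter_partial s (v j.+1) y - iter_partial s (v j) y| <= C * 2^-1 ^+ j) ->
  exists2 f, smoothR Omega f &
    forall s x, Omega x -> tends (fun j => iter_partial s (v j) x) (iter_partial s f x).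
Proof.
move=> oO sv H.
have ex s x : exists l, Omega x -> tends (fun j => iter_partial s (v j) x) l.
  have [Ox|Ox] := pselect (Omega x); last by exists 0.
  have [r r0 [rO Hr]] := H x Ox; have [C [J [C0 HC]]] := Hr s.
  have [|l hl] := @geometric_limit _ (fun j => iter_partial s (v j) x) C J C0; last by exists l.
  by move=> j Jj; apply: HC => //; rewrite subrr normr0 ltW.
have [G HG] := choice (fun p : seq 'I_n * 'rV[R]_n => ex p.1 p.2).
have TG s x : Omega x -> tends (fun j => iter_partial s (v j) x) (G (s, x)) by exact: (HG (s, x)).
have [sf df] : smoothR Omega (fun x => G ([::], x)) /\
    forall s x, Omega x -> iter_partial s (fun x => G ([::], x)) x = G (s, x).
  apply: (@smoothR_quad_family _ _ Omega (fun s x => G (s, x))) => // s x Ox.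
  have [r r0 [rO Hr]] := H x Ox.
  have cQ : compact [set y | `|y - x| <= r] by exact: compact_closed_cube.
  have [B B0 HB] : exists2 B : R, 0 < B & forall s', (size s' <= (size s).+2)%N ->
      exists J, forall j y, (J <= j)%N -> `|y - x| <= r -> `|iter_partial s' (v j) y| <= B.
    apply: short_seqs_bound => [s'|s' B B' BB [J HJ]]; last first.
      by exists J => j y Jj yr; apply: le_trans BB; exact: HJ.
    have [C [J [C0 HC]]] := Hr s'.
    have [B B0 HB] := compact_dbound (size s') oO cQ rO (sv J).
    exists (B + 2 * C), J => j y Jj yr.
    have T := telescope_le C0 (fun j Jj => HC j y Jj yr) (j - J)%N (leqnn J).
    rewrite subnKC// in T; rewrite -(subrK (iter_partial s' (v J) y) (iter_partial s' (v j) y)).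
    rewrite (le_trans (ler_normD _ _))// addrC lerD//; first exact: HB.
    rewrite (le_trans T)// ler_piMr ?mulr_ge0//.
    apply: le_trans (_ : 2^-1 ^+ J <= _); first by rewrite gerBl exprn_ge0.
    by rewrite exprn_ile1// invf_le1// ler1n.
  exists B, (r / 2); split; first by rewrite divr_gt0.
  move=> y yr.
  have r2 : r / 2 <= r by rewrite ler_piMr ?(ltW r0)// invf_le1// ler1n.
  have yr' : `|y - x| <= r by exact: le_trans yr r2.
  have Oy := rO y yr'.
  split.
    rewrite -[G _]subr0; apply: (tends_le (TG s y Oy)).
    have [J HJ] := HB s (leqW (leqnSn _)); exists J => j Jj; rewrite subr0; exact: HJ.
  move=> i h hr.
  have seg t : 0 <= t <= 1 -> `|y + (t * h) *: e i - x| <= r.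
    move=> /andP[t0 t1]; rewrite addrAC (le_trans (ler_normD _ _))// (splitr r) lerD//.
    apply: le_trans (norm_scale_delta _ _) _; rewrite normrM ger0_norm//.
    by apply: le_trans hr; rewrite ler_piMl.
  have Oyh : Omega (y + h *: e i) by apply: rO; have := seg 1; rewrite mul1r ler01 lexx; apply.
  have [J HJ] := HB [:: i, i & s] (leqnn _).
  have qj j : (J <= j)%N -> `|iter_partial s (v j) (y + h *: e i) - iter_partial s (v j) y -
      h * iter_partial (i :: s) (v j) y| <= B * h ^+ 2.
    move=> Jj; apply: (@quad_line _ _ Omega); first exact: smoothR_iter.
      by move=> t /seg /rO.
    by move=> t /seg tr; rewrite -iter_partial_cat; exact: HJ.
  apply/ler_addgt0Pr => tau t0.
  have h0 : 0 < 2 + `|h| by rewrite ltr_wpDr.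
  have t1 : 0 < tau / (2 + `|h|) by rewrite divr_gt0.
  have [J1 H1] := TG s (y + h *: e i) Oyh _ t1.
  have [J2 H2] := TG s y Oy _ t1.
  have [J3 H3] := TG (i :: s) y Oy _ t1.
  (* an index beyond all four thresholds *)
  pose j := (J + J1 + J2 + J3)%N.
  have := qj j (leq_trans (leq_addr _ _) (leq_trans (leq_addr _ _) (leq_addr _ _))).
  have {}H1 := H1 j (leq_trans (leq_addl J J1) (leq_trans (leq_addr _ _) (leq_addr _ _))).
  have {}H2 := H2 j (leq_trans (leq_addl _ J2) (leq_addr _ _)).
  have {}H3 := H3 j (leq_addl _ J3).
  move: H1 H2 H3.
  move: (iter_partial s (v j) (y + h *: e i)) (iter_partial s (v j) y) (iter_partial (i :: s) (v j) y).
  move: (G (s, y + h *: e i)) (G (s, y)) (G (i :: s, y)) => g1 g0 g' a1 a0 a' H1 H2 H3 qq.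
  have -> : g1 - g0 - h * g' = (a1 - a0 - h * a') - (a1 - g1) + (a0 - g0) + h * (a' - g') by ring.
  have -> : B * h ^+ 2 + tau = B * h ^+ 2 + tau / (2 + `|h|) + tau / (2 + `|h|) + `|h| * (tau / (2 + `|h|)).
    by field; rewrite gt_eqF.
  rewrite (le_trans (ler_normD _ _))// lerD//; last by rewrite normrM ler_wpM2l.
  rewrite (le_trans (ler_normD _ _))// lerD//.
  by rewrite (le_trans (ler_normB _ _))// lerD.
exists (fun x => G ([::], x)) => // s x Ox; rewrite df//; exact: TG.
Qed.

End LimitFamily.

(** * Limits of Cauchy nets *)

Section NetLimit.
Context {R : realType} {n : nat}.
Implicit Types (x y : 'rV[R]_n) (v : R -> 'rV[R]_n -> R) (Omega Q : set 'rV[R]_n).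

Definition cauchy_on Q v := forall m, (0 < m)%N -> exists2 C : R, 1 <= C & forall eps eps' x,
  0 < eps' -> eps' <= eps -> eps <= C^-1 -> Q x -> `|v eps x - v eps' x| <= C * eps ^+ m.

Lemma rneg_bound_near v Q :
  (forall m : nat, exists2 C : R, 1 <= C & forall eps x, 0 < eps <= C^-1 -> Q x -> `|v eps x| <= C * eps ^+ m) ->
  rneg v [::] Q.
Proof.
move=> H m; have [C C1 HC] := H m; have C0 : 0 < C by exact: lt_le_trans C1.
exists C, C^-1; split=> //; split; first by rewrite invr_gt0 C0 invf_le1.
by move=> eps ee x Qx; exact: HC.
Qed.

Lemma half01 : 0 < (2 : R)^-1 <= 1.
Proof. by rewrite invr_gt0 ltr0n invf_le1// ler1n. Qed.

Lemma half_pow j : 0 < (2 : R)^-1 ^+ j <= 1.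
Proof.
have /andP[h0 h1] := half01.
by rewrite exprn_gt0 //= exprn_ile1// ltW.
Qed.

(** Dyadic increments of a Cauchy net form a negligible net, so their derivatives of every order are summable
    along 2^-j. *)
Lemma half_net_rneg Omega v c (r : R) : open Omega -> 0 < r -> (forall y, `|y - c| <= r -> Omega y) ->
  (forall eps, 0 < eps <= 1 -> smoothR Omega (v eps)) ->
  rmod v [set y | `|y - c| <= r] -> cauchy_on [set y | `|y - c| <= r] v ->
  forall s, rneg (fun eps y => v eps y - v (2^-1 * eps) y) s [set y | `|y - c| <= r].
Proof.
move=> oO r0 rO sv md ch; have /andP[h0 h1] := half01.
have half (eps : R) : 0 < eps <= 1 -> 0 < 2^-1 * eps <= 1.
  by move=> /andP[e0 e1]; rewrite mulr_gt0//= (mulr_ile1 (ltW h0) (ltW e0)).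
have sub eps (e01 : 0 < eps <= 1) := smoothR_sub_fun oO (sv eps e01) (sv _ (half _ e01)).
apply: (rneg_all r0 rO).
- by move=> eps /sub[].
- move=> s; have [m [C [eta [C0 [/andP[e0 e1] H]]]]] := md s.
  exists m, (C + C * 2 ^+ m), eta; split; first by rewrite addr_gt0// mulr_gt0// exprn_gt0.
  split; first by rewrite e0.
  move=> eps /andP[ep ee] x Qx.
  have [_ ->] := sub eps (introT andP (conj ep (le_trans ee e1))); last exact: rO.
  rewrite (le_trans (ler_normB _ _))// mulrDl lerD//.
    by apply: H => //; rewrite ep.
  have -> : C * 2 ^+ m * eps ^- m = C * (2^-1 * eps) ^- m.
    by rewrite exprMn exprVn; field; rewrite !expf_neq0// gt_eqF.
  by apply: H => //; rewrite mulr_gt0//= (le_trans _ ee)// ler_piMl// ltW.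
- apply: rneg_bound_near => m; have [C C1 H] := ch m.+1 (ltn0Sn m).
  have C0 : 0 < C by exact: lt_le_trans C1.
  exists C; rewrite // => eps x /andP[ep ee] Qx.
  apply: le_trans (H _ _ _ _ _ ee Qx) _; first by rewrite mulr_gt0.
    by rewrite ler_piMl// ltW.
  rewrite ler_pM2l// exprS ler_piMl ?exprn_ge0 ?(ltW ep)//.
  by rewrite (le_trans ee)// invf_le1.
Qed.

Lemma net_limit_real Omega v : open Omega -> (forall eps, 0 < eps <= 1 -> smoothR Omega (v eps)) ->
  (forall x, Omega x -> exists2 r : R, 0 < r & [/\ forall y, `|y - x| <= r -> Omega y,
     rmod v [set y | `|y - x| <= r] & cauchy_on [set y | `|y - x| <= r] v]) ->
  exists f, [/\ smoothR Omega f,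
    (forall s x, Omega x -> tends (fun j => iter_partial s (v (2^-1 ^+ j)) x) (iter_partial s f x)) &
    forall x (r : R), (forall y, `|y - x| <= r -> Omega y) -> cauchy_on [set y | `|y - x| <= r] v ->
      rneg (fun eps y => v eps y - f y) [::] [set y | `|y - x| <= r]].
Proof.
move=> oO sv H.
have [f sf tf] : exists2 f, smoothR Omega f &
    forall s x, Omega x -> tends (fun j => iter_partial s (v (2^-1 ^+ j)) x) (iter_partial s f x).
  apply: (limit_family (v := fun j => v (2^-1 ^+ j)) oO) => [j|x Ox]; first exact: sv (half_pow j).
  have [r r0 [rO md ch]] := H x Ox; exists r => //; split=> // s.
  have [C [eta [C0 [/andP[e0 e1] HC]]]] := half_net_rneg oO r0 rO sv md ch s 1%N.
  have [J HJ] := dyadic_small e0; exists C, J; split; first exact: ltW.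
  move=> j y Jj yr; rewrite distrC.
  have := HC (2^-1 ^+ j); rewrite expr1.
  have [_ d] := smoothR_sub_fun oO (sv _ (half_pow j)) (sv _ (half_pow j.+1)).
  move=> /(_ _ y yr); rewrite -exprS d; last exact: rO.
  by apply; rewrite HJ// andbT; case/andP: (half_pow j).
exists f; split=> // x r rO ch.
apply: rneg_bound_near => m; have [C C1 HC] := ch m.+1 (ltn0Sn m).
have C0 : 0 < C by exact: lt_le_trans C1.
exists C => // eps y /andP[ep ee] yr.
rewrite distrC; apply: (tends_le (tf [::] y (rO y yr))).
have [J HJ] := dyadic_small ep; exists J => j Jj; rewrite distrC.
apply: le_trans (HC eps (2^-1 ^+ j) y _ (HJ j Jj) ee yr) _.
  by case/andP: (half_pow j).
rewrite ler_pM2l// exprS ler_piMl ?exprn_ge0 ?(ltW ep)//.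
by rewrite (le_trans ee)// invf_le1.
Qed.

End NetLimit.

(** * Coefficients of bounded polynomials *)

Section CoefficientBound.
Context {R : realType}.
Implicit Types (P : {poly R}).

Lemma coef_prod_XsubC_le (I : Type) (s : seq I) (t : I -> R) p : (forall k, `|t k| <= 1) ->
  `|(\prod_(k <- s) ('X - (t k)%:P))`_p| <= 2 ^+ size s.
Proof.
move=> t1; elim: s p => [|k s IH] p.
  by rewrite big_nil coef1; case: (p == 0%N); rewrite ?normr1 ?normr0//= ler01.
rewrite big_cons mulrBl coefB coefXM coefCM (le_trans (ler_normB _ _))//= exprS mulr_natl mulr2n.
apply: lerD; first by case: (p == 0%N); rewrite ?normr0 ?exprn_ge0//; exact: IH.
by rewrite normrM -[leRHS]mul1r ler_pM.
Qed.

(** Denominators of the Lagrange basis at equidistant nodes. *)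
Lemma prod_dist_nat (q j : nat) : (j < q)%N ->
  \prod_(0 <= k < q | k != j) `|j%:R - k%:R| = (j`! * (q - j.+1)`!)%:R :> R.
Proof.
move=> jq; rewrite (big_cat_nat (n := j)) //=; last exact: ltnW.
have e1 : forall m, \prod_(0 <= k < m) `|m%:R - k%:R| = m`!%:R :> R.
  elim=> [|m IH]; first by rewrite big_geq.
  rewrite big_nat_recl// subr0 factS natrM -IH ger0_norm//; congr (_ * _).
  by apply: eq_bigr => k _; congr (`| _ |); rewrite -[m.+1%:R]natr1 -[k.+1%:R]natr1 opprD addrACA subrr addr0.
have e2 : forall m, \prod_(0 <= k < m) `|j%:R - (k + j.+1)%:R| = m`!%:R :> R.
  elim=> [|m IH]; first by rewrite big_geq.
  rewrite big_nat_recr// IH factS mulnC natrM; congr (_ * _).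
  by rewrite addnS -addSn natrD opprD addrCA subrr addr0 normrN ger0_norm.
rewrite natrM; congr (_ * _).
  rewrite -(e1 j) big_nat_cond [RHS]big_nat_cond; apply: eq_bigl => k.
  by rewrite andbT; case: (ltnP k j) => [kj|]; rewrite ?andbF// (ltn_eqF kj) andbT.
rewrite big_ltn_cond// eqxx /= -(e2 (q - j.+1)%N) -[in LHS](add0n j.+1) big_addn.
rewrite big_nat_cond [RHS]big_nat_cond; apply: eq_bigl => k.
by rewrite andbT gtn_eqF ?andbT// leq_addl.
Qed.

Lemma count_neq_index (q j : nat) : (j < q)%N ->
  count (fun k => k != j) (index_iota 0 q) = q.-1.
Proof.
move=> jq; have := count_predC (pred1 j) (index_iota 0 q).
rewrite count_uniq_mem ?iota_uniq// mem_index_iota leq0n jq size_iota subn0 => h.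
by rewrite -[in RHS]h.
Qed.

(** Both sides agree at [q] points and have degree less than [q]. *)
Lemma lagrange_expansion (q : nat) (t : nat -> R) P : (size P <= q)%N ->
  (forall j k, (j < q)%N -> (k < q)%N -> t j = t k -> j = k) ->
  P = \sum_(0 <= j < q) (P.[t j] / \prod_(0 <= k < q | k != j) (t j - t k)) *:
        \prod_(0 <= k < q | k != j) ('X - (t k)%:P).
Proof.
move=> sP tI; apply/eqP; rewrite -subr_eq0; set D := _ - _; apply/eqP.
have D0 : all (root D) [seq t j | j <- iota 0 q].
  apply/allP => z /mapP[j]; rewrite mem_iota add0n => /andP[_ jq] ->.
  rewrite /root /D hornerD hornerN horner_sum (bigD1_seq j) ?mem_index_iota ?iota_uniq//=.
  rewrite hornerZ horner_prod [X in _ - (_ + X)]big1_seq ?addr0 => [|k /andP[kj]]; last first.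
    rewrite mem_index_iota => /andP[_ kq]; rewrite hornerZ horner_prod.
    rewrite [X in _ * X](_ : _ = 0) ?mulr0//; apply/eqP; rewrite prodf_seq_eq0.
    by apply/hasP; exists j; rewrite ?mem_index_iota// eq_sym kj hornerXsubC subrr eqxx.
  rewrite -mulrA [X in _ * X](_ : _ = 1) ?mulr1 ?subrr//.
  under [X in _ * X]eq_bigr do rewrite hornerXsubC.
  rewrite mulVf// prodf_seq_neq0; apply/allP => k; rewrite mem_index_iota => /andP[_ kq].
  by apply/implyP => kj; rewrite subr_eq0; apply: contra_neq kj => /esym /(tI _ _ kq jq).
apply: contraTeq D0 => D0; apply/negP => D1.
have := max_poly_roots D0 D1; rewrite size_map size_iota.
have -> : uniq [seq t j | j <- iota 0 q].
  rewrite map_inj_in_uniq ?iota_uniq// => j k; rewrite !mem_iota !add0n => /andP[_ jq] /andP[_ kq].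
  exact: tI.
move=> /(_ isT); rewrite ltnNge => /negP; apply.
apply: leq_trans (size_polyD _ _) _; rewrite geq_max sP size_polyN.
apply: leq_trans (size_sum _ _ _) _; apply/bigmax_leqP_seq => j.
rewrite mem_index_iota => /andP[_ jq] _; apply: leq_trans (size_scale_leq _ _) _.
rewrite -big_filter size_prod_XsubC size_filter.
by rewrite count_neq_index// prednK// (leq_ltn_trans _ jq).
Qed.

(** Lagrange interpolation at the nodes j / q: the numerators have coefficients at most 2^q, and the
    denominators are at least (2e)^-q because q^q <= e^q q! and j! (q-1-j)! >= (q-1)! / 2^(q-1). *)
Lemma poly_coef_bound : exists2 k : R, 1 <= k & forall q P (S : R) p, (0 < q)%N -> (size P <= q)%N ->
  (forall t, 0 <= t <= 1 -> `|P.[t]| <= S) -> `|P`_p| <= k ^+ q * S.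
Proof.
have e1 : 1 <= expR 1 :> R by rewrite -expR0 ler_expR.
exists (8 * expR 1); first by move: e1; lra.
move=> q P S p q0 sP PS.
have S0 : 0 <= S by rewrite (le_trans _ (PS 0 _))// lexx ler01.
have qR : 0 < q%:R :> R by rewrite ltr0n.
pose t k : R := if (k < q)%N then k%:R / q%:R else 0.
have t01 k : 0 <= t k <= 1.
  rewrite /t; case: ifP => kq; last by rewrite lexx ler01.
  by rewrite divr_ge0//= ler_pdivrMr// mul1r ler_nat ltnW.
have tn k : `|t k| <= 1 by have /andP[h1 h2] := t01 k; rewrite ger0_norm.
have tI j k : (j < q)%N -> (k < q)%N -> t j = t k -> j = k.
  move=> jq kq; rewrite /t jq kq => /mulIf => /(_ (lt0r_neq0 _)); rewrite invr_gt0 => /(_ qR) /eqP.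
  by rewrite eqr_nat => /eqP.
rewrite (lagrange_expansion sP tI) coef_sum.
apply: (@le_trans _ _ (\sum_(0 <= j < q) 4 ^+ q * expR 1 ^+ q * S)); last first.
  rewrite sumr_const_nat subn0 -[leLHS]mulr_natl mulrA.
  have -> : (8 * expR 1) ^+ q = 2 ^+ q * (4 ^+ q * expR 1 ^+ q) :> R by rewrite -!exprMn; congr (_ ^+ _); ring.
  apply: ler_wpM2r => //; apply: ler_wpM2r; first by rewrite mulr_ge0// exprn_ge0// (le_trans _ e1).
  by rewrite -natrX ler_nat ltnW// ltn_expl.
rewrite (le_trans (ler_norm_sum _ _ _))// big_nat_cond [leRHS]big_nat_cond.
apply: ler_sum => j /andP[/andP[_ jq] _].
rewrite coefZ !normrM normfV.
have c1 : `|(\prod_(0 <= k < q | k != j) ('X - (t k)%:P))`_p| <= 2 ^+ q.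
  rewrite -big_filter (le_trans (coef_prod_XsubC_le _ _ tn))// ler_eXn2l ?ltr1n//.
  by rewrite size_filter (leq_trans (count_size _ _))// size_iota subn0.
have c2 : `|\prod_(0 <= k < q | k != j) (t j - t k)|^-1 <= 2 ^+ q * expR 1 ^+ q.
  have -> : `|\prod_(0 <= k < q | k != j) (t j - t k)| = q%:R ^- q.-1 * (j`! * (q - j.+1)`!)%:R.
    rewrite -prod_dist_nat// normr_prod.
    have cnt : (\prod_(0 <= k < q | k != j) q%:R^-1 = q%:R ^- q.-1 :> R).
      rewrite -big_filter big_const_seq count_predT iter_mulr_1 -exprVn size_filter; congr (_ ^+ _).
      exact: count_neq_index.
    rewrite -cnt -big_split /= big_nat_cond [RHS]big_nat_cond; apply: eq_bigr => k /andP[/andP[_ kq] _].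
    by rewrite /t jq kq -mulrBl normrM mulrC [X in X * _]ger0_norm// invr_ge0 ltW.
  have f0 : 0 < (j`! * (q - j.+1)`!)%:R :> R by rewrite ltr0n muln_gt0 !fact_gt0.
  rewrite invfM invrK.
  rewrite ler_pdivrMr//.
  have bn : (q.-1`! <= 2 ^ q.-1 * (j`! * (q - j.+1)`!))%N.
    have jq' : (j <= q.-1)%N by rewrite -ltnS prednK.
    have := bin_fact jq'; rewrite -subn1 -subnDA add1n subn1 => <-.
    rewrite leq_mul2r; apply/orP; right.
    rewrite -[2%N]/(1 + 1)%N Pascal (bigD1 (Ordinal (jq' : (j < q.-1.+1)%N)))//= !exp1n !muln1.
    by rewrite leq_addr.
  have ge : q%:R ^+ q / q`!%:R <= expR 1 ^+ q :> R.
    by rewrite -expRM_natl mulr1; exact: expR_ge_pow.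
  have qf : q`!%:R = q%:R * q.-1`!%:R :> R by rewrite -natrM; congr (_%:R); case: (q) q0.
  have qm : q%:R ^+ q.-1 <= expR 1 ^+ q * q.-1`!%:R :> R.
    have fq : 0 < q`!%:R :> R by rewrite ltr0n fact_gt0.
    have qq : q%:R ^+ q = q%:R * q%:R ^+ q.-1 :> R by rewrite -exprS prednK.
    by move: ge; rewrite ler_pdivrMr// qf qq mulrCA ler_pM2l.
  apply: le_trans qm _; rewrite [2 ^+ q * _]mulrC -mulrA ler_wpM2l ?exprn_ge0 ?expR_ge0//.
  rewrite -natrX -natrM ler_nat (leq_trans bn)// leq_mul2r leq_exp2l// leq_pred orbT//.
have -> : 4 ^+ q * expR 1 ^+ q * S = S * (2 ^+ q * expR 1 ^+ q) * 2 ^+ q.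
  have -> : 4 ^+ q = 2 ^+ q * 2 ^+ q :> R by rewrite -exprMn; congr (_ ^+ _); ring.
  ring.
apply: ler_pM => //.
by apply: ler_pM => //; exact: PS.
Qed.

End CoefficientBound.

(** * Weight sequences and Gorny's inequality *)

Section Weights.
Context {R : realType}.
Variable M : nat -> R.
Hypothesis wM : weight_sequence M.

Lemma weight_gt0 p : 0 < M p. Proof. by have [[]] := wM. Qed.

(** Logarithmic convexity says that the ratios M_(p+1) / M_p increase. *)
Lemma weight_ratio_le p q : (p <= q)%N -> M q / M q.+1 <= M p / M p.+1.
Proof.
move=> /subnKC <-; elim: (q - p)%N => [|k IH]; first by rewrite addn0.
rewrite addnS (le_trans _ IH)// ler_pdivrMr ?weight_gt0// mulrAC ler_pdivlMr ?weight_gt0//.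
by rewrite -expr2; have [_ lc _ _] := wM; exact: lc.
Qed.

Lemma weight_mul_le s p : M s * M p <= M (s + p)%N.
Proof.
have [[_ M0] _ _ _] := wM.
elim: p => [|p IH]; first by rewrite addn0 M0 mulr1.
have := weight_ratio_le (leq_addl s p); rewrite addnS.
have := weight_gt0 p; have := weight_gt0 p.+1; have := weight_gt0 (s + p)%N; have := weight_gt0 (s + p).+1.
have := weight_gt0 s; move: IH.
move: (M s) (M p) (M p.+1) (M (s + p)%N) (M (s + p).+1) => a b c d e abd a0 e0 d0 c0 b0.
rewrite ler_pdivrMr// mulrAC ler_pdivlMr// => dce.
rewrite -(ler_pM2r d0) (le_trans (_ : _ <= a * (b * e)))//.
  by rewrite -mulrA ler_pM2l// mulrC.
by rewrite mulrA [e * d]mulrC ler_pM2r.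
Qed.

(** Moderate growth, iterated [N] times. *)
Lemma weight_iter_le : exists2 A : R, 1 <= A & forall N s p,
  M (s + N * p)%N <= A ^+ (N * (s + N * p).+1) * (M s * M p ^+ N).
Proof.
have [_ _ [A [H [A0 [H0 HM]]]] _] := wM.
(* a single base that dominates both A and H *)
pose B := (1 + A) * (1 + H).
have A1 : 1 <= 1 + A by rewrite lerDl ltW. have H1 : 1 <= 1 + H by rewrite lerDl ltW.
have B1 : 1 <= B by rewrite -[leLHS]mulr1 ler_pM.
have AB : A <= B by rewrite -[leLHS]mulr1 ler_pM ?ler01 ?(ltW A0)// lerDr.
have HB : H <= B by rewrite -[leLHS]mul1r ler_pM ?ler01 ?(ltW H0)// lerDr.
have B0 : 0 < B by exact: lt_le_trans B1.
exists B => // N s p; elim: N => [|N IH]; first by rewrite !mul0n addn0 !expr0 mulr1 mul1r.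
have -> : (s + N.+1 * p = p + (s + N * p))%N by rewrite mulSn; ring.
have := HM (p + (s + N * p))%N p (leq_addr _ _); rewrite addKn.
set t := (s + N * p)%N in IH * => h; apply: le_trans h _.
have c1 : A * H ^+ (p + t) <= B ^+ (p + t).+1.
  rewrite exprS; apply: ler_pM => //; rewrite ?(ltW A0) ?exprn_ge0 ?(ltW H0)//.
  by apply: lerXn2r; rewrite // nnegrE ltW.
apply: (@le_trans _ _ (B ^+ (p + t).+1 * M p * (B ^+ (N * t.+1) * (M s * M p ^+ N)))).
  have g0 q : 0 <= M q by apply: ltW; exact: weight_gt0.
  apply: ler_pM => //.
    by rewrite !mulr_ge0 ?exprn_ge0 ?(ltW A0) ?(ltW H0).
  by rewrite ler_pM2r ?weight_gt0.
have -> : B ^+ (p + t).+1 * M p * (B ^+ (N * t.+1) * (M s * M p ^+ N)) =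
   B ^+ ((p + t).+1 + N * t.+1) * (M s * M p ^+ N.+1) by rewrite exprD [_ ^+ N.+1]exprS; ring.
rewrite ler_pM2r ?mulr_gt0 ?exprn_gt0 ?weight_gt0// ler_weXn2l// mulSn leq_add2l leq_mul2l ltnS leq_addl orbT//.
Qed.

(** The decreasing terms of a convergent series satisfy p a_p = O(1): non-quasianalyticity makes the weights
    grow at least like factorials, so that analytic step lengths are affordable. *)
Lemma weight_fact_le : exists2 C : R, 1 <= C & forall p, p`!%:R <= C ^+ p * M p.
Proof.
have [[_ M0] _ _ cv] := wM.
pose a p := M p / M p.+1; pose L := limn (series a).
have a0 p : 0 < a p by rewrite divr_gt0// weight_gt0.
have sL p : series a p <= L.
  apply: nondecreasing_cvgn_le => //; apply: nondecreasing_series => k _ _; exact: ltW.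
have L0 : 0 <= L by have := sL 0%N; rewrite /series /= big_geq.
have C1 : 1 <= 1 + L by rewrite lerDl.
have C0 : 0 < 1 + L by exact: lt_le_trans C1.
exists (1 + L) => //; elim=> [|p IH]; first by rewrite expr0 M0 mulr1.
have pa : p.+1%:R * a p <= 1 + L.
  rewrite (le_trans _ (le_trans (sL p.+1) _)) ?lerDr//.
  rewrite /series /= -[p.+1%:R]/(1 *+ p.+1) mulrnAl mul1r -[X in _ *+ X]subn0 -sumr_const_nat.
  by apply: ler_sum_nat => k /andP[_ kp]; exact: weight_ratio_le.
rewrite factS natrM (le_trans (ler_wpM2l _ IH))// mulrCA exprSr -mulrA ler_pM2l ?exprn_gt0//.
have -> : p.+1%:R * M p = p.+1%:R * a p * M p.+1.
  by rewrite /a -mulrA divfK// gt_eqF// weight_gt0.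
by rewrite ler_pM2r// weight_gt0.
Qed.

End Weights.

Section GornyLine.
Context {R : realType} {n : nat}.
Implicit Types (x y c : 'rV[R]_n) (g : 'rV[R]_n -> R) (Omega Q : set 'rV[R]_n).
Local Notation e i := (delta_mx 0 i : 'rV[R]_n).

(** The Taylor polynomial of degree q - 1 is bounded on the segment by A + B h^q / q!, and so are its
    coefficients, up to the factor k^q. *)
Lemma gorny_line : exists2 k : R, 1 <= k & forall Omega g x i (h A B : R) p q, smoothR Omega g ->
  (p < q)%N -> 0 <= A -> 0 <= B ->
  (forall t, 0 <= t <= 1 -> Omega (x + (t * h) *: e i)) ->
  (forall t, 0 <= t <= 1 -> `|g (x + (t * h) *: e i)| <= A) ->
  (forall t, 0 <= t <= 1 -> `|iter_partial (nseq q i) g (x + (t * h) *: e i)| <= B) ->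
  `|iter_partial (nseq p i) g x| * `|h| ^+ p <= p`!%:R * (k ^+ q * (A + B * `|h| ^+ q / q`!%:R)).
Proof.
have [k k1 Hk] := @poly_coef_bound R; exists k => //.
move=> Omega g x i h A B p q sg pq A0 B0 hO hA hB.
pose P := \poly_(j < q) (iter_partial (nseq j i) g x * h ^+ j / j`!%:R).
have H : `|P`_p| <= k ^+ q * (A + B * `|h| ^+ q / q`!%:R).
  apply: Hk; [exact: leq_ltn_trans pq|exact: size_poly|].
  move=> t /andP[t0 t1]; rewrite horner_poly.
  have seg s : 0 <= s <= 1 -> 0 <= s * t <= 1.
    by move=> /andP[s0 s1]; rewrite mulr_ge0//= mulr_ile1.
  have := @taylor_line _ _ Omega g x i (t * h) B q sg _ _.
  set S1 := \sum_(_ < _) _ => T; set S2 := \sum_(_ < _) _.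
  have -> : S2 = S1.
    apply: eq_bigr => j _; rewrite exprMn; ring.
  have {}T : `|g (x + (t * h) *: e i) - S1| <= B * `|t * h| ^+ q / q`!%:R.
    by apply: T => s /seg st; rewrite mulrA; [exact: hO|exact: hB].
  have -> : S1 = g (x + (t * h) *: e i) - (g (x + (t * h) *: e i) - S1) by rewrite subKr.
  apply: le_trans (ler_normB _ _) _; apply: lerD; first by apply: hA; rewrite t0.
  apply: le_trans T _; rewrite ler_wpM2r ?invr_ge0// ler_wpM2l//.
  apply: lerXn2r; rewrite ?nnegrE// normrM ger0_norm//.
  by rewrite ler_piMl.
move: H; rewrite coef_poly pq !normrM normrX normfV [X in _ / X]ger0_norm// => H.
have f0 : 0 < p`!%:R :> R by rewrite ltr0n fact_gt0.
by rewrite -ler_pdivrMl// mulrC.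
Qed.

End GornyLine.

(** * Interpolation with weights *)

Lemma fact_pow_le N p : (p`! ^ N <= (N * p)`!)%N.
Proof.
elim: N => [|N IH]; first by rewrite expn0 mul0n.
rewrite expnS mulSn -(bin_fact (leq_addr (N * p) p)) addKn.
apply: leq_trans (leq_pmull _ _); first by rewrite leq_mul2l IH orbT.
by rewrite bin_gt0 leq_addr.
Qed.

Section GornyArith.
Context {R : realType}.

(** Division of Gorny's inequality by h^p. *)
Lemma gorny_arith1 (D X F k A B th E Mp : R) (N : nat) (G : R) : 0 < X -> 0 < F -> 0 < E -> 0 < Mp -> 0 < th ->
  X = th * (F * E / Mp) -> D * X <= F * (k * (A * E ^+ 2 + B * X ^+ N.+1 / G)) ->
  D <= th^-1 * k * A * Mp * E + k * B * (F * X ^+ N / G).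
Proof.
move=> X0 F0 E0 M0 t0 XE; rewrite -ler_pdivlMr//; move=> h; apply: le_trans h _.
rewrite le_eqVlt; apply/orP; left; apply/eqP.
have -> : F * (k * (A * E ^+ 2 + B * X ^+ N.+1 / G)) / X = F / X * (k * A * E ^+ 2) + k * B * (F * X ^+ N / G).
  rewrite [X ^+ N.+1]exprS; move: (X ^+ N) G^-1 => Y Z.
  by field; rewrite gt_eqF.
congr (_ + _); rewrite XE; field.
by rewrite !gt_eqF.
Qed.

(** Here p!^N <= (N p)! removes the factorials. *)
Lemma gorny_arith2 (F X th E Mp eps W Ms G : R) (b : nat) : 0 < F -> 0 < E -> E <= eps -> 0 < Mp ->
  0 < th <= 1 -> X = th * (F * E / Mp) -> 0 < G -> F ^+ b.+2 <= G -> 0 <= W -> 0 <= Ms ->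
  (W * (Ms * Mp ^+ b.+2) * eps ^- b) * (F * X ^+ b.+1 / G) <= W * Ms * Mp * E.
Proof.
move=> F0 E0 Ee M0 /andP[t0 t1] XE G0 FG W0 Ms0.
have e0 : 0 < eps by exact: lt_le_trans Ee.
have t2 : 0 <= th ^+ b.+1 <= 1 by rewrite exprn_ge0 ?(ltW t0)//= exprn_ile1// ltW.
have FG1 : 0 <= F ^+ b.+2 / G <= 1.
  by rewrite ler_pdivrMr// mul1r FG divr_ge0 ?exprn_ge0// ltW.
have Ee1 : 0 <= (E / eps) ^+ b <= 1.
  have Ee0 : 0 <= E / eps by rewrite divr_ge0// ltW.
  by rewrite exprn_ge0//= exprn_ile1// ler_pdivrMr// mul1r.
have -> : (W * (Ms * Mp ^+ b.+2) * eps ^- b) * (F * X ^+ b.+1 / G) =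
   (W * Ms * Mp * E) * (th ^+ b.+1 * (F ^+ b.+2 / G * (E / eps) ^+ b)).
  rewrite XE !exprMn !exprVn !exprS; field.
  by rewrite !gt_eqF// ?exprn_gt0.
have P0 : 0 <= W * Ms * Mp * E by rewrite !mulr_ge0// ltW.
rewrite ler_piMr//; case/andP: t2 => u1 u2; case/andP: FG1 => u3 u4; case/andP: Ee1 => u5 u6.
by apply: mulr_ile1 => //; [exact: mulr_ge0|exact: mulr_ile1].
Qed.

Lemma pow_sum_le (x y : R) (m : nat) : 0 <= x -> 0 <= y -> x ^+ m.+1 + y ^+ m.+1 <= (x + y) ^+ m.+1.
Proof.
move=> x0 y0; elim: m => [|m IH]; first by rewrite !expr1.
rewrite [leRHS]exprS; apply: le_trans (ler_wpM2l (addr_ge0 x0 y0) IH).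
rewrite mulrDl !mulrDr -!exprS addrACA lerD ?lerDl ?lerDr ?mulr_ge0 ?exprn_ge0//.
Qed.

End GornyArith.

Section GornyCube.
Context {R : realType} {n : nat}.
Implicit Types (x y c : 'rV[R]_n) (g : 'rV[R]_n -> R) (Omega Q : set 'rV[R]_n) (l : seq 'I_n).

(** Derivatives grouped by coordinate, as in [mindices], but for a sublist of the coordinates. *)
Definition blocks l (a : 'I_n -> nat) : seq 'I_n := flatten [seq nseq (a i) i | i <- l].

Variable M : nat -> R.
Hypothesis wM : weight_sequence M.

(** Interpolation in one coordinate between order 0 and order N p, with N = b + 2, at the step length
    given by h^p = theta^p p! E / M_p.  The factor p! E / M_p turns p! / h^p into M_p / E, so that the
    error E^2 at order 0 becomes E M_p; at order N p the factor E^(N-1) eps^-b is at most E,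
    because E <= eps.  The constant theta keeps [h] below [r], because p! <= C^p M_p.  All other factors are geometric in s + p. *)
Lemma gorny_step (c : 'rV[R]_n) (r K L : R) (b : nat) : 0 < r -> 1 <= K -> 1 <= L ->
  exists2 E1 : R, 1 <= E1 & forall Omega g (E eps : R) s p i, smoothR Omega g ->
    (forall y, `|y - c| <= r -> Omega y) -> 0 < E -> E <= eps -> eps <= 1 ->
    (forall y, `|y - c| <= r -> `|g y| <= L ^+ s.+1 * M s * E ^+ 2) ->
    (forall q y, `|y - c| <= r -> `|iter_partial (nseq q i) g y| <= K ^+ (s + q).+1 * M (s + q)%N * eps ^- b) ->
    forall y, `|y - c| <= r -> `|iter_partial (nseq p i) g y| <= E1 ^+ (s + p).+1 * M (s + p)%N * E.
Proof.
move=> r0 K1 L1.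
have K0 : 0 < K by exact: lt_le_trans K1. have L0 : 0 < L by exact: lt_le_trans L1.
have [k k1 Hk] := @gorny_line R n; have [C C1 HC] := weight_fact_le wM.
have [W W1 HW] := weight_iter_le wM.
have k0 : 0 < k by exact: lt_le_trans k1. have C0 : 0 < C by exact: lt_le_trans C1.
have W0 : 0 < W by exact: lt_le_trans W1.
pose N := b.+2; pose r' := Num.min 1 r; pose th := r' / C.
have r'0 : 0 < r' by rewrite lt_min ltr01.
have r'1 : r' <= 1 by rewrite ge_min lexx.
have r'r : r' <= r by rewrite ge_min lexx orbT.
have th0 : 0 < th by rewrite divr_gt0.
have th1 : th <= 1 by rewrite ler_pdivrMr// mul1r (le_trans r'1).
have ti : 1 <= th^-1 by rewrite invf_ge1.
pose E1 := th^-1 * k ^+ N * L; pose E2 := k ^+ N * K ^+ N * W ^+ (N * N).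
have E11 : 1 <= E1.
  by apply: mulr_ege1 => //; apply: mulr_ege1 => //; exact: exprn_ege1.
have E21 : 1 <= E2 by apply: mulr_ege1; [apply: mulr_ege1|]; exact: exprn_ege1.
exists (E1 + E2); first by rewrite (le_trans E11)// lerDl (le_trans ler01).
move=> Omega g E eps s p i sg rO E0 Ee e1 gL gK y yr.
have e0 : 0 < eps by exact: lt_le_trans Ee.
have E1' : E <= 1 by exact: le_trans e1.
have g0 q : 0 < M q by exact: weight_gt0.
have E12 : E1 ^+ (s + p).+1 <= (E1 + E2) ^+ (s + p).+1.
  by apply: lerXn2r; rewrite ?nnegrE ?addr_ge0 ?(le_trans ler01 E11) ?(le_trans ler01 E21)// lerDl (le_trans ler01).
have LE : L <= E1.
  by rewrite /E1 ler_peMl ?(ltW L0)// mulr_ege1// exprn_ege1.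
have [->|p0] := posnP p.
  rewrite addn0 /=; apply: le_trans (gL y yr) _; rewrite expr2.
  have LE' : L ^+ s.+1 <= (E1 + E2) ^+ s.+1.
    apply: lerXn2r; rewrite ?nnegrE ?(ltW L0) ?addr_ge0 ?(le_trans ler01 E11) ?(le_trans ler01 E21)//.
    by rewrite (le_trans LE)// lerDl (le_trans ler01).
  apply: ler_pM; rewrite ?mulr_ge0 ?exprn_ge0 ?(ltW L0) ?(ltW E0) ?(ltW (g0 _))//.
    by rewrite ler_pM2r.
  by rewrite ler_piMr// ltW.
have F0 : 0 < p`!%:R :> R by rewrite ltr0n fact_gt0.
pose X := th ^+ p * (p`!%:R * E / M p).
have X0 : 0 < X by rewrite !mulr_gt0 ?exprn_gt0 ?invr_gt0.
have Xr : X <= r' ^+ p.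
  have -> : r' ^+ p = th ^+ p * C ^+ p by rewrite -exprMn divfK// gt_eqF.
  rewrite /X ler_pM2l ?exprn_gt0// ler_pdivrMr// (le_trans _ (HC p))//.
  by rewrite ler_piMr// ltW.
have X1 : X <= 1 by rewrite (le_trans Xr)// exprn_ile1// ltW.
(* the step length as a p-th root *)
have [h /andP[h0 h1] hX] := @root_scale _ X p.-1 (introT andP (conj X0 X1)).
rewrite prednK// in hX.
have hr : 0 <= h <= r.
  rewrite ltW//= (le_trans _ r'r)//; rewrite -hX in Xr.
  by move: Xr; rewrite ler_pXn2r// nnegrE ltW.
have pq : (p < N * p)%N by rewrite ltn_Pmull.
have A0 : 0 <= L ^+ s.+1 * M s * E ^+ 2 by rewrite !mulr_ge0 ?exprn_ge0 ?(ltW L0) ?(ltW E0) ?(ltW (g0 _)).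
have B0 : 0 <= K ^+ (s + N * p).+1 * M (s + N * p)%N * eps ^- b.
  by rewrite !mulr_ge0 ?invr_ge0 ?exprn_ge0 ?(ltW K0) ?(ltW e0) ?(ltW (g0 _)).
have G : `|iter_partial (nseq p i) g y| * h ^+ p <= p`!%:R * (k ^+ (N * p) * (L ^+ s.+1 * M s * E ^+ 2 +
    K ^+ (s + N * p).+1 * M (s + N * p)%N * eps ^- b * h ^+ (N * p) / (N * p)`!%:R)).
  have [seg|seg] := cube_segment i hr yr.
    have := Hk Omega g y i h _ _ p (N * p)%N sg pq A0 B0 (fun t t01 => rO _ (seg t t01))
      (fun t t01 => gL _ (seg t t01)) (fun t t01 => gK _ _ (seg t t01)).
    by rewrite (gtr0_norm h0).
  have := Hk Omega g y i (- h) _ _ p (N * p)%N sg pq A0 B0 (fun t t01 => rO _ (seg t t01))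
      (fun t t01 => gL _ (seg t t01)) (fun t t01 => gK _ _ (seg t t01)).
  by rewrite normrN (gtr0_norm h0).
have hN : h ^+ (N * p) = X ^+ b.+2 by rewrite mulnC exprM hX.
rewrite hX hN in G.
have thp : 0 < th ^+ p by rewrite exprn_gt0.
have D := gorny_arith1 X0 F0 E0 (g0 p) thp erefl G.
apply: le_trans D _.
have sp : M s * M p <= M (s + p)%N by exact: weight_mul_le.
have c1 : (th ^+ p)^-1 * k ^+ (N * p) * (L ^+ s.+1 * M s) * M p * E <= E1 ^+ (s + p).+1 * M (s + p)%N * E.
  rewrite ler_pM2r//.
  have -> : (th ^+ p)^-1 * k ^+ (N * p) * (L ^+ s.+1 * M s) * M p = ((th^-1 * k ^+ N) ^+ p * L ^+ s.+1) * (M s * M p).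
    by rewrite (exprM k) (exprMn _ th^-1) exprVn; ring.
  have tk1 : 1 <= th^-1 * k ^+ N by rewrite mulr_ege1// exprn_ege1.
  apply: ler_pM => //; rewrite ?mulr_ge0 ?exprn_ge0 ?(ltW (g0 _)) ?(ltW L0) ?(le_trans ler01 tk1)//.
  rewrite [leRHS]exprMn; apply: ler_pM; rewrite ?exprn_ge0 ?(ltW L0) ?(le_trans ler01 tk1)//.
    by apply: ler_weXn2l => //; rewrite leqW// leq_addl.
  by apply: ler_weXn2l => //; rewrite ltnS leq_addr.
have GF : p`!%:R ^+ b.+2 <= (N * p)`!%:R :> R by rewrite -natrX ler_nat fact_pow_le.
have Gp : 0 < (N * p)`!%:R :> R by rewrite ltr0n fact_gt0.
have c2 : k ^+ (N * p) * (K ^+ (s + N * p).+1 * M (s + N * p)%N * eps ^- b) *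
    (p`!%:R * X ^+ b.+1 / (N * p)`!%:R) <= E2 ^+ (s + p).+1 * M (s + p)%N * E.
  pose Wt := k ^+ (N * p) * K ^+ (s + N * p).+1 * W ^+ (N * (s + N * p).+1).
  have Wt0 : 0 <= Wt by rewrite !mulr_ge0 ?exprn_ge0 ?(ltW k0) ?(ltW K0) ?(ltW W0).
  have th01 : 0 < th ^+ p <= 1 by rewrite thp exprn_ile1// ltW.
  have A2 := gorny_arith2 F0 E0 Ee (g0 p) th01 erefl Gp GF Wt0 (ltW (g0 s)).
  apply: le_trans (le_trans _ A2) _.
    apply: ler_wpM2r; first by rewrite !mulr_ge0 ?invr_ge0 ?exprn_ge0 ?(ltW X0) ?(ltW Gp) ?(ltW F0).
    rewrite mulrA; apply: ler_wpM2r; first by rewrite invr_ge0 exprn_ge0// ltW.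
    rewrite /Wt mulrA -[leRHS]mulrA; apply: ler_wpM2l; last exact: HW.
    by rewrite mulr_ge0 ?exprn_ge0// ltW.
  rewrite ler_pM2r// -mulrA; apply: ler_pM => //; first by rewrite mulr_ge0// ltW.
  have sN : ((s + N * p).+1 <= N * (s + p).+1)%N.
    by rewrite -addSn -[(s + p).+1]addSn mulnDr leq_add2r leq_pmull.
  have -> : E2 ^+ (s + p).+1 = k ^+ (N * (s + p).+1) * K ^+ (N * (s + p).+1) * W ^+ (N * N * (s + p).+1).
    by rewrite !(exprM _ N) (exprM _ (N * N)) /E2; move: (k ^+ N) (K ^+ N) (W ^+ _) => ? ? ?; rewrite !exprMn.
  apply: ler_pM; rewrite ?mulr_ge0 ?exprn_ge0 ?(ltW k0) ?(ltW K0) ?(ltW W0)//; last first.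
    by apply: ler_weXn2l => //; rewrite -mulnA leq_mul2l sN orbT.
  apply: ler_pM; rewrite ?exprn_ge0 ?(ltW k0) ?(ltW K0)//; last by apply: ler_weXn2l.
  by apply: ler_weXn2l => //; rewrite leq_mul2l leqW ?orbT// leq_addl.
apply: le_trans (lerD c1 c2) _; rewrite -!mulrDl ler_pM2r// ler_pM2r//.
by apply: pow_sum_le; [exact: le_trans ler01 E11|exact: le_trans ler01 E21].
Qed.

(** Induction on the coordinates; each of them costs half of the exponent of [eps], which is why the
    assumption has the exponent 2^(size l) gam. *)
Lemma gorny_cube (c : 'rV[R]_n) (r K : R) (b : nat) : 0 < r -> 1 <= K ->
  forall l (gam : nat) (L0 : R), (0 < gam)%N -> 1 <= L0 -> exists2 E1 : R, 1 <= E1 &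
    forall Omega g (eps : R), smoothR Omega g -> (forall y, `|y - c| <= r -> Omega y) -> 0 < eps <= 1 ->
    (forall s y, `|y - c| <= r -> `|iter_partial s g y| <= K ^+ (size s).+1 * M (size s) * eps ^- b) ->
    (forall y, `|y - c| <= r -> `|g y| <= L0 * eps ^+ (2 ^ size l * gam)) ->
    forall a y, `|y - c| <= r -> `|iter_partial (blocks l a) g y| <=
       E1 ^+ (size (blocks l a)).+1 * M (size (blocks l a)) * eps ^+ gam.
Proof.
move=> r0 K1; have [[_ M0] _ _ _] := wM.
elim=> [|i l IH] gam L0 gam0 L01.
  exists L0 => // Omega g eps sg rO e01 gK g0 a y yr.
  by rewrite /= expr1 M0 mulr1 -[X in eps ^+ X]mul1n; exact: g0.
have gam20 : (0 < 2 * gam)%N by rewrite muln_gt0.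
have [L L1 HL] := IH (2 * gam)%N L0 gam20 L01.
have [E1 E11 HE] := gorny_step c b r0 K1 L1; exists E1 => // Omega g eps sg rO e01 gK g0 a y yr.
have [e0 e1] := andP e01.
rewrite /blocks /= -/(blocks l a) iter_partial_cat size_cat size_nseq addnC.
apply: (HE Omega (iter_partial (blocks l a) g) (eps ^+ gam) eps) => //.
- exact: smoothR_iter.
- by rewrite exprn_gt0.
- by rewrite -(prednK gam0) exprS ler_piMr ?(ltW e0)// exprn_ile1// ltW.
- move=> z zr; rewrite -exprM mulnC; apply: (HL Omega) => // w wr.
  by rewrite mulnA -expnSr; exact: g0.
- move=> q z zr; rewrite -iter_partial_cat.
  by have := gK (nseq q i ++ blocks l a) z zr; rewrite size_cat size_nseq addnC.
Qed.

End GornyCube.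

(** * Regular nets that are distributions *)

Section Subset.
Context {R : realType} {n : nat}.
Implicit Types (x y c : 'rV[R]_n) (f : 'rV[R]_n -> R[i]) (rho : 'rV[R]_n -> R[i]).
Implicit Types (v : R -> 'rV[R]_n -> R) (u : @net R n) (Omega V Q K : set 'rV[R]_n) (M : nat -> R).

Lemma powR_neg_le (eps nu : R) (b : nat) : 0 < eps <= 1 -> nu <= b%:R -> eps `^ (- nu) <= eps ^- b.
Proof.
move=> /andP[e0 e1] nb; rewrite powRN lef_pV2 ?posrE ?powR_gt0 ?exprn_gt0//.
by rewrite -powR_mulrn ?(ltW e0)//; apply: ger_powR; rewrite ?e0.
Qed.

(** Bounded exponents may be replaced by a single integer. *)
Lemma reg_net_bound Omega M u K : weight_sequence M -> reg_net Omega M bounded_sequences u ->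
  compact K -> K `<=` Omega -> exists (b : nat) (C eps0 : R), 1 <= C /\ 0 < eps0 <= 1 /\
    forall (a : 'I_n -> nat) (eps : R), 0 < eps <= eps0 -> forall x, K x ->
      normc (partial a (u eps) x) <= C ^+ (mlen a).+1 * M (mlen a) * eps ^- b.
Proof.
move=> wM [su H] cK KO; have [N [[N0 [b Nb]] [C [eps0 [C0 [/andP[e0 e1] HC]]]]]] := H K cK KO.
exists (Num.bound b), (1 + C), eps0; split; first by rewrite lerDl ltW.
split; first by rewrite e0.
move=> a eps /andP[ep ee] x Kx; apply: le_trans (HC a eps _ x Kx) _; first by rewrite ep.
have M0 := weight_gt0 wM (mlen a).
apply: ler_pM; rewrite ?powR_ge0 ?mulr_ge0 ?exprn_ge0 ?(ltW C0) ?(ltW M0)//.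
  rewrite ler_pM2r//; apply: lerXn2r; rewrite ?nnegrE ?addr_ge0 ?(ltW C0)//.
  by rewrite lerDr.
apply: powR_neg_le; first by rewrite ep (le_trans ee).
rewrite (le_trans (Nb _))// ltW// archi_boundP//.
exact: le_trans (N0 0%N) (Nb 0%N).
Qed.

Lemma reg_net_moderate Omega M u : weight_sequence M -> reg_net Omega M bounded_sequences u ->
  moderate Omega u.
Proof.
move=> wM ru; split; first by case: ru.
move=> K a cK KO; have [b [C [eps0 [C1 [e01 H]]]]] := reg_net_bound wM ru cK KO.
exists b, (C ^+ (mlen a).+1 * M (mlen a)), eps0; split.
  by rewrite mulr_gt0 ?exprn_gt0 ?(lt_le_trans _ C1)//; exact: weight_gt0.
by split=> // eps ee x Kx; exact: H.
Qed.

Lemma reg_net_parts Omega M u K : weight_sequence M -> open Omega -> reg_net Omega M bounded_sequences u ->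
  compact K -> K `<=` Omega -> exists (b : nat) (C eps0 : R), 1 <= C /\ 0 < eps0 <= 1 /\
    forall s (eps : R), 0 < eps <= eps0 -> forall x, K x ->
      `|iter_partial s (re_net u eps) x| <= C ^+ (size s).+1 * M (size s) * eps ^- b /\
      `|iter_partial s (im_net u eps) x| <= C ^+ (size s).+1 * M (size s) * eps ^- b.
Proof.
move=> wM oO ru cK KO; have [b [C [eps0 [C1 [/andP[e0 e1] H]]]]] := reg_net_bound wM ru cK KO.
exists b, C, eps0; split=> //; split; first by rewrite e0.
move=> s eps /andP[ep ee] x Kx.
have [s1 s2] : smooth Omega (u eps) by apply: (proj1 ru); rewrite ep (le_trans ee).
have := H (fun i => count_mem i s) eps (introT andP (conj ep ee)) x Kx; rewrite mlen_count => h.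
rewrite (iter_partial_mindices s oO s1 (KO x Kx)) (iter_partial_mindices s oO s2 (KO x Kx)).
split; apply: le_trans h.
  exact: (Re_le_normc (partial _ (u eps) x)).
exact: (Im_le_normc (partial _ (u eps) x)).
Qed.

(** Sum of the dyadic increments, estimated by [gorny_cube] with the exponent 1. *)
Lemma limit_ultradiff Omega M v (g : 'rV[R]_n -> R) c (r C eps0 : R) (b : nat) : weight_sequence M ->
  open Omega -> 0 < r -> (forall y, `|y - c| <= r -> Omega y) ->
  (forall eps, 0 < eps <= 1 -> smoothR Omega (v eps)) -> 1 <= C -> 0 < eps0 <= 1 ->
  (forall s (eps : R), 0 < eps <= eps0 -> forall x, `|x - c| <= r ->
      `|iter_partial s (v eps) x| <= C ^+ (size s).+1 * M (size s) * eps ^- b) ->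
  cauchy_on [set y | `|y - c| <= r] v ->
  (forall s x, Omega x -> tends (fun j => iter_partial s (v (2^-1 ^+ j)) x) (iter_partial s g x)) ->
  exists2 E : R, 1 <= E & forall a y, `|y - c| <= r ->
    `|iter_partial (mindices a) g y| <= E ^+ (mlen a).+1 * M (mlen a).
Proof.
move=> wM oO r0 rO sv C1 /andP[e00 e01] vC ch tg.
have C0 : 0 < C by exact: lt_le_trans C1.
have m0 : (0 < 2 ^ size (enum 'I_n) * 1)%N by rewrite muln1 expn_gt0.
have [L L1 HL] := ch _ m0; have L0 : 0 < L by exact: lt_le_trans L1.
(* the factor 1 + 2^b accounts for the two members of an increment *)
pose K := C * (1 + 2 ^+ b).
have b1 : 1 <= 1 + 2 ^+ b :> R by rewrite lerDl exprn_ge0.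
have K1 : 1 <= K by rewrite mulr_ege1.
have [E E1 HE] := gorny_cube wM c b r0 K1 (enum 'I_n) (ltn0Sn 0) L1.
have E0 : 0 < E by exact: lt_le_trans E1.
have mn0 : 0 < Num.min eps0 L^-1 by rewrite lt_min e00 invr_gt0.
have [J HJ] := dyadic_small mn0.
pose B := (2^-1 ^+ J) ^- b : R.
have B0 : 0 < B by rewrite invr_gt0 !exprn_gt0 ?invr_gt0.
have B1 : 1 <= B by rewrite invf_ge1 ?exprn_gt0 ?invr_gt0// exprn_ile1//; case/andP: (@half_pow R J) => // /ltW.
exists (2 * E + C * B).
  by rewrite (le_trans E1)// (le_trans _ (_ : 2 * E <= _)) ?lerDl ?mulr_ge0 ?(ltW C0) ?(ltW B0)// ler_peMl ?(ltW E0)// ler1n.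
move=> a y yr; rewrite -size_mindices; set s := mindices a.
have Ms := weight_gt0 wM (size s).
have step j : (J <= j)%N -> `|iter_partial s (v (2^-1 ^+ j.+1)) y - iter_partial s (v (2^-1 ^+ j)) y| <=
    E ^+ (size s).+1 * M (size s) * 2^-1 ^+ j.
  move=> Jj; have := HJ j Jj; rewrite le_min => /andP[he hL].
  have [h0 h1] := andP (half_pow j : 0 < (2 : R)^-1 ^+ j <= 1).
  have hh : (2 : R)^-1 ^+ j.+1 <= 2^-1 ^+ j by rewrite exprS ler_piMl ?(ltW h0)// invf_le1// ler1n.
  have h0' : 0 < (2 : R)^-1 ^+ j.+1 by rewrite exprn_gt0// invr_gt0.
  have [sd dd] := smoothR_sub_fun oO (sv _ (half_pow j.+1)) (sv _ (half_pow j)).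
  rewrite -dd; last exact: rO.
  rewrite -[X in _ <= _ * X]expr1; apply: (HE Omega) => //.
  - by rewrite h0.
  - move=> s' z zr; rewrite dd; last exact: rO.
    have p1 := vC s' _ (introT andP (conj h0' (le_trans hh he))) z zr.
    have p2 := vC s' _ (introT andP (conj h0 he)) z zr.
    apply: le_trans (ler_normB _ _) _; apply: le_trans (lerD p1 p2) _.
    have -> : ((2 : R)^-1 ^+ j.+1) ^- b = 2 ^+ b * (2^-1 ^+ j) ^- b.
      by rewrite exprS (exprMn _ 2^-1) invfM; congr (_ * _); rewrite -exprVn invrK.
    have Ms' := weight_gt0 wM (size s').
    have i0 : 0 <= ((2 : R)^-1 ^+ j) ^- b by rewrite invr_ge0 exprn_ge0// ltW.
    have -> : C ^+ (size s').+1 * M (size s') * (2 ^+ b * (2^-1 ^+ j) ^- b) +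
      C ^+ (size s').+1 * M (size s') * (2^-1 ^+ j) ^- b =
      (1 + 2 ^+ b) * C ^+ (size s').+1 * M (size s') * (2^-1 ^+ j) ^- b by ring.
    apply: ler_wpM2r => //; rewrite ler_pM2r// /K exprMn mulrC ler_pM2l ?exprn_gt0//.
    by rewrite exprS ler_peMr ?(le_trans ler01 b1)// exprn_ege1.
  - by move=> z zr; rewrite distrC; apply: HL.
have c0 : 0 <= E ^+ (size s).+1 * M (size s) by rewrite mulr_ge0 ?exprn_ge0 ?(ltW E0) ?(ltW Ms).
have T := tends_rate c0 step (tg s y (rO y yr)) (leqnn J).
have vJ : `|iter_partial s (v (2^-1 ^+ J)) y| <= C ^+ (size s).+1 * M (size s) * B.
  apply: vC => //; have := HJ J (leqnn J); rewrite le_min => /andP[-> _].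
  by case/andP: (@half_pow R J) => ->.
rewrite -(subrK (iter_partial s (v (2^-1 ^+ J)) y) (iter_partial s g y)).
apply: le_trans (ler_normD _ _) _; apply: le_trans (lerD T vJ) _.
apply: (@le_trans _ _ (((2 * E) ^+ (size s).+1 + (C * B) ^+ (size s).+1) * M (size s))); last first.
  by rewrite ler_pM2r// pow_sum_le// mulr_ge0// ltW.
rewrite [leRHS]mulrDl; apply: lerD.
  rewrite mulrA mulrAC ler_pM2r//.
  have [_ h1] := andP (half_pow J : 0 < (2 : R)^-1 ^+ J <= 1).
  rewrite exprMn; apply: le_trans (_ : 2 * E ^+ (size s).+1 <= _).
    by rewrite ler_piMr// mulr_ge0// exprn_ge0// ltW.
  rewrite ler_pM2r ?exprn_gt0// exprS ler_peMr// exprn_ege1// ler1n//.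
rewrite mulrAC ler_pM2r// exprMn ler_pM2l ?exprn_gt0//.
by rewrite exprS ler_peMr ?(ltW B0)// exprn_ege1.
Qed.

Lemma ultradiff_of_local Omega M f : weight_sequence M -> smooth Omega f ->
  (forall x, Omega x -> exists2 r : R, 0 < r & exists2 E : R, 1 <= E & forall a y, `|y - x| <= r ->
    `|iter_partial (mindices a) (fun z => Re (f z)) y| <= E ^+ (mlen a).+1 * M (mlen a) /\
    `|iter_partial (mindices a) (fun z => Im (f z)) y| <= E ^+ (mlen a).+1 * M (mlen a)) ->
  ultradiff Omega M f.
Proof.
move=> wM sf H; split=> // K cK KO.
have mono (C C' : R) a : 0 < C -> C <= C' -> C ^+ (mlen a).+1 * M (mlen a) <= C' ^+ (mlen a).+1 * M (mlen a).
  move=> C0 CC; rewrite ler_pM2r ?(weight_gt0 wM)//; apply: lerXn2r; rewrite // nnegrE ltW//.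
  exact: lt_le_trans CC.
apply: (@compact_cube_ind R n K (fun A => exists c : R, 0 < c /\ forall (a : 'I_n -> nat) x, A x ->
   normc (partial a f x) <= c ^+ (mlen a).+1 * M (mlen a)) cK).
- by exists 1.
- by move=> A B AB [c [c0 h]]; exists c; split=> // a x /AB; exact: h.
- move=> A B [c [c0 h]] [c' [c0' h']]; exists (c + c'); split; first exact: addr_gt0.
  move=> a x [/h hx|/h' hx]; apply: le_trans (hx a) _; apply: mono => //.
    by rewrite lerDl ltW.
  by rewrite lerDr ltW.
move=> x Kx; have [r r0 [E E1 HE]] := H x (KO x Kx); exists r => //.
have E0 : 0 < E by exact: lt_le_trans E1.
exists (E + E); split; first exact: addr_gt0.
move=> a y yr; have [h1 h2] := HE a y yr.
apply: le_trans (normc_le _) _; apply: le_trans (lerD h1 h2) _.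
by rewrite -mulrDl ler_pM2r ?(weight_gt0 wM)// pow_sum_le// ltW.
Qed.

(** The limits of the real and imaginary parts of a representative give [f]. *)
Lemma reg_dist_colombeau_sub Omega M rho : open Omega -> weight_sequence M -> mollifier rho ->
  reg_colombeau Omega M bounded_sequences `&` dist_colombeau rho Omega `<=`
    ultradiff_colombeau Omega M.
Proof.
move=> oO wM mr _ [[u ru <-] [_ [T dT eT]]].
have mu := reg_net_moderate wM ru; have [su _] := mu.
have uT : dist_embedding rho Omega T u.
  by rewrite eT; split=> //; rewrite net_subxx; exact: negligible0.
have loc x : Omega x -> exists2 r : R, 0 < r & [/\ forall y, `|y - x| <= r -> Omega y,
     cauchy_on [set y | `|y - x| <= r] (re_net u), cauchy_on [set y | `|y - x| <= r] (im_net u) &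
     exists (b : nat) (C eps0 : R), 1 <= C /\ 0 < eps0 <= 1 /\
    forall s (eps : R), 0 < eps <= eps0 -> forall y, `|y - x| <= r ->
      `|iter_partial s (re_net u eps) y| <= C ^+ (size s).+1 * M (size s) * eps ^- b /\
      `|iter_partial s (im_net u eps) y| <= C ^+ (size s).+1 * M (size s) * eps ^- b].
  move=> Ox; have [r0 r00 rO] := open_cube oO Ox.
  have [b [C [eps0 [C1 [e01 H]]]]] := reg_net_parts wM oO ru (@compact_closed_cube R n x r0) rO.
  have [|r r0' ch] := local_cauchy (b := b) oO mr dT uT Ox r00.
    move=> s; have D0 : 0 < C ^+ (size s).+1 * M (size s).
      by rewrite mulr_gt0 ?(weight_gt0 wM)// exprn_gt0// (lt_le_trans _ C1).
    by split; exists (C ^+ (size s).+1 * M (size s)), eps0; split=> //; split=> // eps ee y Qy;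
      have [] := H s eps ee y Qy.
  exists (Num.min r0 r); first by rewrite lt_min r00.
  have mr0 y : `|y - x| <= Num.min r0 r -> `|y - x| <= r0.
    by move=> h; rewrite (le_trans h)// ge_min lexx.
  have mr' y : `|y - x| <= Num.min r0 r -> `|y - x| <= r.
    by move=> h; rewrite (le_trans h)// ge_min lexx orbT.
  split.
  - by move=> y /mr0 /rO.
  - move=> m m0; have [D D1 HD] := ch m m0; exists D => // eps eps' y h1 h2 h3 /mr' h4.
    by have [] := HD eps eps' y h1 h2 h3 h4.
  - move=> m m0; have [D D1 HD] := ch m m0; exists D => // eps eps' y h1 h2 h3 /mr' h4.
    by have [] := HD eps eps' y h1 h2 h3 h4.
  - by exists b, C, eps0; split=> //; split=> // s eps ee y /mr0 yr; exact: H.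
have md x (r : R) : (forall y, `|y - x| <= r -> Omega y) ->
    rmod (re_net u) [set y | `|y - x| <= r] /\ rmod (im_net u) [set y | `|y - x| <= r].
  by move=> rO; apply: (moderate_rmod oO mu (@compact_closed_cube R n x r)) => y /rO.
have [f1 [sf1 t1 n1]] : exists g, [/\ smoothR Omega g,
    (forall s x, Omega x -> tends (fun j => iter_partial s (re_net u (2^-1 ^+ j)) x) (iter_partial s g x)) &
    forall x (r : R), (forall y, `|y - x| <= r -> Omega y) -> cauchy_on [set y | `|y - x| <= r] (re_net u) ->
      rneg (fun eps y => re_net u eps y - g y) [::] [set y | `|y - x| <= r]].
  apply: net_limit_real => // [eps /su[] //|x /loc[r r0 [rO c1 _ _]]].
  by exists r => //; split=> //; have [] := md x r rO.
have [f2 [sf2 t2 n2]] : exists g, [/\ smoothR Omega g,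
    (forall s x, Omega x -> tends (fun j => iter_partial s (im_net u (2^-1 ^+ j)) x) (iter_partial s g x)) &
    forall x (r : R), (forall y, `|y - x| <= r -> Omega y) -> cauchy_on [set y | `|y - x| <= r] (im_net u) ->
      rneg (fun eps y => im_net u eps y - g y) [::] [set y | `|y - x| <= r]].
  apply: net_limit_real => // [eps /su[] //|x /loc[r r0 [rO _ c2 _]]].
  by exists r => //; split=> //; have [] := md x r rO.
pose f : 'rV[R]_n -> R[i] := fun x => (f1 x +i* f2 x)%C.
have sf : smooth Omega f by split.
have mf := moderate_sub oO mu (constant_moderate oO sf).
exists f; last first.
  symmetry; apply: gclassP => //; apply: negligible_of_local; first by case: mf.
  move=> x Ox; have [r r0 [rO c1 c2 _]] := loc x Ox; exists r => //; split=> //.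
  have [h1 h2] := moderate_rmod oO mf (@compact_closed_cube R n x r) rO.
  have e1 : re_net (net_sub u (fun=> f)) = fun eps y => re_net u eps y - f1 y.
    by apply/funext => eps; apply/funext => y; rewrite /re_net /net_sub cReD cReN.
  have e2 : im_net (net_sub u (fun=> f)) = fun eps y => im_net u eps y - f2 y.
    by apply/funext => eps; apply/funext => y; rewrite /im_net /net_sub cImD cImN.
  by split=> //; [rewrite e1; exact: n1|rewrite e2; exact: n2].
apply: ultradiff_of_local => // x Ox.
have [r r0 [rO c1 c2 [b [C [eps0 [C1 [e01 H]]]]]]] := loc x Ox; exists r => //.
have [E1 E11 H1] := limit_ultradiff wM oO r0 rO (fun eps ee => (su eps ee).1) C1 e01
  (fun s eps ee y yr => (H s eps ee y yr).1) c1 t1.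
have [E2 E21 H2] := limit_ultradiff wM oO r0 rO (fun eps ee => (su eps ee).2) C1 e01
  (fun s eps ee y yr => (H s eps ee y yr).2) c2 t2.
have E10 : 0 < E1 by exact: lt_le_trans E11. have E20 : 0 < E2 by exact: lt_le_trans E21.
exists (E1 + E2); first by rewrite (le_trans E11)// lerDl ltW.
move=> a y yr; have M0 := weight_gt0 wM (mlen a); split.
  apply: le_trans (H1 a y yr) _; rewrite ler_pM2r//; apply: lerXn2r; rewrite ?nnegrE ?addr_ge0 ?(ltW E10) ?(ltW E20)//.
  by rewrite lerDl ltW.
apply: le_trans (H2 a y yr) _; rewrite ler_pM2r//; apply: lerXn2r; rewrite ?nnegrE ?addr_ge0 ?(ltW E10) ?(ltW E20)//.
by rewrite lerDr ltW.
Qed.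

End Subset.

Theorem theorem9 (R : realType) (n : nat) (Omega : set 'rV[R]_n)
    (M : nat -> R) (rho : 'rV[R]_n -> complex R) :
  open Omega -> Omega !=set0 -> weight_sequence M -> mollifier rho ->
  reg_colombeau Omega M bounded_sequences `&` dist_colombeau rho Omega
    = ultradiff_colombeau Omega M.
Proof.
move=> oO _ wM mr; apply/seteqP; split.
  exact: reg_dist_colombeau_sub.
exact: ultradiff_colombeau_sub.
Qed.
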